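(* Let $B$ be a unital $*$-algebra over $\mathbf{C}$, let $(A,\mathcal{E})$ be a $B$-valued $*$-noncommutative probability space, and let $a\in A$. Then the following are equivalent: (a) $a$ is $B$-valued R-diagonal. (b) $\mathcal{E}(x_1x_2\cdots x_n)=0$ whenever $n\ge 1$, $i_0,i_1,\ldots,i_n\in\{1,2\}$ and $x_j\in\mathcal{P}_{i_{j-1},i_j}$ for $1\le j\le n$ (the sets $\mathcal P_{11},\mathcal P_{12},\mathcal P_{21},\mathcal P_{22}\subseteq A$ built from $a$ are defined in the context). (c) There is a $B$-valued $*$-noncommutative probability space $(\widetilde A,\widetilde{\mathcal{E}})$, an element $p\in\widetilde A$ and a unitary $u\in\widetilde A$ such that (i) $u$ normalizes $B$; (ii) $\widetilde{\mathcal{E}}(p)=0$ and, for all $k\ge1$ and all $b_1,\ldots,b_{2k}\in B$, $\widetilde{\mathcal{E}}(pb_1p^*b_2pb_3p^*b_4\cdots pb_{2k-1}p^*b_{2k}p)=0$; (iii) $\{u,u^*\}$ is free from $\{p,p^*\}$ with respect to $\widetilde{\mathcal{E}}$; (iv) $\widetilde{\mathcal{E}}(u)=0$; (v) $a$ and $up$ have the same $B$-valued $*$-distribution. (d) There is an enlargement $(\widetilde A,\widetilde{\mathcal{E}})$ of $(A,\mathcal{E})$ and a unitary $u\in\widetilde A$ such that (i) $u$ commutes with every element of $B$; (ii) $\{u,u^*\}$ is free from $\{a,a^*\}$ with respect to $\widetilde{\mathcal{E}}$; (iii) $\widetilde{\mathcal{E}}(u^k)=0$ for all integers $k\ge1$;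 (iv) $a$ and $ua$ have the same $B$-valued $*$-distribution. (e) If $(\widetilde A,\widetilde{\mathcal{E}})$ is an enlargement of $(A,\mathcal{E})$ and $u\in\widetilde A$ is a unitary such that (i) $u$ commutes with every element of $B$ and (ii) $\{u,u^*\}$ is free from $\{a,a^*\}$ with respect to $\widetilde{\mathcal{E}}$, then $a$ and $ua$ have the same $B$-valued $*$-distribution. (f) Consider the subalgebra $B^{(2)}=\left\{\begin{pmatrix} b^{(1)}&0\\ 0&b^{(2)}\end{pmatrix} : b^{(1)},b^{(2)}\in B\right\}\subseteq M_2(A)$, the conditional expectation $\mathcal{E}^{(2)}:M_2(A)\to B^{(2)}$ given by $\mathcal{E}^{(2)}\begin{pmatrix} a_{11}&a_{12}\\ a_{21}&a_{22}\end{pmatrix}=\begin{pmatrix} \mathcal{E}(a_{11})&0\\ 0&\mathcal{E}(a_{22})\end{pmatrix}$, the subalgebra $M_2(B)\subseteq M_2(A)$, and $z=\begin{pmatrix}0&a\\ a^*&0\end{pmatrix}$. Then $\{z\}$ and $M_2(B)$ are free with respect to $\mathcal{E}^{(2)}$ (i.e., with amalgamation over $B^{(2)}$). (g) Letting $a_1=a$ and $a_2=a^*$, for every $n\ge1$ and $j=(j(1),\ldots,j(n))\in\{1,2\}^n$, the $B$-valued cumulant map $\alpha_j$ of the pair $(a_1,a_2)$ is equal to zero if $j$ is either not alternating or not of even length, i.e., if $j$ is not of the form $(1,2,1,2,\ldots,1,2)$ or $(2,1,2,1,\ldots,2,1)$.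
   Context: A $B$-valued $*$-noncommutative probability space is a pair $(A,\mathcal{E})$ where $A$ is a unital $*$-algebra over $\mathbf{C}$ containing a unitally embedded copy of the $*$-algebra $B$ and $\mathcal{E}:A\to B$ is a $*$-preserving conditional expectation: linear, $\mathcal{E}(b)=b$ for $b\in B$, and $\mathcal{E}(b_1ab_2)=b_1\mathcal{E}(a)b_2$ for $a\in A$, $b_1,b_2\in B$. An enlargement of $(A,\mathcal{E})$ is a $B$-valued $*$-noncommutative probability space $(\widetilde A,\widetilde{\mathcal{E}})$ with an embedding $A\hookrightarrow\widetilde A$ that is the identity on $B$ and such that $\widetilde{\mathcal{E}}$ restricts to $\mathcal{E}$ on $A$. A unitary $u$ satisfies $u^*u=uu^*=1$; it normalizes $B$ if $ubu^*\in B$ and $u^*bu\in B$ for all $b\in B$. Subsets $S_1,S_2$ of $A$ are free (over $B$) with respect to $\mathcal{E}$ if, with $A_i$ the subalgebra generated by $B\cup S_i$, $\mathcal{E}(y_1\cdots y_n)=0$ whenever $n\ge1$, $y_k\in A_{i_k}$, $\mathcal{E}(y_k)=0$ and $i_k\ne i_{k+1}$ for all $k$. (In (f) the same definition is used with $B^{(2)}$, $\mathcal{E}^{(2)}$.) Two elements have the same $B$-valued $*$-distribution if all $*$-moments $\mathcal{E}(a^{\epsilon(1)}b_1a^{\epsilon(2)}\cdots b_{n-1}a^{\epsilon(n)})$ ($n\ge1$, $\epsilon(i)\in\{1,*\}$, $b_i\in B$) agree. R-diagonality: for $\epsilon\in\{1,*\}^n$, the maximal alternating interval partition $\sigma(\epsilon)$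 is the interval partition of $\{1,\ldots,n\}$ whose blocks $V$ are the maximal intervals such that $j,j+1\in V$ implies $\epsilon(j)\neq\epsilon(j+1)$. The element $a$ is $B$-valued R-diagonal if for every $k\ge0$ and $b_1,\ldots,b_{2k}\in B$, $\mathcal{E}(ab_1a^*b_2ab_3a^*\cdots b_{2k-2}ab_{2k-1}a^*b_{2k}a)=0$, and for every $n\ge1$, $\epsilon\in\{1,*\}^n$, $b_1,\ldots,b_n\in B$, $$\mathcal{E}\Big(\prod_{V\in\sigma(\epsilon)}\Big(\Big(\prod_{j\in V}a^{\epsilon(j)}b_j\Big)-\mathcal{E}\Big(\prod_{j\in V}a^{\epsilon(j)}b_j\Big)\Big)\Big)=0,$$ all products in order of increasing indices. The sets in (b): $\mathcal{P}_{11}=\{b_0ab_1a^*b_2ab_3a^*b_4\cdots ab_{2k-1}a^*b_{2k}ab_{2k+1}: k\ge0, b_i\in B\}$; $\mathcal{P}_{22}=\{b_0a^*b_1ab_2a^*b_3ab_4\cdots a^*b_{2k-1}ab_{2k}a^*b_{2k+1}: k\ge0, b_i\in B\}$; $\mathcal{P}_{12}=\{w-\mathcal{E}(w): w=b_0ab_1a^*b_2ab_3a^*b_4\cdots ab_{2k-1}a^*b_{2k}, k\ge1, b_i\in B\}$; $\mathcal{P}_{21}=\{w-\mathcal{E}(w): w=b_0a^*b_1ab_2a^*b_3ab_4\cdots a^*b_{2k-1}ab_{2k}, k\ge1, b_i\in B\}$. Cumulants: for a family $(a_i)_{i\in I}$ in $A$ the cumulant maps $\alpha_j:B^{n-1}\to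 B$ ($j\in I^n$, $n\ge 1$; an element of $B$ if $n=1$) are the $\mathbf{C}$-multilinear maps defined recursively by $\mathcal{E}(a_{j(1)}b_1a_{j(2)}\cdots b_{n-1}a_{j(n)})=\sum_{\pi\in NC(n)}\hat\alpha_j(\pi)[b_1,\ldots,b_{n-1}]$, the sum being over noncrossing partitions of $\{1,\dots,n\}$. Here $\hat\alpha_j(1_n)=\alpha_j$ for the one-block partition $1_n$; if $\pi\ne1_n$, choose an interval block $\{p,\ldots,p+q-1\}$ of $\pi$, let $\pi'\in NC(n-q)$ be $\pi$ with this block removed (renumbered), $j''=(j(p),\ldots,j(p+q-1))$, and $j'$ be $j$ with these entries removed; then $\hat\alpha_j(\pi)[b_1,\ldots,b_{n-1}]$ equals $\hat\alpha_{j'}(\pi')[b_1,\ldots,b_{p-2},b_{p-1}\alpha_{j''}(b_p,\ldots,b_{p+q-2})b_{p+q-1},b_{p+q},\ldots,b_{n-1}]$ if $p\ge2$, $p+q-1<n$; $\hat\alpha_{j'}(\pi')[b_1,\ldots,b_{p-2}]\,b_{p-1}\alpha_{j''}(b_p,\ldots,b_{n-1})$ if $p\ge2$, $p+q-1=n$; $\alpha_{j''}(b_1,\ldots,b_{q-1})\,b_q\,\hat\alpha_{j'}(\pi')[b_{q+1},\ldots,b_{n-1}]$ if $p=1$, $q<n$. *)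

(* Defs.v *)
From HB Require Import structures.
From mathcomp Require Import all_boot all_order all_algebra.
From mathcomp Require Import boolp classical_sets reals.
From mathcomp Require Import complex zify.

Set Implicit Arguments.
Unset Strict Implicit.
Unset Printing Implicit Defensive.

Import Order.TTheory GRing.Theory Num.Theory.

Local Open Scope ring_scope.

(** Unital *-algebras. [C] will be instantiated by [R[i]] for [R : realType]. *)

HB.mixin Record isStarAlgebra (C : numClosedFieldType) A
    of GRing.Algebra C A := {
  star : A -> A;
  starK : involutive star;
  starD : forall x y : A, star (x + y) = star x + star y;
  starM : forall x y : A, star (x * y) = star y * star x;
  starZ : forall (c : C) (x : A), star (c *: x) = (c^* : C) *: star x
}.

#[short(type="starAlgType")]
HB.structure Definition StarAlgebra (C : numClosedFieldType) :=
  { A of isStarAlgebra C A & GRing.Algebra C A }.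

Record ncps (C : numClosedFieldType) (B : starAlgType C) := Ncps {
  ncps_sort :> starAlgType C;
  emb : {lrmorphism B -> ncps_sort};
  emb_inj : injective emb;
  emb_star : forall b, emb (star b) = star (emb b);
  cexp : {linear ncps_sort -> B};
  cexp_emb : forall b, cexp (emb b) = b;
  cexp_bimod : forall b1 (x : ncps_sort) b2,
    cexp (emb b1 * x * emb b2) = b1 * cexp x * b2;
  cexp_star : forall x : ncps_sort, cexp (star x) = star (cexp x)
}.

Arguments emb {C B} n.
Arguments cexp {C B} n.

Record enlargement (C : numClosedFieldType) (B : starAlgType C)
    (A A' : ncps B) := Enlargement {
  enl :> {lrmorphism A -> A'};
  enl_inj : injective enl;
  enl_star : forall x, enl (star x) = star (enl x);
  enl_emb : forall b, enl (emb A b) = emb A' b;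
  enl_cexp : forall x, cexp A' (enl x) = cexp A x
}.

Section Freeness.
Variables (C : numClosedFieldType) (M : algType C) (V : zmodType).

Definition gen_subalg (X : set M) : set M :=
  smallest (fun S : set M => GRing.subalg_closed [in S]) X.

(** [D] is the subalgebra amalgamated over and [E] the conditional
    expectation onto it; the value [i k] selects [S1] ([false]) or [S2]
    ([true]). Only the first [n] terms of the sequences [i], [y] are used. *)
Definition free_over (D : set M) (E : M -> V) (S1 S2 : set M) : Prop :=
  forall (n : nat) (i : nat -> bool) (y : nat -> M),
    (0 < n)%N ->
    (forall k, (k < n)%N ->
       gen_subalg (D `|` (if i k then S2 else S1))%classic (y k)) ->
    (forall k, (k < n)%N -> E (y k) = 0) ->
    (forall k, (k.+1 < n)%N -> i k != i k.+1) ->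
    E (\prod_(0 <= k < n) y k) = 0.

End Freeness.

Section Elements.
Variables (C : numClosedFieldType) (B : starAlgType C).

Definition unitary (A : starAlgType C) (u : A) : Prop :=
  star u * u = 1 /\ u * star u = 1.

Definition normalizes (A : ncps B) (u : A) : Prop :=
  forall b, range (emb A) (u * emb A b * star u) /\
            range (emb A) (star u * emb A b * u).

Definition free_B (A : ncps B) (S1 S2 : set A) : Prop :=
  free_over (range (emb A)) (cexp A) S1 S2.

(** Exponents in [{1, *}] are booleans, [true] standing for [*]; likewise
    indices in [{1, 2}], [true] standing for [2]. *)
Definition spow (A : starAlgType C) (a : A) (e : bool) : A :=
  if e then star a else a.

(** [moment [:: x_1; ..; x_n] [:: b_1; ..; b_(n-1)]] is
    [E (x_1 b_1 x_2 .. b_(n-1) x_n)]. *)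
Definition moment (A : ncps B) (w : seq A) (b : seq B) : B :=
  cexp A ((\prod_(k < (size w).-1) (w`_k * emb A b`_k)) * w`_(size w).-1).

Definition same_star_dist (A A' : ncps B) (x : A) (x' : A') : Prop :=
  forall (eps : seq bool) (b : seq B), size eps = (size b).+1 ->
    moment [seq spow x e | e <- eps] b = moment [seq spow x' e | e <- eps] b.

Definition centered (A : ncps B) (x : A) : A := x - emb A (cexp A x).

(** [x b_1 y b_2 x b_3 y .. x b_(2k-1) y b_(2k)] *)
Definition alt_word (A : ncps B) (x y : A) (b : nat -> B) (k : nat) : A :=
  \prod_(i < k) (x * emb A (b i.*2.+1) * y * emb A (b i.*2.+2)).

End Elements.

Section MaximalAlternating.
Variables (n : nat) (eps : 'I_n -> bool).

Definition alternating_interval (V : {set 'I_n}) : bool :=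
  [forall i in V, forall j in V, forall k : 'I_n,
     (i <= k <= j)%N ==> (k \in V)] &&
  [forall i in V, forall j in V, (j == i.+1 :> nat) ==> (eps i != eps j)].

Definition max_alternating : {set {set 'I_n}} :=
  [set V : {set 'I_n} | maxset alternating_interval V].

End MaximalAlternating.

(** In the second condition there is one factor for each block, placed at the
    least element [i] of the block: the blocks are thus multiplied in
    increasing order. *)
Definition Rdiagonal (C : numClosedFieldType) (B : starAlgType C) (A : ncps B)
    (a : A) : Prop :=
  (forall (k : nat) (b : nat -> B),
     cexp A (alt_word a (star a) b k * a) = 0) /\
  (forall (n : nat) (eps : 'I_n -> bool) (b : 'I_n -> B), (0 < n)%N ->
     let block := finset.pblock (max_alternating eps) in
     cexp A (\prod_(i < n | [forall j in block i, (i <= j)%N])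
               centered (\prod_(j in block i)
                           (spow a (eps j) * emb A (b j)))) = 0).

Definition Pset (C : numClosedFieldType) (B : starAlgType C) (A : ncps B)
    (a : A) (i j : bool) : set A :=
  (match i, j with
  | false, false => [set x : A | exists k (b : nat -> B),
      x = emb A (b 0%N) * alt_word a (star a) b k * a * emb A (b k.*2.+1)]
  | true, true => [set x : A | exists k (b : nat -> B),
      x = emb A (b 0%N) * alt_word (star a) a b k
            * star a * emb A (b k.*2.+1)]
  | false, true => [set x : A | exists k (b : nat -> B), (0 < k)%N /\
      x = centered (emb A (b 0%N) * alt_word a (star a) b k)]
  | true, false => [set x : A | exists k (b : nat -> B), (0 < k)%N /\
      x = centered (emb A (b 0%N) * alt_word (star a) a b k)]
  end)%classic.

(** [M_2(A)] as an algebra over [C]. An alias is needed because ['M[A]_2]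
    canonically is a module over [A]. *)
Definition mx2 (C : numClosedFieldType) (A : algType C) : Type := 'M[A]_2.

Section Mx2.
Variables (C : numClosedFieldType) (A : algType C).

HB.instance Definition _ := GRing.NzRing.copy (mx2 A) 'M[A]_2.

Definition mx2_scale (c : C) (x : mx2 A) : mx2 A :=
  map_mx (fun y : A => c *: y) (x : 'M[A]_2).

Fact mx2_scaleA c d (x : mx2 A) :
  mx2_scale c (mx2_scale d x) = mx2_scale (c * d) x.
Proof. by apply/matrixP => i j; rewrite !mxE scalerA. Qed.

Fact mx2_scale1 : left_id 1 mx2_scale.
Proof. by move=> x; apply/matrixP => i j; rewrite !mxE scale1r. Qed.

Fact mx2_scaleDr : right_distributive mx2_scale +%R.
Proof. by move=> c x y; apply/matrixP => i j; rewrite !mxE scalerDr. Qed.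

Fact mx2_scaleDl (x : mx2 A) : {morph mx2_scale^~ x : c d / c + d}.
Proof. by move=> c d; apply/matrixP => i j; rewrite !mxE scalerDl. Qed.

HB.instance Definition _ := GRing.Zmodule_isLmodule.Build C (mx2 A)
  mx2_scaleA mx2_scale1 mx2_scaleDr mx2_scaleDl.

Fact mx2_scaleAl (c : C) (x y : mx2 A) : c *: (x * y) = (c *: x) * y.
Proof.
apply/matrixP => i j; rewrite !mxE scaler_sumr.
by apply: eq_bigr => k _; rewrite !mxE scalerAl.
Qed.

HB.instance Definition _ :=
  GRing.Lmodule_isLalgebra.Build C (mx2 A) mx2_scaleAl.

Fact mx2_scaleAr (c : C) (x y : mx2 A) : c *: (x * y) = x * (c *: y).
Proof.
apply/matrixP => i j; rewrite !mxE scaler_sumr.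
by apply: eq_bigr => k _; rewrite !mxE scalerAr.
Qed.

HB.instance Definition _ :=
  GRing.Lalgebra_isAlgebra.Build C (mx2 A) mx2_scaleAr.

Definition mk_mx2 (x11 x12 x21 x22 : A) : mx2 A :=
  \matrix_(i < 2, j < 2)
    if i == 0 then (if j == 0 then x11 else x12)
    else (if j == 0 then x21 else x22).

End Mx2.

Section Mx2Expectation.
Variables (C : numClosedFieldType) (B : starAlgType C) (A : ncps B).

Definition B2 : set (mx2 A) :=
  [set x | exists b1 b2 : B, x = mk_mx2 (emb A b1) 0 0 (emb A b2)]%classic.

Definition M2B : set (mx2 A) :=
  [set x | exists b11 b12 b21 b22 : B,
     x = mk_mx2 (emb A b11) (emb A b12) (emb A b21) (emb A b22)]%classic.

Definition cexp2 (x : mx2 A) : mx2 A :=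
  let y : 'M[A]_2 := x in
  mk_mx2 (emb A (cexp A (y 0 0))) 0 0 (emb A (cexp A (y 1 1))).

End Mx2Expectation.

Arguments B2 {C B} A _.
Arguments M2B {C B} A _.
Arguments cexp2 {C B} A _.

Section Noncrossing.
Variable n : nat.

Definition crossing (V W : {set 'I_n}) : bool :=
  [exists i in V, exists k in W, exists j in V, exists l in W,
     (i < k < j)%N && (j < l)%N].

Definition NC : {set {set {set 'I_n}}} :=
  [set P : {set {set 'I_n}} | finset.partition P [set: 'I_n] &
     [forall V in P, forall W in P, (V != W) ==> ~~ crossing V W]].

Definition one_block : {set {set 'I_n}} := [set [set: 'I_n]].

(** A partition is passed to [hat_rec] below as the word of the blocks of
    [1, .., n]; removing a block then amounts to deleting letters. *)
Definition labels (P : {set {set 'I_n}}) : seq {set 'I_n} :=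
  [seq finset.pblock P i | i <- enum 'I_n].

End Noncrossing.

Definition cut T (p q : nat) (s : seq T) : seq T := take p s ++ drop (p + q) s.

(** [starts_block c p]: the letters equal to the letter [t] of [c] at the
    (0-based) position [p] are exactly those at [p, .., p + q - 1], where
    [q = block_size c p]. *)
Definition block_size (T : eqType) (c : seq T) (p : nat) : nat :=
  if drop p c is t :: _ then count_mem t c else 0%N.

Definition starts_block (T : eqType) (c : seq T) (p : nat) : bool :=
  if drop p c is t :: _ then
    take (block_size c p) (drop p c) == nseq (block_size c p) t
  else false.

Definition first_block (T : eqType) (c : seq T) : nat :=
  find (starts_block c) (iota 0 (size c)).

Section Cumulants.
Variables (C : numClosedFieldType) (B : starAlgType C).

Section Hat.
Variables (I : Type) (alpha : seq I -> seq B -> B).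

(** The recursion removes the leftmost interval block; [m] bounds the number of
    blocks. The entry [b_k] is [b`_k.-1], and the three branches are the cases
    [p = 1], [p + q - 1 = n] and [p >= 2, p + q - 1 < n]. *)
Fixpoint hat_rec (T : eqType) (m : nat) (j : seq I) (c : seq T) (b : seq B)
    : B :=
  if constant c then alpha j b else
  if m isn't m'.+1 then 0 else
  let p := first_block c in
  let q := block_size c p in
  let v := alpha (take q (drop p j)) (take q.-1 (drop p b)) in
  let: (j', c') := (cut p q j, cut p q c) in
  if p == 0%N then v * b`_q.-1 * hat_rec m' j' c' (drop q b)
  else if (p + q)%N == size j then
    hat_rec m' j' c' (take p.-1 b) * b`_p.-1 * v
  else
    hat_rec m' j' c'
      (take p.-1 b ++ (b`_p.-1 * v * b`_(p + q).-1) :: drop (p + q) b).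

Definition hat n (j : seq I) (P : {set {set 'I_n}}) (b : seq B) : B :=
  hat_rec n j (labels P) b.

End Hat.

Variables (A : ncps B) (I : Type) (x : I -> A).

(** The moment-cumulant formula solved for the term of the one-block
    partition; [m] bounds the length of [j]. See [moment_cumulant]. *)
Fixpoint cumulant_rec (m : nat) (j : seq I) (b : seq B) : B :=
  match m, j with
  | m'.+1, _ :: _ =>
      moment (map x j) b -
      \sum_(P in NC (size j) | P != one_block (size j))
         hat (cumulant_rec m') j P b
  | _, _ => 0
  end.

Definition cumulant (j : seq I) (b : seq B) : B :=
  cumulant_rec (size j) j b.

Lemma labels_one_block n : constant (labels (one_block n)).
Proof.
case: n => [|n]; first by rewrite /labels enum_ord0.
have pb i : finset.pblock (one_block n.+1) i = [set: 'I_n.+1]%SET.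
  apply: def_pblock; rewrite ?inE //.
  by apply/finset.trivIsetP => V W /set1P-> /set1P->; rewrite eqxx.
rewrite /labels (eq_map pb) /constant.
by elim: (enum _) => //= _ l; case: l => //= _ l ->; rewrite eqxx.
Qed.

Lemma constant_labels n (P : {set {set 'I_n}}) : (0 < n)%N ->
  finset.partition P [set: 'I_n]%SET -> constant (labels P) -> P = one_block n.
Proof.
case: n P => // n P _ /and3P[/eqP covP trivP set0P] /constantP.
move=> /(_ finset.set0)[V cV].
have pb i : finset.pblock P i = V.
  have : finset.pblock P i \in labels P by apply/map_f; rewrite mem_enum.
  by rewrite cV mem_nseq => /andP[_ /eqP].
have pbi i : i \in V by rewrite -(pb i) mem_pblock covP inE.
have VT : V = [set: 'I_n.+1]%SET by apply/setP => i; rewrite pbi inE.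
apply/setP => W; rewrite inE -VT; apply/idP/eqP => [WP|->].
  have /set0Pn[i iW] : W != finset.set0 by apply: contraNneq set0P => <-.
  by rewrite -(pb i) (def_pblock trivP WP iW).
by rewrite -(pb ord0) pblock_mem // covP inE.
Qed.

Lemma hat_one_block (J : Type) (al : seq J -> seq B -> B) n j b :
  hat al j (one_block n) b = al j b.
Proof. by rewrite /hat; case: n => [|n] /=; rewrite labels_one_block. Qed.

Lemma size_cut T p q (s : seq T) : (size (cut p q s) <= size s)%N.
Proof. by rewrite size_cat size_drop size_take; case: ltnP; lia. Qed.

Lemma cut_id T p q (s : seq T) : size (cut p q s) = size s -> cut p q s = s.
Proof.
rewrite size_cat size_drop size_take /cut; case: ltnP => ps E.
  have -> : q = 0%N by lia.
  by rewrite addn0 cat_take_drop.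
by rewrite take_oversize // drop_oversize ?cats0 //; lia.
Qed.

Lemma size_first_block (T : eqType) (c : seq T) : ~~ constant c ->
  (size (take (block_size c (first_block c)) (drop (first_block c) c))
     < size c)%N.
Proof.
case: c => // t c; set s := t :: c; set p := first_block s => cN.
rewrite ltnNge; apply: contra cN; rewrite size_take_min size_drop => le_s.
have p0 : p = 0%N by rewrite /= in le_s; lia.
have : starts_block s p.
  have ps : (p < size (iota 0 (size s)))%N by rewrite size_iota p0.
  have := nth_find 0%N (etrans (has_find _ _) ps).
  by rewrite nth_iota // -[X in (X < _)%N]/p p0.
rewrite p0 /starts_block drop0 take_oversize; last by rewrite -p0; lia.
by move/eqP => {1}->; apply/(constantP t); exists t; rewrite size_nseq.
Qed.

Lemma eq_hat_rec (J : Type) (al1 al2 : seq J -> seq B -> B) (n : nat) :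
    (forall j b, (size j < n)%N -> al1 j b = al2 j b) ->
  forall (T : eqType) m j (c : seq T) b, size j = size c ->
    (size j < n)%N || (size j <= n)%N && ~~ constant c ->
  hat_rec al1 m j c b = hat_rec al2 m j c b.
Proof.
move=> eal T; elim=> [|m IHm] j c b sjc jn.
  by rewrite /=; case: ifP jn => // _; rewrite andbF orbF => /eal.
rewrite /=; case: ifP jn => [_|/negbT cN jn]; first by rewrite andbF orbF => /eal.
have {}jn : (size j <= n)%N by case/orP: jn => [/ltnW|/andP[]].
have := size_first_block cN; set p := first_block c; set q := block_size c p.
move=> sv; rewrite eal; last first.
  by apply: leq_trans jn; rewrite size_take_min size_drop sjc;
     move: sv; rewrite size_take_min size_drop.
have IH b' : hat_rec al1 m (cut p q j) (cut p q c) b' =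
             hat_rec al2 m (cut p q j) (cut p q c) b'.
  have ecut : size (cut p q j) = size (cut p q c).
    by rewrite !size_cat !size_drop !size_take_min sjc.
  apply: IHm => //; case: ltnP => //= nj.
  have /cut_id-> : size (cut p q c) = size c.
    by have := size_cut p q j; lia.
  by rewrite cN andbT; have := size_cut p q j; lia.
by rewrite !IH.
Qed.

Lemma eq_hat (J : Type) (al1 al2 : seq J -> seq B -> B) j P b :
    (forall j' b', (size j' < size j)%N -> al1 j' b' = al2 j' b') ->
    (0 < size j)%N -> P \in NC (size j) -> P != one_block (size j) ->
  hat al1 j P b = hat al2 j P b.
Proof.
move=> eal j0 /[!inE]/andP[partP _] P1.
apply: eq_hat_rec eal _ _ _ _ _ _ _.
  by rewrite size_map size_enum_ord.
rewrite leqnn ltnn; apply: contra P1 => cP.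
by apply/eqP/constant_labels.
Qed.

Lemma one_block_NC n : (0 < n)%N -> one_block n \in NC n.
Proof.
case: n => // n _; rewrite inE; apply/andP; split.
  apply/and3P; split; first by rewrite /finset.cover big_set1.
    by apply/finset.trivIsetP => V W /set1P-> /set1P->; rewrite eqxx.
  by rewrite inE eq_sym; apply/set0Pn; exists ord0; rewrite inE.
by apply/forall_inP => V /set1P->; apply/forall_inP => W /set1P->; rewrite eqxx.
Qed.

Lemma cumulant_rec_stable m j b : (size j <= m)%N ->
  cumulant_rec m j b = cumulant j b.
Proof.
rewrite /cumulant; elim/ltn_ind: m j b => -[|m] IH [|i j] b // jm.
rewrite /=; congr (_ - _); apply: eq_bigr => P /andP[PNC P1].
apply: (@eq_hat _ _ _ (i :: j)) => // j' b' j'j; rewrite (IH m) //; last by move: j'j jm => /=; lia.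
by rewrite (IH (size j)) //; move: j'j jm => /=; lia.
Qed.

(** The recursive definition of the cumulants. *)
Lemma moment_cumulant j b : (0 < size j)%N ->
  moment (map x j) b = \sum_(P in NC (size j)) hat cumulant j P b.
Proof.
move=> j0; rewrite (bigD1 (one_block _)) ?one_block_NC //=.
rewrite hat_one_block.
case: j j0 => [//|i j] _; rewrite {1}/cumulant [size (i :: j)]/=.
rewrite [cumulant_rec _ _ _]/=.
rewrite [X in _ = _ - X + _](eq_bigr (fun P => hat cumulant (i :: j) P b)) ?subrK //.
move=> P /andP[PNC P1]; apply: (@eq_hat _ _ _ (i :: j)) => // j' b' j'j.
exact: cumulant_rec_stable.
Qed.

End Cumulants.

(* Main.v *)
Require Import Defs.
From HB Require Import structures.
From mathcomp Require Import all_boot all_order all_algebra.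
From mathcomp Require Import boolp classical_sets reals.
From mathcomp Require Import complex zify.

Import Order.TTheory GRing.Theory Num.Theory.
Local Open Scope ring_scope.

Set Implicit Arguments.
Unset Strict Implicit.
Unset Printing Implicit Defensive.

(** The equivalences all go through one property of the moments of [a], called
    [Rdiag_moments]: odd alternating moments vanish, and so does the expectation
    of every product of centered alternating words in [a] and its adjoint in
    which two neighbouring words meet in equal letters.

    - R-diagonality says this about the decomposition of a word into its maximal
      alternating runs ([block_product], [RdiagonalP]), and products of elements
      of the sets P_ij are such products with coefficients of B on the left,
      which the preceding word absorbs ([Pset_productsP]).

    - If [u] is a unitary normalizing B and free from [p], an alternating word in
      [u * p] is a word in [p] flanked by powers of [u]; between two words that
      meet in equal letters exactly one of [u], [star u] survives.  Such a product
      is an alternating product of elements of two free algebras, and vanishes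
      after the factors are centered ([free_expansion]).  Centering costs nothing
      if [u] has expectation 0 ([Rdiag_up_centered]), and costs terms that vanish
      by induction if [p] itself has the property ([Rdiag_up_Rdiag]).

    - A moment functional with the property is determined by its even alternating
      moments, because expanding the centered product expresses any other moment
      by moments of shorter words ([eq_Rdiag_moments]).  Multiplication by a free
      unitary commuting with B does not change the even alternating moments, hence
      it leaves the whole distribution unchanged.

    - A free Haar unitary commuting with B always exists ([fp_free]).  The free
      product of A with the group ring of the integers acts on functions of
      reduced words, where the unitary shifts a label and A acts as the copy of
      A carrying the current label.  The enlargement is the product of A, which
      makes the embedding injective, of the algebra of operators, and of its
      conjugate opposite algebra; exchanging the last two factors is the
      involution.

    - For two by two matrices, the algebra generated by [z] and the diagonal
      matrices over B has alternating words as entries, while a centered matrix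
      over B is antidiagonal and flips the index.  An alternating product of
      centered matrices therefore has as entries exactly the sums of products
      considered in [Rdiag_moments].

    - Moments are recovered from cumulants by a process with a stack
      ([fock_moment]): letters are pushed one by one, and after each push some of
      the topmost letters may be replaced by the value of a cumulant.  If only
      even alternating cumulants are nonzero, then no block can reach below a
      place where two equal letters meet in the stack, so that a centered word
      always leaves letters on the stack and [Rdiag_moments] holds
      ([fock_Rdiag]).  Conversely, given [Rdiag_moments], compare the moments of
      [a] with those produced by its even alternating cumulants alone: by
      induction on the length and the uniqueness above, all moments agree, and
      with them all cumulants ([Rdiag_only_alternating]).  That the process
      computes the sum over noncrossing partitions is [fock_moment_hat]. *)

(** * Words in an element and its adjoint *)

Section Words.
Variables (C : numClosedFieldType) (B : starAlgType C).

Implicit Types (w : seq (bool * B)) (ws : seq (seq (bool * B))).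

(** A letter is a pair: an exponent, and the coefficient that follows it; the
    boolean [e] is the exponent that the next letter must have. *)
Fixpoint alternates (e : bool) w : bool :=
  if w is x :: w' then (x.1 == e) && alternates (~~ e) w' else true.

(** The parity of the size of [w] gives the exponent of its last letter, and
    the next word must start with this same exponent. *)
Fixpoint chain (e : bool) ws : bool :=
  if ws is w :: ws' then
    [&& (0 < size w)%N, alternates e w & chain (e (+) ~~ odd (size w)) ws']
  else true.

Lemma alternates_cat e w1 w2 :
  alternates e (w1 ++ w2) = alternates e w1 && alternates (e (+) odd (size w1)) w2.
Proof.
elim: w1 e => [|x w1 IH] e /=; first by rewrite addbF.
by rewrite IH -andbA addbN addNb.
Qed.

Lemma alternates_rcons e w x :
  alternates e (rcons w x) = alternates e w && (x.1 == e (+) odd (size w)).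
Proof. by rewrite -cats1 alternates_cat /= andbT. Qed.

Lemma chain_exists w : exists e ws, chain e ws /\ flatten ws = w.
Proof.
elim: w => [|x w [e [[|w1 ws] [cws <-]]]].
- by exists true; exists [::].
- by exists x.1; exists [:: [:: x]]; rewrite /= eqxx.
case/and3P: cws => w1_gt0 a1 cws.
have [xe|xe] := eqVneq x.1 e.
  exists e; exists ([:: x] :: w1 :: ws).
  by split=> //=; rewrite xe eqxx addbF w1_gt0 a1.
exists x.1; exists ((x :: w1) :: ws); split=> //=.
have -> : ~~ x.1 = e by case: (x.1) (e) xe => -[].
rewrite eqxx a1 negbK /=.
by move: cws; rewrite addbN; move: xe; case: (x.1) (e) => -[] //=; case: odd.
Qed.

Section Coefficients.
Variable I : Type.

(** A word preceded by a coefficient, so that multiplication by B on the right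
    also makes sense on the empty word. *)
Definition state : Type := B * seq (I * B).

Definition rmul (s : state) (v : B) : state :=
  if s.2 is x :: l
  then (s.1, rcons (belast x l) ((last x l).1, (last x l).2 * v))
  else (s.1 * v, [::]).

Lemma rmul_nil b v : rmul (b, [::]) v = (b * v, [::]).
Proof. by []. Qed.

Lemma rmul_rcons b l x v :
  rmul (b, rcons l x) v = (b, rcons l (x.1, x.2 * v)).
Proof. by rewrite /rmul /=; case: l => [|y l] //=; rewrite last_rcons belast_rcons. Qed.

Lemma rmulM s v1 v2 : rmul (rmul s v1) v2 = rmul s (v1 * v2).
Proof.
case: s => b l; elim/last_ind: l => [|l x _]; first by rewrite !rmul_nil mulrA.
by rewrite !rmul_rcons mulrA.
Qed.

Lemma rmul1 s : rmul s 1 = s.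
Proof.
case: s => b l; elim/last_ind: l => [|l x _]; first by rewrite rmul_nil mulr1.
by rewrite rmul_rcons mulr1; case: x.
Qed.

Lemma size_rmul s v : size (rmul s v).2 = size s.2.
Proof.
by case: s => b; elim/last_ind => [|l x _] //; rewrite rmul_rcons !size_rcons.
Qed.

End Coefficients.

(** The expansion of the expectation of [s] times the centered words [ws],
    written with moments only, so that it makes sense for moments that do not
    come from an algebra; see [centered_momentE]. *)
Fixpoint centered_moment (M : seq (bool * B) -> B) (s : state bool) ws : B :=
  if ws is w :: ws' then
    centered_moment M (s.1, s.2 ++ w) ws' - centered_moment M (rmul s (M w)) ws'
  else s.1 * M s.2.

Definition Rdiag_moments (M : seq (bool * B) -> B) : Prop :=
  (forall e w, alternates e w -> odd (size w) -> M w = 0) /\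
  (forall e ws, (0 < size ws)%N -> chain e ws -> centered_moment M (1, [::]) ws = 0).

Section Uniqueness.
Variables (M M' : seq (bool * B) -> B) (n : nat).
Hypothesis eqM : forall w, (size w < n)%N -> M w = M' w.

Lemma eq_centered_moment ws s : (size s.2 + size (flatten ws) < n)%N ->
  centered_moment M s ws = centered_moment M' s ws.
Proof.
elim: ws s => [|w ws IH] s /=; first by rewrite addn0 => sn; rewrite eqM.
rewrite size_cat => sn; rewrite eqM; last by lia.
by rewrite !IH //= ?size_rmul ?size_cat; lia.
Qed.

(** In the expansion of a product of centered words, every term other than the
    moment of the full word involves only words of size less than [n]. *)
Lemma eq_centered_moment_top ws s : all (fun w => (0 < size w < n)%N) ws ->
    (size s.2 + size (flatten ws) <= n)%N ->
  centered_moment M s ws - s.1 * M (s.2 ++ flatten ws) =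
  centered_moment M' s ws - s.1 * M' (s.2 ++ flatten ws).
Proof.
elim: ws s => [|w ws IH] s /=; first by rewrite cats0 !subrr.
rewrite size_cat => /andP[/andP[w0 wn] aws] sn.
rewrite addrAC [RHS]addrAC !catA.
have := IH (s.1, s.2 ++ w) aws; rewrite /= size_cat => -> //; last by lia.
by rewrite eqM // (@eq_centered_moment ws (rmul s (M' w))) // size_rmul; lia.
Qed.

(** If [w] is not alternating, it is a product of at least two runs; the
    expansion of the vanishing centered product then gives its moment in terms
    of shorter words. *)
Lemma Rdiag_moments_step w : Rdiag_moments M -> Rdiag_moments M' ->
    size w = n -> ~~ (alternates true w || alternates false w) || odd n ->
  M w = M' w.
Proof.
move=> [oM cM] [oM' cM'] wn bad.
have [e [ws [cws fws]]] := chain_exists w.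
have wtriv : alternates e w -> M w = M' w.
  move=> aw; have on : odd n by case: e aw {cws} bad => ->; rewrite ?orbT.
  by rewrite (oM e) ?wn // (oM' e) ?wn.
case: ws cws fws => [|w1 [|w2 ws]] cws fws.
- by apply: wtriv; rewrite -fws.
- by apply: wtriv; rewrite -fws /= cats0; case/and3P: cws.
have all0 f ws' : chain f ws' -> all (fun w => (0 < size w)%N) ws'.
  by elim: ws' f => //= x ws' IH f /and3P[-> _ /IH].
have := @eq_centered_moment_top [:: w1, w2 & ws] (1, [::]).
rewrite (cM e) // (cM' e) // fws !mul1r /= !sub0r => H.
apply: oppr_inj; apply: H; last by rewrite wn.
have := all0 _ _ cws => /= /and3P[w10 w20 aws].
move: wn; rewrite -fws /= !size_cat => wn.
have H x : x \in ws -> (size x <= size (flatten ws))%N.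
  elim: (ws) => //= y l IH; rewrite inE size_cat => /predU1P[->|/IH]; lia.
rewrite /= w10 w20 /=; apply/and3P; split; [lia|lia|].
apply/allP => x xws; rewrite (allP aws) //=.
by apply: leq_ltn_trans (H _ xws) _; lia.
Qed.

End Uniqueness.

Lemma eq_Rdiag_moments (M M' : seq (bool * B) -> B) :
    Rdiag_moments M -> Rdiag_moments M' ->
    (forall e w, alternates e w -> ~~ odd (size w) -> M w = M' w) ->
  M =1 M'.
Proof.
move=> RM RM' ev w; move: {2}(size w) (erefl (size w)) => n.
elim/ltn_ind: n w => n IH w wn.
have [bad|] := boolP (~~ (alternates true w || alternates false w) || odd n).
  by apply: (Rdiag_moments_step (n := n)) => // w' w'n; apply: (IH (size w')).
rewrite negb_or negbK -wn => /andP[/orP[] aw ow]; exact: ev aw ow.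
Qed.

Lemma eq_centered_moment_ext (M M' : seq (bool * B) -> B) s ws : M =1 M' ->
  centered_moment M s ws = centered_moment M' s ws.
Proof. by move=> E; elim: ws s => [|w ws IH] s /=; rewrite ?E ?IH. Qed.

Lemma Rdiag_moments_ext (M M' : seq (bool * B) -> B) : M =1 M' ->
  Rdiag_moments M -> Rdiag_moments M'.
Proof.
move=> E [oM cM]; split=> [e w aw ow|e ws ws0 cws]; first by rewrite -E (oM e).
by rewrite -(eq_centered_moment_ext _ _ E) (cM e).
Qed.

End Words.
Arguments state {C} B I.

Section GenuineMoments.
Variables (C : numClosedFieldType) (B : starAlgType C) (A : ncps B).
Implicit Types (a x y : A) (b : B) (w : seq (bool * B)).

Lemma cexpMl b x : cexp A (emb A b * x) = b * cexp A x.
Proof. by rewrite -{1}[_ * x]mulr1 -(rmorph1 (emb A)) cexp_bimod mulr1. Qed.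

Lemma cexpMr x b : cexp A (x * emb A b) = cexp A x * b.
Proof. by rewrite -{1}[x]mul1r -(rmorph1 (emb A)) cexp_bimod mul1r. Qed.

Lemma cexp1 : cexp A 1 = 1.
Proof. by rewrite -(rmorph1 (emb A)) cexp_emb. Qed.

Lemma cexp_centered x : cexp A (centered x) = 0.
Proof. by rewrite /centered raddfB /= cexp_emb subrr. Qed.

Lemma centered_id x : cexp A x = 0 -> centered x = x.
Proof. by rewrite /centered => ->; rewrite raddf0 subr0. Qed.

Lemma centeredMr x b : centered x * emb A b = centered (x * emb A b).
Proof. by rewrite /centered cexpMr mulrBl rmorphM. Qed.

Lemma centeredMl b x : emb A b * centered x = centered (emb A b * x).
Proof. by rewrite /centered cexpMl mulrBr rmorphM. Qed.

Lemma centeredD x y : centered (x + y) = centered x + centered y.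
Proof. by rewrite /centered linearD rmorphD opprD addrACA. Qed.

Definition wval a (w : seq (bool * B)) : A :=
  \prod_(x <- w) (spow a x.1 * emb A x.2).

Definition sval a (s : state B bool) : A := emb A s.1 * wval a s.2.

Definition wmoment a (w : seq (bool * B)) : B := cexp A (wval a w).

Lemma wval_cons a (x : bool * B) w : wval a (x :: w) = spow a x.1 * emb A x.2 * wval a w.
Proof. by rewrite /wval big_cons. Qed.

Lemma wval_nil a : wval a [::] = 1.
Proof. by rewrite /wval big_nil. Qed.

Lemma wval_cat a w1 w2 : wval a (w1 ++ w2) = wval a w1 * wval a w2.
Proof. by rewrite /wval big_cat. Qed.

Lemma wval_rcons a w (x : bool * B) :
  wval a (rcons w x) = wval a w * (spow a x.1 * emb A x.2).
Proof. by rewrite -cats1 wval_cat wval_cons wval_nil mulr1. Qed.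

Lemma sval_rmul a s b : sval a (rmul s b) = sval a s * emb A b.
Proof.
case: s => b0; elim/last_ind => [|l x _].
  by rewrite rmul_nil /sval /= !wval_nil !mulr1 rmorphM.
by rewrite rmul_rcons /sval /= !wval_rcons /= rmorphM !mulrA.
Qed.

Lemma wval_rmul a w b : (0 < size w)%N ->
  wval a (rmul (1, w) b).2 = wval a w * emb A b.
Proof.
case: w => // x w _; have := sval_rmul a (1, x :: w) b.
by rewrite /sval rmorph1 !mul1r.
Qed.

Lemma centered_rmul a w b : (0 < size w)%N ->
  centered (wval a w) * emb A b = centered (wval a (rmul (1, w) b).2).
Proof. by move=> w0; rewrite wval_rmul // centeredMr. Qed.

Lemma centered_momentE a s ws : centered_moment (wmoment a) s ws =
  cexp A (sval a s * \prod_(w <- ws) centered (wval a w)).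
Proof.
elim: ws s => [|w ws IH] s /=; first by rewrite big_nil mulr1 cexpMl.
rewrite !IH -raddfB -mulrBl big_cons mulrA; congr (cexp A (_ * _)).
by rewrite sval_rmul /sval /= wval_cat mulrA -mulrBr.
Qed.

Lemma Rdiag_momentsE a : Rdiag_moments (wmoment a) <->
  (forall e w, alternates e w -> odd (size w) -> cexp A (wval a w) = 0) /\
  (forall e ws, (0 < size ws)%N -> chain e ws ->
     cexp A (\prod_(w <- ws) centered (wval a w)) = 0).
Proof.
have E ws : centered_moment (wmoment a) (1, [::]) ws =
    cexp A (\prod_(w <- ws) centered (wval a w)).
  by rewrite centered_momentE /sval /= wval_nil rmorph1 !mul1r.
by split=> -[oM cM]; split=> // e ws w0 cw; have := cM e ws w0 cw; rewrite E.
Qed.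

Lemma momentE a (eps : seq bool) (b : seq B) : size eps = (size b).+1 ->
  moment [seq spow a e | e <- eps] b = wmoment a (zip eps (rcons b 1)).
Proof.
move=> s; rewrite /moment /wmoment; congr (cexp A _).
rewrite size_map; elim: b eps s => [|b0 b IH] [|e eps] //= [s].
  case: eps s => // _; rewrite big_ord0 mul1r wval_cons wval_nil /=.
  by rewrite rmorph1 !mulr1.
case: eps s => [|e' eps] // s.
by rewrite big_ord_recl wval_cons /= -IH //= -!mulrA.
Qed.

Lemma wmoment_split a (eps : seq bool) (b : seq B) b0 :
  size eps = (size b).+1 ->
  wmoment a (zip eps (rcons b b0)) = moment [seq spow a e | e <- eps] b * b0.
Proof.
move=> s; rewrite momentE // /wmoment -cexpMr; congr (cexp A _).
elim: b eps s => [|b1 b IH] [|e eps] //= [s].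
  case: eps s => // _; rewrite !wval_cons wval_nil /=.
  by rewrite rmorph1 !mulr1.
by rewrite !wval_cons IH // mulrA.
Qed.

End GenuineMoments.

(** The coefficient after the last letter factors out of a moment, and with it
    the difference between the two sides. *)
Lemma same_star_distP (C : numClosedFieldType) (B : starAlgType C)
    (A A' : ncps B) (x : A) (x' : A') :
  same_star_dist x x' <-> wmoment x =1 wmoment x'.
Proof.
split=> [H w|H eps b s]; last by rewrite !momentE.
elim/last_ind: w => [|w [e b] _].
  by rewrite /wmoment !wval_nil !cexp1.
have -> : rcons w (e, b) = zip (rcons (unzip1 w) e) (rcons (unzip2 w) b).
  by rewrite zip_rcons ?size_map // zip_unzip.
by rewrite !wmoment_split ?size_rcons ?size_map // H ?size_rcons ?size_map.
Qed.

(** * Alternating words and the sets P_ij *)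

Section AlternatingWords.
Variables (C : numClosedFieldType) (B : starAlgType C).
Implicit Types (w : seq (bool * B)) (ws : seq (seq (bool * B))).

Definition alt_letters (e : bool) (b : nat -> B) (n : nat) : seq (bool * B) :=
  mkseq (fun i => (e (+) odd i, b i.+1)) n.

Lemma alternates_alt_letters e b n : alternates e (alt_letters e b n).
Proof.
elim: n => [|n IH] //; rewrite /alt_letters mkseqS -/(alt_letters e b n).
by rewrite alternates_rcons IH size_mkseq /=.
Qed.

Lemma size_alt_letters e b n : size (alt_letters e b n) = n.
Proof. exact: size_mkseq. Qed.

Lemma alternatesP e w b0 :
  alternates e w -> w = alt_letters e (fun i => nth 0 (b0 :: unzip2 w) i) (size w).
Proof.
elim/last_ind: w => [|w x IH] //; rewrite alternates_rcons => /andP[aw /eqP xe].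
rewrite size_rcons /alt_letters mkseqS; congr rcons; last first.
  rewrite -xe /unzip2 map_rcons /= nth_rcons size_map ltnn eqxx.
  by case: (x).
rewrite {1}(IH aw); apply/eq_in_map => i; rewrite mem_iota /= add0n => iw.
by rewrite /= /unzip2 map_rcons nth_rcons size_map iw.
Qed.

Lemma alternates_rmul e b w v : alternates e (rmul (b, w) v).2 = alternates e w.
Proof.
elim/last_ind: w => [|w x _] //.
by rewrite rmul_rcons /= !alternates_rcons.
Qed.

Lemma alternates_flip e w k (x0 : bool * B) : alternates e w -> (k.+1 < size w)%N ->
  (nth x0 w k).1 != (nth x0 w k.+1).1.
Proof.
elim: w e k => [|x w IH] e [|k] //= /andP[/eqP xe aw].
  rewrite xe {x xe}; case: w {IH} aw => //= y w /andP[/eqP-> _] _.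
  by case: e.
exact: IH aw.
Qed.

Lemma alternates_last e w (x0 : bool * B) : alternates e w -> (0 < size w)%N ->
  (last x0 w).1 = e (+) ~~ odd (size w).
Proof.
case/lastP: w => // w x; rewrite alternates_rcons last_rcons size_rcons /= negbK.
by case/andP=> _ /eqP.
Qed.

Lemma chain_head e ws (x0 : bool * B) : chain e ws ->
  (0 < size (flatten ws))%N -> (nth x0 (flatten ws) 0).1 = e.
Proof.
case: ws => //= w ws /and3P[w0 aw _] _.
by case: w aw w0 => //= x w /andP[/eqP].
Qed.

Variable A : ncps B.
Implicit Types (a : A).

Lemma spowN a e : spow a (~~ e) = star (spow a e).
Proof. by case: e => //=; rewrite starK. Qed.

Lemma alt_wordE a e b k :
  alt_word (spow a e) (spow a (~~ e)) b k = wval a (alt_letters e b k.*2).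
Proof.
rewrite /alt_word; elim: k => [|k IH]; first by rewrite big_ord0 wval_nil.
rewrite big_ord_recr doubleS /alt_letters !mkseqS !wval_rcons IH /=.
by rewrite odd_double addbF addbT !mulrA.
Qed.

Lemma alt_word_oddE a e b k :
  alt_word (spow a e) (spow a (~~ e)) b k * spow a e * emb A (b k.*2.+1) =
  wval a (alt_letters e b k.*2.+1).
Proof.
rewrite alt_wordE /alt_letters mkseqS wval_rcons /=.
by rewrite odd_double addbF mulrA.
Qed.

(** The four sets differ by the first letter and the parity of the length, and
    only words of even length are centered. *)
Lemma PsetP a i j x : Pset a i j x <-> exists (b0 : B) w,
  [/\ alternates i w, (0 < size w)%N, j = i (+) ~~ odd (size w) &
   x = if odd (size w) then emb A b0 * wval a w
       else centered (emb A b0 * wval a w)].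
Proof.
have fwd e (b : nat -> B) n : (0 < n)%N -> exists (b0 : B) w,
  [/\ alternates e w, (0 < size w)%N, e (+) ~~ odd n = e (+) ~~ odd (size w) &
   (if odd n then emb A (b 0%N) * wval a (alt_letters e b n)
   else centered (emb A (b 0%N) * wval a (alt_letters e b n))) =
   if odd (size w) then emb A b0 * wval a w
       else centered (emb A b0 * wval a w)].
  move=> n0; exists (b 0%N), (alt_letters e b n).
  by rewrite alternates_alt_letters size_alt_letters.
have dblgt0 k : (0 < k.*2)%N = (0 < k)%N by case: k.
split.
  case: i j => -[] /= [k [b]].
  - move=> ->; have := fwd true b k.*2.+1 isT; rewrite /= odd_double /=.
    by rewrite -alt_word_oddE /= !mulrA.
  - case=> k0 ->; have := fwd true b k.*2; rewrite dblgt0 => /(_ k0).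
    by rewrite /= odd_double /= -alt_wordE.
  - case=> k0 ->; have := fwd false b k.*2; rewrite dblgt0 => /(_ k0).
    by rewrite /= odd_double /= -alt_wordE.
  - move=> ->; have := fwd false b k.*2.+1 isT; rewrite /= odd_double /=.
    by rewrite -alt_word_oddE /= !mulrA.
case=> b0 [w [aw w0 -> ->]].
set b := fun i => nth 0 (b0 :: unzip2 w) i.
have wE := alternatesP b0 aw; rewrite -/b in wE.
have [ow|ow] := boolP (odd (size w)).
  have sw : size w = (size w)./2.*2.+1.
    by rewrite -[LHS]odd_double_half ow.
  rewrite addbF [in wval a _]wE sw -alt_word_oddE.
  by case: (i) => /=; exists (size w)./2, b; rewrite ?mulrA.
have sw : size w = (size w)./2.*2.
  by rewrite -[LHS]odd_double_half (negbTE ow).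
rewrite addbT [in wval a _]wE sw -alt_wordE.
by case: (i) => /=; exists (size w)./2, b; (split; first by lia).
Qed.

Definition Pset_products_vanish a := forall (n : nat) (i : nat -> bool) (x : nat -> A),
  (0 < n)%N ->
  (forall k, (1 <= k <= n)%N -> Pset a (i k.-1) (i k) (x k)) ->
  cexp A (\prod_(1 <= k < n.+1) x k) = 0.

(** The left coefficient of each factor is absorbed in the last coefficient of
    the factor before it; only the first one remains. *)
Lemma Pset_prod a (n : nat) (i : nat -> bool) (x : nat -> A) :
    (forall e w, alternates e w -> odd (size w) -> cexp A (wval a w) = 0) ->
    (forall k, (1 <= k <= n)%N -> Pset a (i k.-1) (i k) (x k)) ->
  exists (b0 : B) ws, [/\ chain (i 0%N) ws, size ws = n &
    \prod_(1 <= k < n.+1) x k =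
      emb A b0 * \prod_(w <- ws) centered (wval a w)].
Proof.
move=> oM; elim: n i x => [|n IH] i x Px.
  by exists 1, [::]; rewrite /= big_geq // big_nil rmorph1 mulr1.
have /PsetP[b0 [w [aw w0 i1 x1]]] := Px 1%N isT.
have [|b1 [ws [cws sws pws]]] := IH (i \o succn) (x \o succn).
  by move=> [|k] // /andP[_ kn]; have := Px k.+2; rewrite /= !ltnS kn; apply.
exists b0, ((rmul (1, w) b1).2 :: ws); split => /=.
- by rewrite size_rmul alternates_rmul w0 aw /= -i1.
- by rewrite sws.
rewrite big_nat_recl // big_cons mulrA pws /= mulrA; congr (_ * _).
rewrite -centered_rmul // mulrA; congr (_ * _).
rewrite centeredMl x1; case: ifP => // ow.
by rewrite centered_id // cexpMl (oM (i 0%N)) // mulr0.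
Qed.

Lemma Pset_productsP a : Pset_products_vanish a <-> Rdiag_moments (wmoment a).
Proof.
rewrite Rdiag_momentsE; split=> [Hb|[oM cM] n i x n0 Px]; last first.
  have [b0 [ws [cws sws ->]]] := Pset_prod oM Px.
  by rewrite cexpMl (cM (i 0%N)) ?mulr0 // sws.
have oM e w : alternates e w -> odd (size w) -> cexp A (wval a w) = 0.
  move=> aw ow; have := Hb 1%N (fun=> e) (fun=> wval a w) isT.
  rewrite big_nat1; apply=> k _; apply/PsetP; exists 1, w.
  by rewrite ow addbF rmorph1 mul1r; split=> //; case: (w) ow.
split=> // e ws ws0 cws.
pose typ k := foldl (fun e (w : seq (bool * B)) => e (+) ~~ odd (size w)) e
                (take k ws).
have typP k : (k < size ws)%N -> [/\ alternates (typ k) (nth [::] ws k),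
    (0 < size (nth [::] ws k))%N &
    typ k.+1 = typ k (+) ~~ odd (size (nth [::] ws k))].
  rewrite {}/typ {ws0}; elim: ws e cws k => // w ws IH e /= /and3P[w0 aw cws].
  case=> [|k] /= kw; first by rewrite take0.
  exact: IH cws k kw.
have := Hb (size ws) typ (fun k => centered (wval a (nth [::] ws k.-1))) ws0.
rewrite big_add1 /= big_mkord (big_nth [::]) big_mkord; apply.
case=> // k /andP[_ kn]; have [aw w0 ->] := typP k kn.
apply/PsetP; exists 1, (nth [::] ws k); rewrite rmorph1 mul1r.
split=> //; case: ifP => // ow.
by rewrite centered_id // (oM (typ k)).
Qed.

End AlternatingWords.

(** * Maximal alternating intervals *)

Section MaximalRuns.
Variables (C : numClosedFieldType) (B : starAlgType C).
Implicit Types (w : seq (bool * B)) (ws : seq (seq (bool * B))).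

Let x0 : bool * B := (true, 0).

(** Positions are natural numbers rather than ordinals, so that words can be
    cut and reindexed; [x0] is only read outside of the word. *)
Definition flips w k := (nth x0 w k).1 != (nth x0 w k.+1).1.

Definition same_run w i j :=
  all (flips w) (iota (minn i j) (maxn i j - minn i j)).

Lemma same_runP w i j : reflect
  (forall k, (minn i j <= k < maxn i j)%N -> flips w k) (same_run w i j).
Proof.
apply: (iffP allP) => H k; have := H k; rewrite mem_iota => {}H Hk; apply: H; lia.
Qed.

Lemma same_run_refl w i : same_run w i i.
Proof. by apply/same_runP => k; lia. Qed.

Lemma same_run_sym w i j : same_run w i j = same_run w j i.
Proof. by rewrite /same_run minnC maxnC. Qed.

Lemma same_run_trans w i j k :
  same_run w i j -> same_run w j k -> same_run w i k.
Proof.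
move=> /same_runP ij /same_runP jk; apply/same_runP => l lik.
have [lij|lij] := boolP (minn i j <= l < maxn i j)%N; first exact: ij.
by apply: jk; lia.
Qed.

Definition run_start w i := (i == 0%N) || ~~ flips w i.-1.

Section Blocks.
Variables (n : nat) (eps : 'I_n -> bool) (w : seq (bool * B)).
Hypothesis epsE : forall i : 'I_n, eps i = (nth x0 w i).1.

Definition run_set (i : 'I_n) : {set 'I_n} := [set j : 'I_n | same_run w i j]%SET.

Lemma run_set_alternating i : alternating_interval eps (run_set i).
Proof.
apply/andP; split; apply/forall_inP => j; rewrite inE => ij;
  apply/forall_inP => k; rewrite inE => ik.
  apply/forallP => l; apply/implyP => jlk; rewrite inE.
  apply/same_runP => m mil.
  have /same_runP jk : same_run w j k.
    by apply: same_run_trans ik; rewrite same_run_sym.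
  have [mij|mij] := boolP (minn i j <= m < maxn i j)%N.
    by move/same_runP: ij; apply.
  by apply: jk; lia.
apply/implyP => /eqP kj.
have /same_runP jk : same_run w j k.
  by apply: same_run_trans ik; rewrite same_run_sym.
by have := jk j; rewrite /flips !epsE kj; apply; lia.
Qed.

Lemma sub_run_set (V : {set 'I_n}) i :
  alternating_interval eps V -> i \in V -> V \subset run_set i.
Proof.
case/andP=> /forall_inP intV /forall_inP altV iV; apply/fintype.subsetP => j jV.
rewrite inE; apply/same_runP => k kij.
have inV l : (minn i j <= l <= maxn i j)%N -> exists2 l' : 'I_n, l' = l :> nat & l' \in V.
  move=> lij; have ln : (l < n)%N by have := ltn_ord i; have := ltn_ord j; lia.
  exists (Ordinal ln) => //.
  have [ij|ji] := leqP i j.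
    have /forall_inP/(_ j jV)/forallP/(_ (Ordinal ln))/implyP := intV _ iV.
    by apply => /=; lia.
  have /forall_inP/(_ i iV)/forallP/(_ (Ordinal ln))/implyP := intV _ jV.
  by apply => /=; lia.
have [k1 k1E k1V] := inV k ltac:(lia).
have [k2 k2E k2V] := inV k.+1 ltac:(lia).
have /forall_inP/(_ k2 k2V)/implyP := altV _ k1V.
by rewrite !epsE k1E k2E /flips; apply.
Qed.

(** An alternating interval containing [i] lies in the run of [i], and this run
    is itself an alternating interval. *)
Lemma max_alternating_run V i : V \in max_alternating eps -> i \in V ->
  V = run_set i.
Proof.
rewrite inE => /maxsetP[altV maxV] iV; apply/esym/maxV.
  exact: run_set_alternating.
exact: sub_run_set.
Qed.

Lemma run_set_max i : run_set i \in max_alternating eps.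
Proof.
rewrite inE; apply/maxsetP; split=> [|V altV sV]; first exact: run_set_alternating.
have iV : i \in V by apply: (fintype.subsetP sV); rewrite inE same_run_refl.
by apply/eqP; rewrite finset.eqEsubset sV sub_run_set.
Qed.

Lemma pblock_max_alternating i :
  finset.pblock (max_alternating eps) i = run_set i.
Proof.
apply: def_pblock; rewrite ?run_set_max ?inE ?same_run_refl //.
apply/finset.trivIsetP => V W VP WP; apply: contraNT.
case/pred0Pn=> j /andP[/= jV jW].
by rewrite (max_alternating_run VP jV) (max_alternating_run WP jW).
Qed.

Lemma run_startP i : [forall j in run_set i, (i <= j)%N] = run_start w i.
Proof.
rewrite /run_start; case: (posnP i) => [->|i0] /=; first exact/forall_inP.
apply/forall_inP/idP => [H|].
  apply/negP => fl.
  have ln : (i.-1 < n)%N by have := ltn_ord i; lia.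
  have : (i <= Ordinal ln)%N.
    apply: H; rewrite inE; apply/same_runP => k /= ki.
    by have -> : k = i.-1 by lia.
  by rewrite /=; lia.
move=> nfl j; rewrite inE => /same_runP ij; rewrite leqNgt.
by apply: contra nfl => ji; apply: ij; lia.
Qed.

End Blocks.

Variable A : ncps B.
Variable a : A.

Let F w j := spow a (nth x0 w j).1 * emb A (nth x0 w j).2.

Lemma wval_nth w : wval a w = \prod_(0 <= j < size w) F w j.
Proof. by rewrite /wval (big_nth x0). Qed.

(** Two neighbouring words of a chain meet in equal letters, so that the words
    of a chain are the runs of their concatenation. *)
Lemma run_product e ws : chain e ws -> let w := flatten ws in
  \prod_(0 <= i < size w | run_start w i)
     centered (\prod_(0 <= j < size w | same_run w i j) F w j) =
  \prod_(w' <- ws) centered (wval a w').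
Proof.
elim: ws e => [|w1 ws IH] e; first by rewrite /= !big_nil.
move=> /= /and3P[w10 aw1 cws]; rewrite big_cons -(IH _ cws) /=.
set w2 := flatten ws; set n1 := size w1; set n2 := size w2.
have sw : size (w1 ++ w2) = (n1 + n2)%N by rewrite size_cat.
have nth1 j : (j < n1)%N -> nth x0 (w1 ++ w2) j = nth x0 w1 j.
  by rewrite nth_cat => ->.
have nth2 j : nth x0 (w1 ++ w2) (n1 + j) = nth x0 w2 j.
  by rewrite nth_cat ltnNge leq_addr /= addKn.
have fl1 k : (k.+1 < n1)%N -> flips (w1 ++ w2) k.
  by move=> kn; rewrite /flips !nth1 ?(ltnW kn) //; apply: alternates_flip aw1 kn.
have fl2 k : flips (w1 ++ w2) (n1 + k) = flips w2 k.
  by rewrite /flips -addnS !nth2.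
have fl0 : (0 < n2)%N -> ~~ flips (w1 ++ w2) n1.-1.
  move=> n20; rewrite /flips prednK // (nth1 n1.-1) ?prednK //.
  by have := nth2 0%N; rewrite addn0 => ->; rewrite (chain_head _ cws) // nth_last (alternates_last _ aw1) // eqxx.
have run1 j : (j < n1 + n2)%N -> same_run (w1 ++ w2) 0 j = (j < n1)%N.
  move=> jn; apply/same_runP/idP => [H|jn1 k kj]; last by apply: fl1; lia.
  rewrite ltnNge; apply/negP => n1j; have /fl0/negP : (0 < n2)%N by lia.
  by apply; apply: H; lia.
have run12 i j : (0 < n2)%N -> (i < n1)%N -> same_run (w1 ++ w2) i (n1 + j) = false.
  move=> n20 ilt; apply/negP => /same_runP H.
  by have /negP := fl0 n20; apply; apply: H; lia.
have run2 i j : same_run (w1 ++ w2) (n1 + i) (n1 + j) = same_run w2 i j.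
  apply/same_runP/same_runP => H k kij; first by rewrite -fl2; apply: H; lia.
  have -> : k = (n1 + (k - n1))%N by lia.
  by rewrite fl2; apply: H; lia.
rewrite sw (big_cat_nat (n := n1)) ?leq_addr //=; congr (_ * _).
  rewrite big_ltn_cond //= [X in _ * X]big_nat_cond [X in _ * X]big1 ?mulr1;
    last first.
    move=> i /andP[/andP[i0 ilt]]; rewrite /run_start fl1 ?orbF //; last by lia.
    by case: i i0 {ilt}.
  congr centered; rewrite (big_cat_nat (n := n1)) ?leq_addr //=.
  rewrite [X in _ * X]big_nat_cond [X in _ * X]big1 ?mulr1; last first.
    by move=> j /andP[/andP[n1j jn]]; rewrite run1 // ltnNge n1j.
  rewrite wval_nth big_nat_cond [RHS]big_nat_cond; apply: eq_big => [j|j].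
    by rewrite andbT; case: ltnP => //= jn1; rewrite run1 //; lia.
  by case/andP=> /andP[_ jn1] _; rewrite /F nth1.
rewrite -{1}[n1]add0n big_addn addKn big_nat_cond [RHS]big_nat_cond.
apply: eq_big => [i|i].
  case: ltnP => //= ilt; rewrite /run_start.
  case: i ilt => [|i] ilt /=; first by rewrite add0n fl0 ?orbT //; lia.
  by rewrite -(fl2 i) addnC.
case/andP=> /andP[_ ilt] _; congr centered.
rewrite (big_cat_nat (n := n1)) ?leq_addr //=.
rewrite big_nat_cond big1 ?mul1r; last first.
  move=> j /andP[/andP[_ jn]]; rewrite same_run_sym addnC run12 //; lia.
rewrite -{1}[n1]add0n big_addn addKn; apply: eq_big => [j|j _].
  by rewrite ![(_ + n1)%N]addnC run2.
by rewrite /F addnC nth2.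
Qed.

Lemma block_product n (eps : 'I_n -> bool) (b : 'I_n -> B) e ws :
    chain e ws -> size (flatten ws) = n ->
    (forall i : 'I_n, nth x0 (flatten ws) i = (eps i, b i)) ->
  let block := finset.pblock (max_alternating eps) in
  \prod_(i < n | [forall j in block i, (i <= j)%N])
    centered (\prod_(j in block i) (spow a (eps j) * emb A (b j))) =
  \prod_(w <- ws) centered (wval a w).
Proof.
move=> cws wn wE /=; rewrite -(run_product cws) /= wn big_mkord.
have epsE i : eps i = (nth x0 (flatten ws) i).1 by rewrite wE.
apply: eq_big => [i|i _]; rewrite (pblock_max_alternating epsE) ?run_startP //.
congr centered; rewrite big_mkord; apply: eq_big => [j|j _]; first by rewrite inE.
by rewrite /F wE.
Qed.

End MaximalRuns.

(** * R-diagonality and moments of words *)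

Section RdiagonalMoments.
Variables (C : numClosedFieldType) (B : starAlgType C).

Lemma star0 (A : starAlgType C) : star 0 = 0 :> A.
Proof. by apply: (addrI (star 0)); rewrite -starD !addr0. Qed.

Lemma star1 (A : starAlgType C) : star 1 = 1 :> A.
Proof. by rewrite -[LHS]mulr1 -[X in _ * X]starK -starM mulr1 starK. Qed.

Variables (A : ncps B) (a : A).

(** Taking adjoints reverses a word and changes its letters: an odd word that
    starts with [star a] becomes one that starts with [a]. *)
Lemma star_wval e (w : seq (bool * B)) : alternates e w -> exists (b0 : B) w',
  [/\ star (wval a w) = emb A b0 * wval a w', alternates (e (+) odd (size w)) w' &
   size w' = size w].
Proof.
elim/last_ind: w => [_|w x IH].
  by exists 1, [::]; rewrite wval_nil star1 rmorph1 mulr1.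
rewrite alternates_rcons => /andP[/IH[b0 [w' [sw aw' sz]]] /eqP xe].
exists (star x.2), ((~~ x.1, b0) :: w'); split; last by rewrite size_rcons /= sz.
  by rewrite wval_rcons !starM sw wval_cons /= spowN emb_star !mulrA.
by rewrite size_rcons /= xe !addbN eqxx /= negbK.
Qed.

Lemma alt_word_rcons e b k :
  alt_word (spow a e) (spow a (~~ e)) b k * spow a e =
  wval a (rcons (alt_letters e b k.*2) (e, 1)).
Proof. by rewrite wval_rcons /= rmorph1 mulr1 alt_wordE. Qed.

Lemma odd_moments :
    (forall (k : nat) (b : nat -> B), cexp A (alt_word a (star a) b k * a) = 0) ->
  forall e w, alternates e w -> odd (size w) -> cexp A (wval a w) = 0.
Proof.
move=> odda.
have odd0 w : alternates false w -> odd (size w) -> cexp A (wval a w) = 0.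
  move=> aw ow; rewrite (alternatesP 0 aw).
  have -> : size w = (size w)./2.*2.+1 by rewrite -[LHS]odd_double_half ow.
  by rewrite -alt_word_oddE cexpMr odda mul0r.
case=> w aw ow; last exact: odd0.
have [b0 [w' [sw aw' sw']]] := star_wval aw.
have : star (cexp A (wval a w)) = 0.
  by rewrite -cexp_star sw cexpMl odd0 ?mulr0 ?sw' //; rewrite ow in aw'.
by move/(congr1 (@star _ _)); rewrite starK star0.
Qed.

Lemma RdiagonalP : Rdiagonal a <-> Rdiag_moments (wmoment a).
Proof.
rewrite Rdiag_momentsE; split=> [[odda eva]|[oM cM]]; split.
- exact: odd_moments.
- move=> e ws ws0 cws; set w := flatten ws.
  have w0 : (0 < size w)%N.
    by case: (ws) ws0 cws @w => //= w1 ws' _ /and3P[w10 _ _]; rewrite size_cat; lia.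
  have := eva (size w) (fun i => (nth (true, 0) w i).1)
    (fun i => (nth (true, 0) w i).2) w0.
  rewrite /= (block_product (e := e) (ws := ws) a) //.
  by move=> i; case: nth.
- by move=> k b; rewrite (alt_word_rcons false) (oM false) //;
     rewrite ?alternates_rcons ?alternates_alt_letters ?size_rcons size_alt_letters /= odd_double.
- move=> n eps b n0; pose w := [seq (eps i, b i) | i <- enum 'I_n].
  have [e [ws [cws fws]]] := chain_exists w.
  have wn : size (flatten ws) = n by rewrite fws size_map size_enum_ord.
  rewrite /= (block_product a cws wn) ?(cM e) //.
    by case: (ws) wn => //= n00; move: n0; rewrite -n00.
  move=> i; rewrite fws (nth_map i) ?size_enum_ord // nth_ord_enum //.
Qed.

End RdiagonalMoments.

(** * Freeness from a unitary *)

Section GeneratedSubalgebra.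
Variables (C : numClosedFieldType) (M : algType C).
Implicit Types (X S : set M) (x y : M).

Lemma gen_subalg_ind X S : GRing.subalg_closed [in S] -> (X `<=` S)%classic ->
  (gen_subalg X `<=` S)%classic.
Proof. by move=> cS XS x; apply; split. Qed.

Lemma gen_subalg_incl X x : X x -> gen_subalg X x.
Proof. by move=> Xx S [_ XS]; apply: XS. Qed.

Lemma gen_subalg1 X : gen_subalg X 1.
Proof. by move=> S [[S1 _ _] _]; rewrite -in_setE. Qed.

Lemma gen_subalgM X x y : gen_subalg X x -> gen_subalg X y -> gen_subalg X (x * y).
Proof.
move=> Xx Xy S cS; have [[_ _ SM] _] := cS; rewrite -in_setE.
by apply: SM; rewrite in_setE; [apply: Xx|apply: Xy].
Qed.

Lemma gen_subalgB X x y : gen_subalg X x -> gen_subalg X y -> gen_subalg X (x - y).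
Proof.
move=> Xx Xy S cS; have [[_ SL _] _] := cS; rewrite -in_setE addrC -scaleN1r.
by apply: SL; rewrite in_setE; [apply: Xy|apply: Xx].
Qed.

Lemma subalg_closedP S : S 1 -> (forall (c : C) x y, S x -> S y -> S (c *: x + y)) ->
  (forall x y, S x -> S y -> S (x * y)) -> GRing.subalg_closed [in S].
Proof.
move=> S1 SL SM; split; first by rewrite in_setE.
  by move=> c x y; rewrite !in_setE; apply: SL.
by move=> x y; rewrite !in_setE; apply: SM.
Qed.

Definition free_factors (V : zmodType) (D : set M) (E : M -> V) (S1 S2 : set M)
    (s : seq (bool * M)) :=
  forall z : bool * M, z \in s ->
    gen_subalg (D `|` (if z.1 then S2 else S1))%classic z.2 /\ E z.2 = 0.

Lemma free_over_seq (V : zmodType) (D : set M) (E : M -> V) (S1 S2 : set M)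
    (s : seq (bool * M)) :
    free_over D E S1 S2 -> (0 < size s)%N -> free_factors D E S1 S2 s ->
    sorted (fun i j => i != j) (unzip1 s) ->
  E (\prod_(z <- s) z.2) = 0.
Proof.
move=> fr s0 sF ss; pose x0 : bool * M := (true, 0).
rewrite (big_nth x0).
apply: (fr (size s) (fun k => (nth x0 s k).1) (fun k => (nth x0 s k).2)) => //.
- by move=> k ks; apply: (sF _ (mem_nth x0 ks)).1.
- by move=> k ks; apply: (sF _ (mem_nth x0 ks)).2.
move=> k ks; have /(sortedP true)/(_ k) := ss.
by rewrite size_map ks !(nth_map x0) ?(ltnW ks) //; apply.
Qed.

Lemma alternating_mkseq (T : Type) (i : nat -> bool) (y : nat -> T) n :
    (forall k, (k.+1 < n)%N -> i k != i k.+1) ->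
  sorted (fun i j => i != j) (unzip1 (mkseq (fun k => (i k, y k)) n)).
Proof.
move=> alt; apply/(sortedP true) => k; rewrite !size_map size_iota => kn.
rewrite /unzip1 -map_comp !(nth_map 0%N) ?size_iota ?(ltnW kn) //.
by rewrite !nth_iota ?(ltnW kn) // alt.
Qed.

End GeneratedSubalgebra.

Section FreeUnitary.
Variables (C : numClosedFieldType) (B : starAlgType C) (A : ncps B).
Variables (p u : A).

Let Du := gen_subalg (range (emb A) `|` [set u; star u])%classic.
Let Dp := gen_subalg (range (emb A) `|` [set p; star p])%classic.

Lemma gen_emb (S : set A) b : gen_subalg (range (emb A) `|` S)%classic (emb A b).
Proof. by apply: gen_subalg_incl; left; exists b. Qed.

Lemma gen_centered (S : set A) x : gen_subalg (range (emb A) `|` S)%classic x ->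
  gen_subalg (range (emb A) `|` S)%classic (centered x).
Proof. by move=> Sx; apply: gen_subalgB => //; apply: gen_emb. Qed.

Lemma gen_spow (S : set A) a w : S a -> S (star a) ->
  gen_subalg (range (emb A) `|` S)%classic (wval a w).
Proof.
move=> Sa Ssa; elim: w => [|x w IH]; first by rewrite wval_nil; apply: gen_subalg1.
rewrite wval_cons; apply: gen_subalgM => //; apply: gen_subalgM; last exact: gen_emb.
by apply: gen_subalg_incl; right; case: (x.1).
Qed.

Hypothesis fr : free_B [set u; star u]%classic [set p; star p]%classic.

Let ff := free_factors (range (emb A)) (cexp A) [set u; star u]%classic
  [set p; star p]%classic.

(** What [free_expansion] asks of the elements from the algebra of [p]: when
    some of the elements [Ux.1] between them are replaced by their expectations,
    the merged products still have expectation 0. *)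
Fixpoint good (X : A) (us : seq (A * A)) : Prop :=
  cexp A X = 0 /\
  if us is Ux :: us' then good (X * emb A (cexp A Ux.1) * Ux.2) us' else True.

Fixpoint goods (us : seq (A * A)) : Prop :=
  if us is Ux :: us' then
    [/\ Du Ux.1, Dp Ux.2, good Ux.2 us' & goods us']
  else True.

(** Split each element of the algebra of [u] into a centered part and its
    expectation.  The centered part continues the alternating product [ys], the
    expectation merges its two neighbours, and [good] says that the merged factor
    is again centered. *)
Lemma free_expansion us ys X U :
    ff ys -> sorted (fun i j => i != j) (rcons (unzip1 ys) true) ->
    Dp X -> good X us -> goods us -> Du U ->
  cexp A (\prod_(y <- ys) y.2 * X * \prod_(Ux <- us) (Ux.1 * Ux.2) * U) = 0.
Proof.
have split x : x = centered x + emb A (cexp A x) by rewrite subrK.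
have ffu ys' X' V : ff ys' -> sorted (fun i j => i != j) (rcons (unzip1 ys') true) ->
    Dp X' -> cexp A X' = 0 -> Du V ->
    let ys2 := ys' ++ [:: (true, X'); (false, centered V)] in
    ff ys2 /\ sorted (fun i j => i != j) (rcons (unzip1 ys2) true).
  move=> fy sy DX EX DV; split.
    move=> x; rewrite mem_cat !inE => /or3P[/fy //|/eqP->|/eqP->] //=.
    by split; [apply: gen_centered|apply: cexp_centered].
  rewrite /unzip1 map_cat -!cats1 -catA /=.
  case: (ys') sy => //= y ys3; rewrite -cats1 !cat_path /=.
  by case/andP=> -> /andP[->].
elim: us ys X U => [|[V x] us IH] ys X U fy sy DX /= gX gus DU.
  have [EX _] := gX; rewrite big_nil mulr1 (split U) mulrDr raddfD /= cexpMr.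
  have [fy2 sy2] := ffu _ _ _ fy sy DX EX DU.
  have -> : cexp A (\prod_(y <- ys) y.2 * X * centered U) = 0.
    have := free_over_seq fr _ fy2; rewrite big_cat /= !big_cons big_nil /= mulr1 mulrA.
    apply; first by rewrite size_cat addnC.
    move: sy2; rewrite -cats1 /=; case: (unzip1 _) => //= z zs.
    by rewrite cat_path => /andP[].
  have fy1 : ff (rcons ys (true, X)).
    by move=> z; rewrite mem_rcons inE => /predU1P[->|/fy].
  have := free_over_seq fr _ fy1.
  rewrite -cats1 big_cat /= big_cons big_nil mulr1 cats1 /unzip1 map_rcons size_rcons.
  by move=> -> //; rewrite mul0r addr0.
case: gX => EX gX; case: gus => DV Dx gx gus.
have [V0 V0E] : exists V0, V0 = centered V by exists (centered V).
rewrite big_cons /= (split V) -V0E !(mulrDl, mulrDr) raddfD /=.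
have [fy2 sy2] := ffu _ _ _ fy sy DX EX DV.
have := IH _ _ _ fy2 sy2 Dx gx gus DU.
rewrite big_cat /= !big_cons big_nil /= !mulrA !mulr1 -V0E => ->; rewrite add0r.
have := IH _ _ _ fy sy _ gX gus DU; rewrite !mulrA; apply.
by do 2![apply: gen_subalgM => //]; apply: gen_emb.
Qed.

Lemma free_expansion_left us X V U : Du V -> Dp X -> good X us -> goods us -> Du U ->
  cexp A (V * X * \prod_(Ux <- us) (Ux.1 * Ux.2) * U) = 0.
Proof.
move=> DV DX gX gus DU.
have [V0 V0E] : exists V0, V0 = centered V by exists (centered V).
rewrite -[V](subrK (emb A (cexp A V))) -/(centered V) -V0E !mulrDl raddfD /=.
rewrite -!mulrA cexpMl !mulrA.
have ff0 : ff [::] by [].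
have := free_expansion ff0 isT DX gX gus DU; rewrite big_nil mul1r => ->.
rewrite mulr0 addr0.
have ff1 : ff [:: (false, centered V)].
  by move=> x; rewrite inE => /eqP-> /=; split; [apply: gen_centered|apply: cexp_centered].
by have := free_expansion ff1 isT DX gX gus DU; rewrite big_cons big_nil mulr1 -V0E.
Qed.

Hypotheses (uU : unitary u) (uN : normalizes u).

(** Moving [u] to the left through the coefficients that follow [star p]
    conjugates them. *)
Definition twist (w : seq (bool * B)) : seq (bool * B) :=
  [seq (x.1, if x.1 then cexp A (star u * emb A x.2 * u) else x.2) | x <- w].

Lemma alternates_twist e w : alternates e (twist w) = alternates e w.
Proof. by elim: w e => //= x w IH e; rewrite IH. Qed.

Definition upre (e : bool) : A := if e then 1 else u.
Definition upost (e : bool) : A := if e then star u else 1.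

(** The product [star u * b * u] met after each [star p] stays in B, so that
    powers of [u] remain at the two ends of the word only. *)
Lemma wval_up e w : alternates e w ->
  wval (u * p) w = upre e * wval p (twist w) * upost (e (+) ~~ odd (size w)).
Proof.
have [suu usu] := uU.
elim: w e => [|[e' b] w IH] e /=.
  by rewrite !wval_nil mulr1; case: e; rewrite /= ?mulr1.
case/andP=> /eqP-> /IH wE; rewrite !wval_cons /= wE addNb -addbN.
case: e {wE} => /=; last by rewrite !mulrA mulr1.
have [_ [b' _ b'E]] := uN b.
by rewrite starM -b'E cexp_emb b'E !mulrA mul1r.
Qed.

Let Dpw w : Dp (wval p w).
Proof. by apply: gen_spow => /=; [left|right]. Qed.

Lemma Du_pre e : Du (upre e).
Proof.
by case: e; [apply: gen_subalg1|apply: gen_subalg_incl; right; left].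
Qed.

Lemma Du_post e : Du (upost e).
Proof.
by case: e; [apply: gen_subalg_incl; right; right|apply: gen_subalg1].
Qed.

Lemma cexp_sandwich U V x : Du U -> Du V -> Dp x ->
  cexp A (U * x * V) = cexp A (U * emb A (cexp A x) * V).
Proof.
move=> DU DV Dx; rewrite -{1}[x](subrK (emb A (cexp A x))) mulrDr mulrDl raddfD /=.
have := @free_expansion_left [::] (centered x) U V DU (gen_centered Dx) _ I DV.
by rewrite big_nil mulr1 => -> //; rewrite ?add0r //; split=> //; apply: cexp_centered.
Qed.

(** The expectation of a word flanked by [u] and [star u] is the conjugate of
    an element of B, thus lies in B: centering commutes with the flanking. *)
Lemma centered_up e w : alternates e w ->
    (odd (size w) -> cexp A (wval p (twist w)) = 0) ->
  centered (wval (u * p) w) =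
    upre e * centered (wval p (twist w)) * upost (e (+) ~~ odd (size w)).
Proof.
move=> aw ow; rewrite (wval_up aw) /centered.
set X := wval p _; have DX : Dp X := Dpw _.
rewrite mulrBr mulrBl cexp_sandwich //; [|exact: Du_pre|exact: Du_post].
congr (_ - _); case: odd ow => [/(_ isT)-> |_].
  by rewrite raddf0 mulr0 mul0r !raddf0.
rewrite addbT; case: e {aw} => /=; first by rewrite mul1r mulr1 cexp_emb.
by have [[b _ <-] _] := uN (cexp A X); rewrite cexp_emb.
Qed.

(** What is left of [u] between two words of which the second one starts with
    the exponent [e] that ends the first one. *)
Definition ujoin (e : bool) : A := if e then star u else u.

Fixpoint spine (e : bool) (ws : seq (seq (bool * B))) : seq (A * A) :=
  if ws is w :: ws' then
    (ujoin e, centered (wval p (twist w))) :: spine (e (+) ~~ odd (size w)) ws'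
  else [::].

Definition last_letter (e : bool) (ws : seq (seq (bool * B))) : bool :=
  foldl (fun e (w : seq (bool * B)) => e (+) ~~ odd (size w)) e ws.

Hypothesis oddp : forall e w, alternates e w -> odd (size w) -> cexp A (wval p w) = 0.

Let size_twist w : size (twist w) = size w.
Proof. exact: size_map. Qed.

Let odd_twist e w : alternates e w -> odd (size w) -> cexp A (wval p (twist w)) = 0.
Proof.
by move=> aw ow; apply: (oddp (e := e)); rewrite ?alternates_twist ?size_twist.
Qed.

Lemma prod_up e ws : chain e ws ->
  upost e * \prod_(w <- ws) centered (wval (u * p) w) =
  \prod_(Ux <- spine e ws) (Ux.1 * Ux.2) * upost (last_letter e ws).
Proof.
elim: ws e => [|w ws IH] e /=; first by rewrite !big_nil mulr1 mul1r.
case/and3P=> w0 aw cws; rewrite !big_cons (centered_up aw); last by move/(odd_twist aw).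
rewrite -!mulrA IH // !mulrA; do 3!congr (_ * _).
by case: e {aw cws}; rewrite /= ?mulr1 ?mul1r.
Qed.

Lemma Rdiag_up : (forall e ws, chain e ws -> goods (spine e ws)) ->
  Rdiag_moments (wmoment (u * p)).
Proof.
move=> H; apply/Rdiag_momentsE; split=> [e w aw ow|e ws ws0 cws].
  rewrite (wval_up aw) cexp_sandwich //; [|exact: Du_pre|exact: Du_post].
  by rewrite (odd_twist aw ow) raddf0 mulr0 mul0r raddf0.
have := H _ _ cws; case: ws ws0 cws => // w ws _ /= /and3P[w0 aw cws] [_ Dx gx gws].
rewrite big_cons (centered_up aw); last by move/(odd_twist aw).
rewrite -mulrA prod_up // mulrA.
by apply: free_expansion_left => //; [apply: Du_pre|apply: Du_post].
Qed.

Let goods_spine e ws : chain e ws ->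
  (forall e w ws, chain e (w :: ws) ->
    good (centered (wval p (twist w))) (spine (e (+) ~~ odd (size w)) ws)) ->
  goods (spine e ws).
Proof.
move=> cws H; elim: ws e cws => //= w ws IH e cews; have /and3P[w0 aw cws] := cews.
split; last exact: IH.
- by case: e {cews aw cws}; [exact: (Du_post true)|exact: (Du_pre false)].
- exact: (gen_centered (Dpw _)).
- exact: H.
Qed.

(** Both [u] and its adjoint have expectation 0, so that the merged products
    contain a factor 0. *)
Lemma Rdiag_up_centered : cexp A u = 0 -> Rdiag_moments (wmoment (u * p)).
Proof.
move=> u0; apply: Rdiag_up => e ws cws; apply: goods_spine cws _ => {e ws}.
have good0 us : good 0 us.
  by elim: us => /= [|x us IH]; split; rewrite ?raddf0 // !mul0r.
move=> e w ws _; case: ws => [|w' ws] /=; first by rewrite cexp_centered.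
split; first exact: cexp_centered.
suff -> : cexp A (ujoin (e (+) ~~ odd (size w))) = 0 by rewrite raddf0 mulr0 mul0r.
by case: addb => //=; rewrite cexp_star u0 star0.
Qed.

(** The merged products are products of centered words in [p] along a chain,
    once the expectations of the unitaries are absorbed as coefficients. *)
Lemma Rdiag_up_Rdiag : Rdiag_moments (wmoment p) -> Rdiag_moments (wmoment (u * p)).
Proof.
move=> /Rdiag_momentsE[_ cM]; apply: Rdiag_up => e ws cws.
apply: goods_spine cws _ => {e ws}.
pose X w := centered (wval p (twist w)).
have XM w b : (0 < size w)%N -> exists w', [/\ forall e, alternates e w' = alternates e w,
    size w' = size w & X w * emb A b = centered (wval p w')].
  move=> w0; exists (rmul (1, twist w) b).2.
  rewrite size_rmul size_twist /X centered_rmul ?size_twist //.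
  by split=> // e; rewrite alternates_rmul alternates_twist.
have key e ws Y : chain e ws ->
    (forall b ws', chain e ws' ->
       cexp A (Y * emb A b * \prod_(w <- ws') centered (wval p w)) = 0) ->
    good Y (spine e ws).
  elim: ws e Y => [|w ws IH] e Y /=.
    by move=> _ /(_ 1 [::] isT); rewrite big_nil rmorph1 !mulr1.
  case/and3P=> w0 aw cws HY; split.
    by have := HY 1 [::] isT; rewrite big_nil rmorph1 !mulr1.
  apply: IH => // b ws' cws'; have [w' [aw' sw' wE]] := XM w b w0.
  have := HY (cexp A (ujoin e)) (w' :: ws'); rewrite big_cons /= sw' w0 aw' aw cws'.
  by move/(_ isT); rewrite -wE !mulrA.
move=> e w ws /= /and3P[w0 aw cws]; apply: key => // b ws' cws'.
have [w' [aw' sw' wE]] := XM w b w0.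
have := cM e (w' :: ws') isT; rewrite /= sw' w0 aw' aw cws' big_cons -wE.
by apply.
Qed.

End FreeUnitary.

(** * Multiplication by a free unitary *)

Section UnitaryConditions.
Variables (C : numClosedFieldType) (B : starAlgType C) (A : ncps B) (a : A).

Definition free_polar := exists (A' : ncps B) (p u : A'), unitary u /\
  [/\ normalizes u,
      cexp A' p = 0 /\
        (forall (k : nat) (b : nat -> B), (0 < k)%N ->
           cexp A' (alt_word p (star p) b k * p) = 0),
      free_B [set u; star u]%classic [set p; star p]%classic,
      cexp A' u = 0 &
      same_star_dist a (u * p)].

Definition haar_rotation := exists (A' : ncps B) (f : enlargement A A') (u : A'),
  unitary u /\
  [/\ forall b : B, u * emb A' b = emb A' b * u,
      free_B [set u; star u]%classic [set f a; star (f a)]%classic,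
      forall k : nat, (0 < k)%N -> cexp A' (u ^+ k) = 0 &
      same_star_dist a (u * f a)].

Definition rotation_invariant := forall (A' : ncps B) (f : enlargement A A') (u : A'),
  unitary u ->
  (forall b : B, u * emb A' b = emb A' b * u) ->
  free_B [set u; star u]%classic [set f a; star (f a)]%classic ->
  same_star_dist a (u * f a).

Lemma free_polar_Rdiag : free_polar -> Rdiag_moments (wmoment a).
Proof.
case=> A' [p [u [uU [uN [p0 pk] fr u0 /same_star_distP sd]]]].
apply: (@Rdiag_moments_ext _ _ (wmoment (u * p))) => [w|]; first by rewrite sd.
apply: Rdiag_up_centered => //; apply: odd_moments => k b.
have [->|k0] := posnP k; last exact: pk.
by rewrite /alt_word big_ord0 mul1r.
Qed.

Lemma commute_normalizes (A' : ncps B) (u : A') : unitary u ->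
  (forall b : B, u * emb A' b = emb A' b * u) ->
  normalizes u /\ forall b : B, star u * emb A' b * u = emb A' b.
Proof.
move=> [suu usu] uB.
have ub b : star u * emb A' b * u = emb A' b by rewrite -mulrA -uB mulrA suu mul1r.
by split=> // b; split; exists b; rewrite // ?ub // uB -mulrA usu mulr1.
Qed.

Lemma twist_commute (A' : ncps B) (u : A') (w : seq (bool * B)) :
  (forall b : B, star u * emb A' b * u = emb A' b) -> twist u w = w.
Proof.
move=> ub; rewrite /twist -[RHS]map_id; apply: eq_map => -[e b] /=.
by rewrite ub cexp_emb; case: e.
Qed.

Lemma wval_enl (A' : ncps B) (f : enlargement A A') w : wval (f a) w = f (wval a w).
Proof.
elim: w => [|x w IH]; first by rewrite !wval_nil rmorph1.
rewrite !wval_cons IH !rmorphM -(enl_emb f); congr (_ * _ * _).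
by case: (x.1); rewrite //= -(enl_star f).
Qed.

(** Both [f a] and [u * f a] satisfy [Rdiag_moments]; an even alternating word
    in [u * f a] is a word in [f a], conjugated by [u] or not, and this
    conjugation preserves the expectation since [u] commutes with B. *)
Lemma Rdiag_rotation_invariant : Rdiag_moments (wmoment a) -> rotation_invariant.
Proof.
move=> Ra A' f u uU uB fr; apply/same_star_distP.
have [uN ub] := commute_normalizes uU uB.
have af : wmoment a =1 wmoment (f a) by move=> w; rewrite /wmoment wval_enl enl_cexp.
apply: eq_Rdiag_moments => //.
  by apply: Rdiag_up_Rdiag => //;
     [case: (Rdiag_moments_ext af Ra)|apply: Rdiag_moments_ext af Ra].
move=> e w aw ow; rewrite af /wmoment (wval_up (f a) uU uN aw) twist_commute //.
rewrite (cexp_sandwich fr); last first.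
- by apply: gen_spow => /=; [left|right].
- exact: Du_post.
- exact: Du_pre.
rewrite (negbTE ow) addbT; case: (e) => /=; first by rewrite mul1r mulr1 cexp_emb.
by rewrite uB -mulrA (proj2 uU) mulr1 cexp_emb.
Qed.

(** The polar part can be [f a] itself: odd alternating moments of [f a] are
    equal to those of [u * f a], in which a single power of [u] remains. *)
Lemma haar_rotation_free_polar : haar_rotation -> free_polar.
Proof.
case=> A' [f [u [uU [uB fr uk sd]]]]; exists A', (f a), u; split=> //.
have [uN ub] := commute_normalizes uU uB.
have u0 : cexp A' u = 0 by have := uk 1%N isT.
suff odd0 e w : alternates e w -> odd (size w) -> cexp A' (wval (f a) w) = 0.
  split=> //; split=> [|k b k0].
    have := odd0 false [:: (false, 1)] isT isT.
    by rewrite wval_cons wval_nil /= rmorph1 !mulr1.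
  by rewrite (alt_word_rcons (f a) false) (odd0 false) //;
     rewrite ?alternates_rcons ?alternates_alt_letters ?size_rcons size_alt_letters /= odd_double.
move=> aw ow; have /same_star_distP/(_ w) := sd; rewrite /wmoment.
rewrite wval_enl enl_cexp => ->; rewrite (wval_up (f a) uU uN aw) twist_commute //.
rewrite (cexp_sandwich fr); last first.
- by apply: gen_spow => /=; [left|right].
- exact: Du_post.
- exact: Du_pre.
rewrite ow addbF; case: (e) => /=.
  by rewrite mul1r cexpMl cexp_star u0 star0 mulr0.
by rewrite mulr1 cexpMr u0 mul0r.
Qed.

End UnitaryConditions.

(** * A module for the free product with the group ring of the integers *)

Section FreeProductModule.
Variables (C : numClosedFieldType) (B : starAlgType C) (A : ncps B).
Local Notation emb := (emb A).
Local Notation cexp := (cexp A).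
Implicit Types (y z a : A) (b v : B) (k m : int).

(** A word, listed from its last slot, after a coefficient of B.  A slot
    [(k, y)] stands for the class of [y] modulo B in the copy of A with label [k]. *)
Definition fstate : Type := B * seq (int * A).

Definition fmul (s : fstate) (v : B) : fstate :=
  if s.2 is x :: l then (s.1, (x.1, x.2 * emb v) :: l) else (s.1 * v, [::]).

Definition reduced (l : seq (int * A)) : bool :=
  sorted (fun k m => k != m) (unzip1 l).

Lemma fmulM s v1 v2 : fmul (fmul s v1) v2 = fmul s (v1 * v2).
Proof. by case: s => b [|x l]; rewrite /fmul /= ?rmorphM mulrA. Qed.

Lemma fmul_unzip1 s v : unzip1 (fmul s v).2 = unzip1 s.2.
Proof. by case: s => b []. Qed.

Lemma fmul1 s : fmul s 1 = s.
Proof. by case: s => b [|[k y] l]; rewrite /fmul /= ?rmorph1 mulr1. Qed.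

(** The functions on words that factor through the tensor products over B of
    the quotients A / B: using functions avoids the construction of these
    products. *)
Record slotwise (g : fstate -> B) : Prop := Slotwise {
  slot_base : forall b b0 l, g (b * b0, l) = b * g (b0, l);
  slot_add : forall b0 l1 k y z l2,
    g (b0, l1 ++ (k, y + z) :: l2) =
    g (b0, l1 ++ (k, y) :: l2) + g (b0, l1 ++ (k, z) :: l2);
  slot_kill : forall b0 l1 k b l2, g (b0, l1 ++ (k, emb b) :: l2) = 0;
  slot_balanced : forall b0 l1 k b y l2, g (b0, l1 ++ (k, emb b * y) :: l2) =
    g ((fmul (b0, l2) b).1, l1 ++ (k, y) :: (fmul (b0, l2) b).2) }.

Lemma slotwise_add g h : slotwise g -> slotwise h ->
  slotwise (fun s => g s + h s).
Proof.
move=> [gb ga gk gl] [hb ha hk hl]; split=> *.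
- by rewrite gb hb mulrDr.
- by rewrite ga ha addrACA.
- by rewrite gk hk addr0.
- by rewrite gl hl.
Qed.

Lemma slotwise_opp g : slotwise g -> slotwise (fun s => - g s).
Proof.
move=> [gb ga gk gl]; split=> *.
- by rewrite gb mulrN.
- by rewrite ga opprD.
- by rewrite gk oppr0.
- by rewrite gl.
Qed.

Lemma slotwise_0 : slotwise (fun=> 0).
Proof. by split=> *; rewrite ?mulr0 ?addr0. Qed.

Lemma slotwise_mulr g v : slotwise g -> slotwise (fun s => g s * v).
Proof.
move=> [gb ga gk gl]; split=> *.
- by rewrite gb mulrA.
- by rewrite ga mulrDl.
- by rewrite gk mul0r.
- by rewrite gl.
Qed.

Lemma slotwise_push g m a : slotwise g ->
  slotwise (fun s => g (s.1, (m, a) :: s.2)).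
Proof.
move=> [gb ga gk gl]; split=> * /=.
- exact: gb.
- exact: (ga _ (_ :: _)).
- exact: (gk _ (_ :: _)).
- exact: (gl _ (_ :: _)).
Qed.

Lemma slotwise_fmul g v : slotwise g -> slotwise (fun s => g (fmul s v)).
Proof.
move=> [gb ga gk gl]; split=> /= b0.
- by move=> b1 [|x l]; rewrite /fmul /= -?mulrA gb.
- move=> [|x l1] k y z l2; last by apply: (ga _ (_ :: _)).
  by rewrite /fmul /= mulrDl; apply: (ga _ [::]).
- move=> [|x l1] k b l2; last by apply: (gk _ (_ :: _)).
  by rewrite /fmul /= -rmorphM; apply: (gk _ [::]).
- move=> [|x l1] k b y l2; last by apply: (gl _ (_ :: _)).
  by rewrite {1}/fmul /= -mulrA; rewrite (gl _ [::]).
Qed.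

Section Slotwise.
Variables (g : fstate -> B) (gS : slotwise g).

Lemma slot_fmulD s v1 v2 : g (fmul s (v1 + v2)) = g (fmul s v1) + g (fmul s v2).
Proof.
case: gS => gb ga _ _; case: s => b [|[k y] l]; rewrite /fmul /=.
  by rewrite -[b * (v1 + v2)]mulr1 -[b * v1]mulr1 -[b * v2]mulr1 !gb -mulrDl -mulrDr.
by rewrite rmorphD mulrDr; apply: (ga _ [::]).
Qed.

Lemma slot_fmul0 s : g (fmul s 0) = 0.
Proof. by apply: (addrI (g (fmul s 0))); rewrite -slot_fmulD !addr0. Qed.

Lemma slot_top_add b0 m y z l :
  g (b0, (m, y + z) :: l) = g (b0, (m, y) :: l) + g (b0, (m, z) :: l).
Proof. exact: (slot_add gS _ [::]). Qed.

Lemma slot_top_kill b0 m v l : g (b0, (m, emb v) :: l) = 0.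
Proof. exact: (slot_kill gS _ [::]). Qed.

Lemma slot_top0 b0 m l : g (b0, (m, 0) :: l) = 0.
Proof. by rewrite -(raddf0 emb) slot_top_kill. Qed.

Lemma slot_topN b0 m y l : g (b0, (m, - y) :: l) = - g (b0, (m, y) :: l).
Proof. by apply/eqP; rewrite -addr_eq0 -slot_top_add addNr slot_top0. Qed.

Lemma slot_top_balanced b0 m v y l : g (b0, (m, emb v * y) :: l) =
  g ((fmul (b0, l) v).1, (m, y) :: (fmul (b0, l) v).2).
Proof. exact: (slot_balanced gS _ [::]). Qed.

(** Scalars are elements of B: by balancedness they travel through the slots
    down to the left coefficient, where they are central. *)
Lemma slot_scale (c : C) b0 l1 m y l2 :
  g (b0, l1 ++ (m, c *: y) :: l2) = g (b0, l1 ++ (m, y) :: l2) * c%:A.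
Proof.
have mulcA z : c *: z = emb c%:A * z by rewrite linearZ /= rmorph1 -scalerAl mul1r.
elim: l2 l1 m y => [|[k z] l2 IH] l1 m y; rewrite mulcA (slot_balanced gS) /fmul /=.
  by rewrite [b0 * _]mulr_algr -[c *: b0]mulr_algl (slot_base gS) mulr_algr mulr_algl.
have -> : z * emb c%:A = c *: z by rewrite linearZ /= rmorph1 -scalerAr mulr1.
by have := IH (rcons l1 (m, y)) k z; rewrite !cat_rcons.
Qed.

Lemma slot_fmul_scale (c : C) s v : g (fmul s (c *: v)) = g (fmul s v) * c%:A.
Proof.
case: s => b [|[k y] l]; rewrite /fmul /=.
  by rewrite -scalerAr -[c *: (b * v)]mulr_algl (slot_base gS) mulr_algr mulr_algl.
by rewrite linearZ /= -scalerAr; apply: (slot_scale _ _ [::]).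
Qed.

End Slotwise.

(** A function of the current label and of a word; words with two neighbouring
    slots of the same label do not occur in the free product. *)
Record fpmod : Type := Fpmod {
  fpfun :> int -> fstate -> B;
  fpfun_slotwise : forall m, slotwise (fpfun m);
  fpfun_reduced : forall m s, ~~ reduced s.2 -> fpfun m s = 0 }.

Lemma fpmodP (f g : fpmod) : (forall m s, f m s = g m s) -> f = g.
Proof.
case: f g => f fS fR [g gS gR] /= E.
have fg : f = g by apply: funext => m; apply: funext => s; apply: E.
by subst g; congr Fpmod; apply: Prop_irrelevance.
Qed.

HB.instance Definition _ := gen_eqMixin fpmod.
HB.instance Definition _ := gen_choiceMixin fpmod.

#[local] Obligation Tactic := idtac.

Program Definition fp_add (f g : fpmod) := @Fpmod (fun m s => f m s + g m s) _ _.
Next Obligation. by move=> f g m; apply: slotwise_add; apply: fpfun_slotwise. Qed.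
Next Obligation. by move=> f g m s rs /=; rewrite !fpfun_reduced // addr0. Qed.

Program Definition fp_opp (f : fpmod) := @Fpmod (fun m s => - f m s) _ _.
Next Obligation. by move=> f m; apply: slotwise_opp; apply: fpfun_slotwise. Qed.
Next Obligation. by move=> f m s rs /=; rewrite fpfun_reduced // oppr0. Qed.

Program Definition fp_zero := @Fpmod (fun _ _ => 0) _ _.
Next Obligation. by move=> m; apply: slotwise_0. Qed.
Next Obligation. by []. Qed.

Fact fp_addA : associative fp_add.
Proof. by move=> f g h; apply: fpmodP => m s /=; rewrite addrA. Qed.
Fact fp_addC : commutative fp_add.
Proof. by move=> f g; apply: fpmodP => m s /=; rewrite addrC. Qed.
Fact fp_add0 : left_id fp_zero fp_add.
Proof. by move=> f; apply: fpmodP => m s /=; rewrite add0r. Qed.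
Fact fp_addN : left_inverse fp_zero fp_opp fp_add.
Proof. by move=> f; apply: fpmodP => m s /=; rewrite addNr. Qed.

HB.instance Definition _ := GRing.isZmodule.Build fpmod
  fp_addA fp_addC fp_add0 fp_addN.

Program Definition fp_mulr (f : fpmod) (v : B) := @Fpmod (fun m s => f m s * v) _ _.
Next Obligation. by move=> f v m; apply: slotwise_mulr; apply: fpfun_slotwise. Qed.
Next Obligation. by move=> f v m s rs /=; rewrite fpfun_reduced // mul0r. Qed.

Lemma fp_addE (f g : fpmod) m s : (f + g) m s = f m s + g m s.
Proof. by []. Qed.

Lemma fp_mulrD f g v : fp_mulr (f + g) v = fp_mulr f v + fp_mulr g v.
Proof. by apply: fpmodP => m s /=; rewrite mulrDl. Qed.

Program Definition fp_vac := @Fpmod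
  (fun m s => if (s.2 == [::]) && (m == 0) then s.1 else 0) _ _.
Next Obligation.
move=> m; split=> /=.
- by move=> b b0 l; case: ifP => //; rewrite mulr0.
- by move=> b0 [|x l1] *; rewrite /= addr0.
- by move=> b0 [|x l1].
- by move=> b0 [|x l1] k b y [|z l2].
Qed.
Next Obligation. by move=> m [b [|x l]]. Qed.

Program Definition fp_shift k (f : fpmod) := @Fpmod (fun m s => f (m + k) s) _ _.
Next Obligation. by move=> k f m; apply: fpfun_slotwise. Qed.
Next Obligation. by move=> k f m s rs; apply: fpfun_reduced. Qed.

(** Right multiplication by [a] of a word that does not end in the copy of A
    with label [m]: [a] is the sum of a new slot and of its expectation. *)
Definition fp_gen a (f : fpmod) m (s : fstate) : B :=
  f m (s.1, (m, a) :: s.2) + f m (fmul s (cexp a)).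

(** If the last slot has the current label, it is multiplied by [a] within its
    copy of A; the slot is first replaced by its centered representative, to
    which it is equal modulo B. *)
Definition fp_act_fun a (f : fpmod) m (s : fstate) : B :=
  if reduced s.2 then
    if s.2 is x :: l then
      if x.1 == m then fp_gen (centered x.2 * a) f m (s.1, l)
      else fp_gen a f m s
    else fp_gen a f m s
  else 0.

Lemma slotwise_gen a f m : slotwise (fp_gen a f m).
Proof.
apply: slotwise_add.
  by apply: slotwise_push; apply: fpfun_slotwise.
by apply: slotwise_fmul; apply: fpfun_slotwise.
Qed.

Lemma fp_genD a a' f m s : fp_gen (a + a') f m s = fp_gen a f m s + fp_gen a' f m s.
Proof.
have fS := fpfun_slotwise f m.
by rewrite /fp_gen (slot_top_add fS) raddfD (slot_fmulD fS) addrACA.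
Qed.

Lemma fp_gen_embl a f m s v : fp_gen (emb v * a) f m s = fp_gen a f m (fmul s v).
Proof.
have fS := fpfun_slotwise f m; case: s => b l.
by rewrite /fp_gen (slot_top_balanced fS) cexpMl fmulM.
Qed.

Lemma fp_gen0 f m s : fp_gen 0 f m s = 0.
Proof.
have fS := fpfun_slotwise f m.
by rewrite /fp_gen (slot_top0 fS) raddf0 (slot_fmul0 fS) addr0.
Qed.

Lemma reduced_unzip1 l l' : unzip1 l = unzip1 l' -> reduced l = reduced l'.
Proof. by rewrite /reduced => ->. Qed.

Lemma slotwise_act a f m : slotwise (fp_act_fun a f m).
Proof.
have [gb ga gk gl] := slotwise_gen a f m.
split; rewrite /fp_act_fun /=.
- move=> b b0 l; case: ifP => _; last by rewrite mulr0.
  case: l => [|x l]; first exact: gb.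
  case: ifP => _; last exact: gb.
  by case: (slotwise_gen (centered x.2 * a) f m) => + _ _ _; apply.
- move=> b0 l1 k y z l2.
  rewrite (@reduced_unzip1 _ (l1 ++ (k, y) :: l2)) ?/unzip1 ?map_cat //.
  rewrite (@reduced_unzip1 (l1 ++ (k, z) :: l2) (l1 ++ (k, y) :: l2)) ?/unzip1 ?map_cat //.
  case: ifP => _; last by rewrite addr0.
  case: l1 => [|x l1] /=.
    case: ifP => _; last exact: (ga _ [::]).
    by rewrite centeredD mulrDl fp_genD.
  case: ifP => _; last exact: (ga _ (_ :: _)).
  by case: (slotwise_gen (centered x.2 * a) f m) => _ + _ _; apply.
- move=> b0 l1 k b l2; case: ifP => _ //.
  case: l1 => [|x l1] /=.
    case: ifP => _; last exact: (gk _ [::]).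
    by rewrite /centered cexp_emb subrr mul0r fp_gen0.
  case: ifP => _; last exact: (gk _ (_ :: _)).
  by case: (slotwise_gen (centered x.2 * a) f m) => _ _ + _; apply.
- move=> b0 l1 k b y l2.
  rewrite (@reduced_unzip1 _ (l1 ++ (k, y) :: (fmul (b0, l2) b).2)); last first.
    by rewrite /unzip1 !map_cat /= -!/(unzip1 _) fmul_unzip1.
  case: ifP => _ //.
  case: l1 => [|x l1] /=.
    case: ifP => _; last exact: (gl _ [::]).
    by rewrite -centeredMl -mulrA fp_gen_embl; case: fmul.
  case: ifP => _; last exact: (gl _ (_ :: _)).
  by case: (slotwise_gen (centered x.2 * a) f m) => _ _ _ +; apply.
Qed.

Program Definition fp_act a (f : fpmod) := @Fpmod (fp_act_fun a f) _ _.
Next Obligation. by move=> a f m; apply: slotwise_act. Qed.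
Next Obligation. by move=> a f m s rs; rewrite /fp_act_fun (negbTE rs). Qed.

Lemma fp_genf_add a f g m s : fp_gen a (f + g) m s = fp_gen a f m s + fp_gen a g m s.
Proof. by rewrite /fp_gen !fp_addE addrACA. Qed.

Lemma fp_genf_mulr a f v m s : fp_gen a (fp_mulr f v) m s = fp_gen a f m s * v.
Proof. by rewrite /fp_gen /= mulrDl. Qed.

Lemma fp_act_addf a f g : fp_act a (f + g) = fp_act a f + fp_act a g.
Proof.
apply: fpmodP => m [b [|x l]]; rewrite fp_addE /= /fp_act_fun /=.
  exact: fp_genf_add.
by case: ifP => _; [case: ifP => _; apply: fp_genf_add|rewrite addr0].
Qed.

Lemma fp_act_mulr a f v : fp_act a (fp_mulr f v) = fp_mulr (fp_act a f) v.
Proof.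
apply: fpmodP => m [b [|x l]]; rewrite /= /fp_act_fun /=.
  exact: fp_genf_mulr.
by case: ifP => _; [case: ifP => _; apply: fp_genf_mulr|rewrite mul0r].
Qed.

Lemma fp_actD a a' f : fp_act (a + a') f = fp_act a f + fp_act a' f.
Proof.
apply: fpmodP => m [b [|x l]]; rewrite fp_addE /= /fp_act_fun /= ?fp_genD //.
by do ?case: ifP => _; rewrite ?mulrDr ?fp_genD ?addr0.
Qed.

Lemma fp_genZ (c : C) a f m s : fp_gen (c *: a) f m s = fp_gen a f m s * c%:A.
Proof.
have fS := fpfun_slotwise f m.
rewrite /fp_gen linearZ /= (slot_fmul_scale fS) mulrDl; congr (_ + _).
exact: (slot_scale fS _ _ [::]).
Qed.

Lemma fp_actZ (c : C) a f : fp_act (c *: a) f = fp_mulr (fp_act a f) c%:A.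
Proof.
apply: fpmodP => m [b [|x l]]; rewrite /= /fp_act_fun /= ?fp_genZ //.
case: ifP => _; last by rewrite mul0r.
case: ifP => _ //.
by rewrite -[_ * (c *: a)]scalerAr fp_genZ.
Qed.

(** The expectation of an element of B is all of it: no slot is created, and
    the word is multiplied by this element. *)
Lemma fp_act_emb v f m s : fp_act (emb v) f m s = f m (fmul s v).
Proof.
have fS := fpfun_slotwise f m.
have gE s' : fp_gen (emb v) f m s' = f m (fmul s' v).
  by rewrite /fp_gen (slot_top_kill fS) cexp_emb add0r.
rewrite /= /fp_act_fun; case: ifP => [rs|/negbT rs]; last first.
  by rewrite fpfun_reduced // /reduced fmul_unzip1.
case: s rs => b [|[k y] l] /= rs; rewrite ?gE //; case: eqP => [->|_]; rewrite ?gE //.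
rewrite /fp_gen cexpMr cexp_centered mul0r (slot_fmul0 fS) addr0 /=.
rewrite /centered mulrBl -rmorphM (slot_top_add fS) (slot_topN fS).
by rewrite (slot_top_kill fS) subr0.
Qed.

Lemma fp_act1 f : fp_act 1 f = f.
Proof.
by apply: fpmodP => m s; rewrite -(rmorph1 emb) fp_act_emb fmul1.
Qed.

Lemma fp_act_new a f m s : reduced s.2 -> (forall x l, s.2 = x :: l -> x.1 != m) ->
  fp_act a f m s = fp_gen a f m s.
Proof.
move=> rs H; rewrite /= /fp_act_fun rs; case: s {rs} H => b [|x l] //= H.
by rewrite (negbTE (H _ _ erefl)).
Qed.

Lemma fp_act_top a f m b y l : reduced ((m, y) :: l) ->
  fp_act a f m (b, (m, y) :: l) = fp_gen (centered y * a) f m (b, l).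
Proof. by move=> rs; rewrite /= /fp_act_fun rs /= eqxx. Qed.

(** The two terms of the inner action combine: the new slot for [a] is centered
    before it is multiplied, and the part [cexp a] removed there comes back from
    the second term, moved to the next slot by balancedness. *)
Lemma fp_gen_act a a' f m s : reduced s.2 -> (forall x l, s.2 = x :: l -> x.1 != m) ->
  fp_gen a (fp_act a' f) m s = fp_gen (a * a') f m s.
Proof.
move=> rs H; have fS := fpfun_slotwise f m.
have rs' : reduced ((m, a) :: s.2).
  case: s rs H => b [|x l] //= rs H; rewrite /reduced /= -/(reduced (x :: l)).
  by rewrite eq_sym (H _ _ erefl).
rewrite {1}/fp_gen fp_act_top // fp_act_new; last 2 first.
- by rewrite /reduced fmul_unzip1.
- move=> x l; case: s rs H {rs'} => b [|z l'] //= rs H; rewrite /fmul /= => -[<- _].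
  exact: (H _ _ erefl).
have -> : (s.1, s.2) = s by case: (s).
rewrite /centered mulrBl fp_genD -mulNr -rmorphN fp_gen_embl -addrA.
have gS := slotwise_gen a' f m.
by rewrite -(slot_fmulD gS) addNr (slot_fmul0 gS) addr0.
Qed.

Lemma fp_actM a a' f : fp_act (a * a') f = fp_act a (fp_act a' f).
Proof.
apply: fpmodP => m s; rewrite /= /fp_act_fun; case: ifP => // rs.
case: s rs => b [|x l] /= rs; first by rewrite fp_gen_act.
case: eqP => xm; last first.
  by rewrite fp_gen_act //= => z l' [<- _]; apply/eqP.
rewrite fp_gen_act ?mulrA //=; first exact: (path_sorted rs).
by move=> z l' E; move: rs; rewrite E /reduced /= -xm eq_sym => /andP[].
Qed.

End FreeProductModule.

(** * Operators on the free product module *)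

Section FreeProductAlgebra.
Variables (C : numClosedFieldType) (B : starAlgType C) (A : ncps B).
Local Notation W := (fpmod A).

(** Right multiplication of values by B commutes with these operators: it is
    what makes the expectation below right linear over B. *)
Record fpend : Type := Fpend {
  fpapp :> W -> W;
  fpapp_add : forall f g, fpapp (f + g) = fpapp f + fpapp g;
  fpapp_mulr : forall f v, fpapp (fp_mulr f v) = fp_mulr (fpapp f) v }.

Lemma fpendP (S T : fpend) : (forall f m s, S f m s = T f m s) -> S = T.
Proof.
case: S T => S Sa Sm [T Ta Tm] /= E.
have ST : S = T by apply: funext => f; apply: fpmodP => m s; apply: E.
by subst T; congr Fpend; apply: Prop_irrelevance.
Qed.

HB.instance Definition _ := gen_eqMixin fpend.
HB.instance Definition _ := gen_choiceMixin fpend.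

#[local] Obligation Tactic := idtac.

Program Definition fpe_add (S T : fpend) := @Fpend (fun f => S f + T f) _ _.
Next Obligation. by move=> S T f g /=; rewrite !fpapp_add addrACA. Qed.
Next Obligation. by move=> S T f v /=; rewrite !fpapp_mulr fp_mulrD. Qed.

Program Definition fpe_opp (S : fpend) := @Fpend (fun f => - S f) _ _.
Next Obligation. by move=> S f g /=; rewrite !fpapp_add opprD. Qed.
Next Obligation.
by move=> S f v /=; rewrite !fpapp_mulr; apply: fpmodP => m s /=; rewrite mulNr.
Qed.

Program Definition fpe_zero := @Fpend (fun f => 0) _ _.
Next Obligation. by move=> f g /=; rewrite addr0. Qed.
Next Obligation. by move=> f v /=; apply: fpmodP => m s /=; rewrite mul0r. Qed.

Program Definition fpe_mul (S T : fpend) := @Fpend (fun f => S (T f)) _ _.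
Next Obligation. by move=> S T f g /=; rewrite !fpapp_add. Qed.
Next Obligation. by move=> S T f v /=; rewrite !fpapp_mulr. Qed.

Program Definition fpe_one := @Fpend (fun f => f) _ _.
Next Obligation. by []. Qed.
Next Obligation. by []. Qed.

Program Definition fpe_scale (c : C) (S : fpend) :=
  @Fpend (fun f => fp_mulr (S f) c%:A) _ _.
Next Obligation. by move=> c S f g /=; rewrite !fpapp_add fp_mulrD. Qed.
Next Obligation.
move=> c S f v /=; rewrite !fpapp_mulr; apply: fpmodP => m s /=.
by rewrite -!mulrA mulr_algr mulr_algl.
Qed.

Fact fpe_addA : associative fpe_add.
Proof. by move=> R S T; apply: fpendP => f m s /=; rewrite addrA. Qed.
Fact fpe_addC : commutative fpe_add.
Proof. by move=> S T; apply: fpendP => f m s /=; rewrite addrC. Qed.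
Fact fpe_add0 : left_id fpe_zero fpe_add.
Proof. by move=> T; apply: fpendP => f m s /=; rewrite add0r. Qed.
Fact fpe_addN : left_inverse fpe_zero fpe_opp fpe_add.
Proof. by move=> T; apply: fpendP => f m s /=; rewrite addNr. Qed.

HB.instance Definition _ := GRing.isZmodule.Build fpend
  fpe_addA fpe_addC fpe_add0 fpe_addN.

Fact fpe_mulA : associative fpe_mul.
Proof. by move=> R S T; apply: fpendP. Qed.
Fact fpe_mul1 : left_id fpe_one fpe_mul.
Proof. by move=> T; apply: fpendP. Qed.
Fact fpe_mulr1 : right_id fpe_one fpe_mul.
Proof. by move=> T; apply: fpendP. Qed.
Fact fpe_mulDl : left_distributive fpe_mul +%R.
Proof. by move=> R S T; apply: fpendP. Qed.
Fact fpe_mulDr : right_distributive fpe_mul +%R.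
Proof. by move=> R S T; apply: fpendP => f m s /=; rewrite fpapp_add. Qed.
Fact fpe_one_neq0 : fpe_one != 0.
Proof.
apply/eqP => /(congr1 (fun S : fpend => S (fp_vac A) 0 (1, [::]))) /=.
by move/eqP; rewrite oner_eq0.
Qed.

HB.instance Definition _ := GRing.Zmodule_isNzRing.Build fpend
  fpe_mulA fpe_mul1 fpe_mulr1 fpe_mulDl fpe_mulDr fpe_one_neq0.

Fact fpe_scaleA c d (T : fpend) :
  fpe_scale c (fpe_scale d T) = fpe_scale (c * d) T.
Proof.
by apply: fpendP => f m s /=; rewrite -mulrA mulr_algr scalerA.
Qed.
Fact fpe_scale1 : left_id 1 fpe_scale.
Proof. by move=> T; apply: fpendP => f m s /=; rewrite scale1r mulr1. Qed.
Fact fpe_scaleDr : right_distributive fpe_scale +%R.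
Proof. by move=> c S T; apply: fpendP => f m s /=; rewrite mulrDl. Qed.
Fact fpe_scaleDl (T : fpend) : {morph fpe_scale^~ T : c d / c + d}.
Proof. by move=> c d; apply: fpendP => f m s /=; rewrite scalerDl mulrDr. Qed.

HB.instance Definition _ := GRing.Zmodule_isLmodule.Build C fpend
  fpe_scaleA fpe_scale1 fpe_scaleDr fpe_scaleDl.

Fact fpe_scaleAl (c : C) (S T : fpend) : c *: (S * T) = (c *: S) * T.
Proof. by apply: fpendP. Qed.

HB.instance Definition _ := GRing.Lmodule_isLalgebra.Build C fpend fpe_scaleAl.

Fact fpe_scaleAr (c : C) (S T : fpend) : c *: (S * T) = S * (c *: T).
Proof. by apply: fpendP => f m s /=; rewrite fpapp_mulr. Qed.

HB.instance Definition _ := GRing.Lalgebra_isAlgebra.Build C fpend fpe_scaleAr.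

Definition fpe_act (x : A) : fpend := Fpend (fp_act_addf x) (fp_act_mulr x).

Program Definition fpe_shift (k : int) : fpend := @Fpend (fp_shift k) _ _.
Next Obligation. by move=> k f g; apply: fpmodP. Qed.
Next Obligation. by move=> k f v; apply: fpmodP. Qed.

Lemma fpe_actD x y : fpe_act (x + y) = fpe_act x + fpe_act y.
Proof. by apply: fpendP => f m s; rewrite -[LHS]/(fp_act _ f m s) fp_actD. Qed.

Lemma fpe_actM x y : fpe_act (x * y) = fpe_act x * fpe_act y.
Proof. by apply: fpendP => f m s; rewrite -[LHS]/(fp_act _ f m s) fp_actM. Qed.

Lemma fpe_act1 : fpe_act 1 = 1.
Proof. by apply: fpendP => f m s; rewrite -[LHS]/(fp_act _ f m s) fp_act1. Qed.

Lemma fpe_actZ c x : fpe_act (c *: x) = c *: fpe_act x.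
Proof. by apply: fpendP => f m s; rewrite -[LHS]/(fp_act _ f m s) fp_actZ. Qed.

Lemma fpe_shiftD k l : fpe_shift (k + l) = fpe_shift k * fpe_shift l.
Proof. by apply: fpendP => f m s /=; rewrite addrA. Qed.

Lemma fpe_shift0 : fpe_shift 0 = 1.
Proof. by apply: fpendP => f m s /=; rewrite addr0. Qed.

Lemma fpe_act_embE b (f : W) m s : fpe_act (emb A b) f m s = f m (fmul s b).
Proof. exact: fp_act_emb. Qed.

Lemma fpe_shift_emb k b :
  fpe_shift k * fpe_act (emb A b) = fpe_act (emb A b) * fpe_shift k.
Proof.
by apply: fpendP => f m s; rewrite fpe_act_embE /=
  -[LHS]/(fpe_act (emb A b) f (m + k) s) fpe_act_embE.
Qed.

(** The vacuum state: the empty word, with label 0. *)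
Definition fpe_exp (T : fpend) : B := T (fp_vac A) 0 (1, [::]).

Lemma fpe_exp_bimod b1 T b2 :
  fpe_exp (fpe_act (emb A b1) * T * fpe_act (emb A b2)) = b1 * fpe_exp T * b2.
Proof.
rewrite /fpe_exp -mulrA -[_ 0 _]/(fpe_act (emb A b1) (T (fpe_act (emb A b2) (fp_vac A))) 0 _).
rewrite fpe_act_embE /fmul /= mul1r.
have -> : fp_act (emb A b2) (fp_vac A) = fp_mulr (fp_vac A) b2.
  apply: fpmodP => m [b [|x l]]; rewrite fp_act_emb /= ?mul0r //.
  by case: ifP; rewrite ?mul0r.
rewrite fpapp_mulr /= -[b1 in LHS]mulr1.
by rewrite (slot_base (fpfun_slotwise _ _)).
Qed.

Lemma fpe_exp_act x : fpe_exp (fpe_act x) = cexp A x.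
Proof.
rewrite /fpe_exp -[LHS]/(fp_act x _ 0 _) fp_act_new //.
by rewrite /fp_gen /= add0r mul1r.
Qed.

Lemma fpe_expD S T : fpe_exp (S + T) = fpe_exp S + fpe_exp T.
Proof. by []. Qed.

Lemma fpe_expZ c T : fpe_exp (c *: T) = c *: fpe_exp T.
Proof. by rewrite /fpe_exp /= mulr_algr. Qed.

Definition shift_poly (L : seq (int * B)) : fpend :=
  \sum_(x <- L) fpe_act (emb A x.2) * fpe_shift x.1.

Definition const_term (L : seq (int * B)) : B := \sum_(x <- L | x.1 == 0) x.2.

(** The label of the empty word is taken to be 0. *)
Definition off_top (f : W) := forall m (s : fstate A),
  (if s.2 is x :: _ then x.1 else 0) != m -> f m s = 0.

Definition at_top (f : W) := forall m (s : fstate A),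
  (if s.2 is x :: _ then x.1 else 0) == m -> f m s = 0.

Definition free_factor (x : bool * fpend) : Prop :=
  if x.1 then exists2 y : A, x.2 = fpe_act y & cexp A y = 0
  else exists2 L : seq (int * B), x.2 = shift_poly L & const_term L = 0.

Lemma fpsum_app (I : Type) (r : seq I) (F : I -> fpend) (f : W) m s :
  (\sum_(i <- r) F i) f m s = \sum_(i <- r) F i f m s.
Proof. by elim: r => [|i r IH]; rewrite ?big_nil // !big_cons -IH. Qed.

(** A shift by a nonzero amount makes the current label differ from that of the
    last slot; the unshifted terms add up to the vanishing constant term. *)
Lemma shift_poly_at_top L f : const_term L = 0 -> off_top f ->
  at_top (shift_poly L f).
Proof.
move=> L0 ot m s sm; rewrite /shift_poly fpsum_app.
have topb b : (if (fmul s b).2 is x :: _ then x.1 else 0) == m.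
  by case: s sm => b0 [|x l].
rewrite (bigID (fun x => x.1 == 0)) /= [X in _ + X]big1 ?addr0; last first.
  move=> [k b] /= k0; rewrite -[LHS]/(fpe_act (emb A b) (fp_shift k f) m s).
  rewrite fpe_act_embE /= ot // (eqP (topb b)) -[X in X != _]addr0.
  by rewrite (inj_eq (addrI m)) eq_sym.
rewrite (eq_bigr (fun x => f m (fmul s x.2))) => [|[k b] /= /eqP->]; last first.
  by rewrite -[LHS]/(fpe_act (emb A b) (fp_shift 0 f) m s) fpe_act_embE /= addr0.
have fS := fpfun_slotwise f m.
rewrite -(big_morph (fun v => f m (fmul s v)) (slot_fmulD fS s) (slot_fmul0 fS s)).
by rewrite -/(const_term L) L0 (slot_fmul0 fS).
Qed.

Definition vanish_pushed (f : W) := forall m b y l, f m (b, (m, y) :: l) = 0.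

(** When the last slot has another label than the current one, a centered
    element only creates a slot. *)
Lemma fpe_act_pushed x (f : W) m (s : fstate A) : cexp A x = 0 -> vanish_pushed f ->
  (if s.2 is z :: _ then z.1 != m else true) -> fpe_act x f m s = 0.
Proof.
move=> x0 pf sm; have [rs|rs] := boolP (reduced s.2); last exact: fpfun_reduced.
rewrite -[LHS]/(fp_act x f m s) fp_act_new //; last first.
  by move=> z l sE; move: sm; rewrite sE.
by rewrite /fp_gen pf x0 (slot_fmul0 (fpfun_slotwise _ _)) addr0.
Qed.

(** Along an alternating product, slots created by elements of A always have
    the current label, and the next shift moves this label away: no slot is ever
    removed, and the word left at the end is not the empty one. *)
Lemma free_product_vanish (xs : seq (bool * fpend)) :
    (forall x, x \in xs -> free_factor x) ->
    sorted (fun i j => i != j) (unzip1 xs) ->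
  (0 < size xs)%N -> fpe_exp (\prod_(x <- xs) x.2) = 0.
Proof.
move=> ff sx x0.
suff : let g := (\prod_(x <- xs) x.2) (fp_vac A) in
    match xs with
    | [::] => off_top g /\ vanish_pushed g
    | (true, _) :: _ => off_top g /\ g 0 (1, [::]) = 0
    | (false, _) :: _ => at_top g
    end.
  by case: xs x0 {ff sx} => // -[[] T] xs _ /=; [case|apply].
elim: xs ff sx {x0} => [|[t T] xs IH] ff sx.
  rewrite big_nil; split=> [m [b [|x l]]|m b y l] //=.
  by rewrite eq_sym => /negbTE->.
have ffx x : x \in xs -> free_factor x by move=> xxs; apply: ff; rewrite inE xxs orbT.
have {IH ffx} := IH ffx (path_sorted sx).
rewrite big_cons; move: (\prod_(x <- xs) x.2) => R.
rewrite -[(T * R : fpend) (fp_vac A)]/(T (R (fp_vac A))).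
move: (R (fp_vac A)) => g /= Hg.
have := ff (t, T); rewrite inE eqxx => /(_ isT).
case: t sx {ff} => sx [/=].
  move=> y -> y0; have pg : vanish_pushed g.
    case: xs sx Hg => [|[[] S] xs] //= _; first by case.
    by move=> ag m b z l; apply: ag.
  split; last exact: fpe_act_pushed.
  by move=> m [b [|z l]] zm; apply: fpe_act_pushed => //=.
move=> L -> L0; apply: shift_poly_at_top => //.
by case: xs sx Hg => [|[[] S] xs] //= _; case.
Qed.

End FreeProductAlgebra.

(** * Enlargement by a free Haar unitary *)

Section ConjugateOpposite.
Variables (C : numClosedFieldType) (P : algType C).

(** An alias, since the opposite ring carries the conjugate scalar action. *)
Definition copp : Type := P^c.

HB.instance Definition _ := GRing.NzRing.copy copp P^c.

Definition copp_scale (c : C) (x : copp) : copp := c^* *: (x : P).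

Fact copp_scaleA c d x : copp_scale c (copp_scale d x) = copp_scale (c * d) x.
Proof. by rewrite /copp_scale scalerA rmorphM. Qed.
Fact copp_scale1 : left_id 1 copp_scale.
Proof. by move=> x; rewrite /copp_scale rmorph1 scale1r. Qed.
Fact copp_scaleDr : right_distributive copp_scale +%R.
Proof. by move=> c x y; rewrite /copp_scale scalerDr. Qed.
Fact copp_scaleDl x : {morph copp_scale^~ x : c d / c + d}.
Proof. by move=> c d; rewrite /copp_scale rmorphD scalerDl. Qed.

HB.instance Definition _ := GRing.Zmodule_isLmodule.Build C copp
  copp_scaleA copp_scale1 copp_scaleDr copp_scaleDl.

Fact copp_scaleAl (c : C) (x y : copp) : c *: (x * y) = (c *: x) * y.
Proof. exact: (@scalerAr _ P). Qed.

HB.instance Definition _ := GRing.Lmodule_isLalgebra.Build C copp copp_scaleAl.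

Fact copp_scaleAr (c : C) (x y : copp) : c *: (x * y) = x * (c *: y).
Proof. exact: (@scalerAl _ P). Qed.

HB.instance Definition _ := GRing.Lalgebra_isAlgebra.Build C copp copp_scaleAr.

End ConjugateOpposite.

Section HaarEnlargement.
Variables (C : numClosedFieldType) (B : starAlgType C) (A : ncps B).
Local Notation P := (fpend A).

(** Exchanging the last two factors is an involution that reverses products.
    The first factor makes the embedding of A injective. *)
Definition fpstar : Type := (A * P * copp P)%type.

HB.instance Definition _ := GRing.Algebra.copy fpstar (A * P * copp P)%type.

Lemma fpstarP (z w : fpstar) :
  z.1.1 = w.1.1 -> z.1.2 = w.1.2 -> z.2 = w.2 -> z = w.
Proof. by case: z w => [[x p] q] [[x' p'] q'] /= -> -> ->. Qed.

Definition fp_star (z : fpstar) : fpstar := (star z.1.1, z.2, z.1.2).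

Fact fp_starK : involutive fp_star.
Proof. by move=> [[x p] q]; rewrite /fp_star /= starK. Qed.
Fact fp_starD z w : fp_star (z + w) = fp_star z + fp_star w.
Proof. by rewrite /fp_star /= starD. Qed.
Fact fp_starM z w : fp_star (z * w) = fp_star w * fp_star z.
Proof. by rewrite /fp_star /= starM. Qed.
Fact fp_starZ (c : C) z : fp_star (c *: z) = c^* *: fp_star z.
Proof.
case: z => [[x p] q]; rewrite /fp_star /= starZ.
suff E : c *: p = (c^* : C) *: (p : copp P) by rewrite [X in (_, _, X)]E.
by rewrite -[RHS]/((c^*)^* *: p) conjCK.
Qed.

HB.instance Definition _ := isStarAlgebra.Build C fpstar
  fp_starK fp_starD fp_starM fp_starZ.

Definition fp_incl (x : A) : fpstar := (x, fpe_act x, fpe_act (star x) : copp P).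

Fact fp_incl_linear : linear fp_incl.
Proof.
move=> c x y; rewrite /fp_incl starD starZ !fpe_actD !fpe_actZ.
by [].
Qed.

Fact fp_incl_monoid : monoid_morphism fp_incl.
Proof.
split=> [|x y]; first by rewrite /fp_incl star1 !fpe_act1.
by rewrite /fp_incl starM !fpe_actM.
Qed.

HB.instance Definition _ := GRing.isLinear.Build C A fpstar _ fp_incl fp_incl_linear.
HB.instance Definition _ := GRing.isMonoidMorphism.Build A fpstar fp_incl fp_incl_monoid.

(** The average over the two operator factors is invariant under the
    involution. *)
Definition fps_exp (z : fpstar) : B :=
  2^-1 *: (fpe_exp z.1.2 + star (fpe_exp (z.2 : P))).

Fact fps_exp_linear : linear fps_exp.
Proof.
move=> c [[x p] q] [[x' p'] q'].
rewrite /fps_exp -[(_ + _).1.2]/(c *: p + p')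
  -[(_ + _).2]/((c^* : C) *: (q : P) + (q' : P)).
rewrite !fpe_expD !fpe_expZ starD starZ conjCK scalerA mulrC -scalerA -!scalerDr.
by congr (_ *: _); rewrite scalerDr addrACA.
Qed.

HB.instance Definition _ := GRing.isLinear.Build C fpstar B _ fps_exp fps_exp_linear.

Lemma half_add (V : lmodType C) (x : V) : 2^-1 *: (x + x) = x :> V.
Proof. by rewrite -mulr2n -scaler_nat scalerA mulVf ?scale1r ?pnatr_eq0. Qed.

Lemma fps_exp_incl x : fps_exp (fp_incl x) = cexp A x.
Proof. by rewrite /fps_exp /= !fpe_exp_act cexp_star starK half_add. Qed.

Definition fp_emb : {lrmorphism B -> fpstar} := (fp_incl \o emb A).

Fact fp_emb_inj : injective fp_emb.
Proof. by move=> b1 b2 [/(@emb_inj _ _ A)]. Qed.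
Fact fp_emb_star b : fp_emb (star b) = star (fp_emb b).
Proof. by rewrite -[RHS]/(fp_star (fp_incl (emb A b))) /fp_star /= /fp_incl emb_star starK. Qed.
Fact fp_cexp_emb b : fps_exp (fp_emb b) = b.
Proof. by rewrite -[fp_emb b]/(fp_incl (emb A b)) fps_exp_incl cexp_emb. Qed.
Fact fp_cexp_bimod b1 (z : fpstar) b2 :
  fps_exp (fp_emb b1 * z * fp_emb b2) = b1 * fps_exp z * b2.
Proof.
case: z => [[x p] q]; rewrite /fps_exp.
rewrite -[(_ * _ * _).1.2]/(fpe_act (emb A b1) * p * fpe_act (emb A b2)).
rewrite -[(_ * _ * _).2]/(fpe_act (star (emb A b2)) * ((q : P) * fpe_act (star (emb A b1)))).
rewrite mulrA -!emb_star !fpe_exp_bimod !starM !starK.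
by rewrite mulrA -mulrDl -mulrDr scalerAl scalerAr.
Qed.
Fact fp_cexp_star z : fps_exp (star z) = star (fps_exp z).
Proof.
rewrite /fps_exp starZ starD starK addrC; congr (_ *: _).
by rewrite fmorphV rmorph_nat.
Qed.

Definition fp_ncps : ncps B :=
  @Ncps C B fpstar fp_emb fp_emb_inj fp_emb_star fps_exp fp_cexp_emb
    fp_cexp_bimod fp_cexp_star.

Fact fp_incl_inj : injective (fp_incl : A -> fp_ncps).
Proof. by move=> x y []. Qed.
Fact fp_incl_star x : (fp_incl (star x) : fp_ncps) = star (fp_incl x : fp_ncps).
Proof. by rewrite -[RHS]/(fp_star (fp_incl x)) /fp_star /= /fp_incl starK. Qed.

Definition fp_enl : enlargement A fp_ncps :=
  @Enlargement C B A fp_ncps fp_incl fp_incl_inj fp_incl_star (fun=> erefl)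
    fps_exp_incl.

Definition fp_haar : fp_ncps :=
  (1, fpe_shift A 1, fpe_shift A (-1) : copp P) : fpstar.

Lemma fp_haar_unitary : unitary fp_haar.
Proof.
have E1 : fpe_shift A (-1) * fpe_shift A 1 = 1.
  by rewrite -fpe_shiftD addNr fpe_shift0.
have E2 : fpe_shift A 1 * fpe_shift A (-1) = 1.
  by rewrite -fpe_shiftD subrr fpe_shift0.
split; apply: fpstarP => //.
- by rewrite -[LHS]/(star 1 * 1) star1 mul1r.
- by rewrite -[LHS]/(1 * star 1) star1 mul1r.
Qed.

Lemma fp_haar_commute b : fp_haar * emb fp_ncps b = emb fp_ncps b * fp_haar.
Proof.
apply: fpstarP.
- by rewrite -[LHS]/(1 * emb A b) -[RHS]/(emb A b * 1) mul1r mulr1.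
- exact: fpe_shift_emb.
rewrite -[LHS]/(fpe_act (star (emb A b)) * fpe_shift A (-1)).
by rewrite -[RHS]/(fpe_shift A (-1) * fpe_act (star (emb A b))) -emb_star fpe_shift_emb.
Qed.

Definition conj_poly (L : seq (int * B)) := [seq (- x.1, star x.2) | x <- L].

(** Both operator components of a Laurent polynomial in the unitary are recorded,
    as the expectation involves both. *)
Definition haar_poly : set fp_ncps := [set z : fp_ncps | exists L,
  (z : fpstar).1.2 = shift_poly A L /\ (z : fpstar).2 = shift_poly A (conj_poly L)]%classic.

Lemma shift_poly_cat L1 L2 : shift_poly A (L1 ++ L2) = shift_poly A L1 + shift_poly A L2.
Proof. exact: big_cat. Qed.

Lemma shift_poly_mul L1 L2 : shift_poly A L1 * shift_poly A L2 =
  shift_poly A [seq (x.1 + y.1, x.2 * y.2) | x <- L1, y <- L2].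
Proof.
rewrite /shift_poly big_allpairs_dep mulr_suml; apply: eq_bigr => x _.
rewrite mulr_sumr; apply: eq_bigr => y _ /=.
by rewrite rmorphM fpe_actM fpe_shiftD -!mulrA; congr (_ * _); rewrite !mulrA fpe_shift_emb.
Qed.

Lemma haar_poly_closed : GRing.subalg_closed [in haar_poly].
Proof.
apply: subalg_closedP.
- exists [:: (0, 1)]; rewrite /shift_poly /= !big_seq1 /= star1 oppr0 rmorph1.
  by rewrite fpe_act1 fpe_shift0 mulr1.
- move=> c z w [L [Lp Lq]] [L' [Lp' Lq']].
  exists ([seq (x.1, c *: x.2) | x <- L] ++ L').
  rewrite /conj_poly map_cat !shift_poly_cat.
  rewrite -[(c *: z + w).1.2]/(c *: z.1.2 + w.1.2).
  rewrite -[(c *: z + w).2]/((c^* : C) *: (z.2 : P) + (w.2 : P)).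
  rewrite Lp Lq Lp' Lq' /shift_poly !big_map !scaler_sumr.
  split; congr (_ + _); apply: eq_bigr => x _ /=.
    by rewrite linearZ /= fpe_actZ scalerAl.
  by rewrite starZ linearZ /= fpe_actZ scalerAl.
move=> z w [L [Lp Lq]] [L' [Lp' Lq']].
exists [seq (x.1 + y.1, x.2 * y.2) | x <- L, y <- L'].
rewrite -[(z * w).1.2]/(z.1.2 * w.1.2) -[(z * w).2]/((w.2 : P) * (z.2 : P)).
rewrite Lp Lq Lp' Lq'; split; first exact: shift_poly_mul.
rewrite shift_poly_mul /shift_poly big_allpairs_dep /conj_poly !big_map big_allpairs_dep.
rewrite [RHS]exchange_big /=; apply: eq_bigr => x _; rewrite big_map.
by apply: eq_bigr => y _ /=; rewrite starM opprD addrC.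
Qed.

Lemma haar_poly_gen :
  (gen_subalg (range (emb fp_ncps) `|` [set fp_haar; star fp_haar]) `<=` haar_poly)%classic.
Proof.
apply: gen_subalg_ind => [|z [[b _ <-]|[->|->]]]; first exact: haar_poly_closed.
- exists [:: (0, b)]; rewrite /shift_poly /conj_poly /= !big_seq1 /= oppr0 fpe_shift0 !mulr1.
  by rewrite emb_star.
- exists [:: (1, 1)]; rewrite /shift_poly /conj_poly /= !big_seq1 /= star1 rmorph1.
  by rewrite fpe_act1 !mul1r.
- exists [:: (-1, 1)]; rewrite /shift_poly /conj_poly /= !big_seq1 /= star1 rmorph1.
  by rewrite fpe_act1 !mul1r opprK.
Qed.

Lemma fpe_exp_shift_poly L : fpe_exp (shift_poly A L) = const_term L.
Proof.
rewrite /fpe_exp /shift_poly fpsum_app /const_term [RHS]big_mkcond /=.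
apply: eq_bigr => -[k b] _.
rewrite -[LHS]/(fpe_act (emb A b) (fp_shift k (fp_vac A)) 0 (1, [::])).
by rewrite fpe_act_embE /= add0r mul1r.
Qed.

Lemma const_term_conj L : const_term (conj_poly L) = star (const_term L).
Proof.
rewrite /const_term /conj_poly big_map (big_morph (@star C B) (@starD C B) (star0 B)).
by apply: eq_bigl => x /=; rewrite oppr_eq0.
Qed.

Lemma fps_exp_haar_poly (z : fp_ncps) L :
  (z : fpstar).1.2 = shift_poly A L -> (z : fpstar).2 = shift_poly A (conj_poly L) ->
  cexp fp_ncps z = const_term L.
Proof.
move=> zp zq; rewrite -[LHS]/(fps_exp z) /fps_exp zp zq.
by rewrite !fpe_exp_shift_poly const_term_conj starK half_add.
Qed.

Lemma fp_haar_moments k : (0 < k)%N -> cexp fp_ncps (fp_haar ^+ k) = 0.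
Proof.
move=> k0; have E : forall k : nat, ((fp_haar ^+ k : fp_ncps) : fpstar).1.2 = fpe_shift A k%:Z /\
    ((fp_haar ^+ k : fp_ncps) : fpstar).2 = fpe_shift A (- k%:Z).
  elim=> [|n [IH1 IH2]]; first by rewrite expr0 oppr0 fpe_shift0.
  rewrite exprS -[(_ * _).1.2]/(fpe_shift A 1 * (fp_haar ^+ n : fpstar).1.2).
  rewrite -[(_ * _).2]/(((fp_haar ^+ n : fpstar).2 : P) * fpe_shift A (-1)).
  rewrite IH1 IH2 -!fpe_shiftD -[- n%:Z - 1]opprD.
  by rewrite [n%:Z + 1]addrC intS.
rewrite (@fps_exp_haar_poly _ [:: (k%:Z, 1)]).
- by rewrite /const_term big_cons big_nil /= (_ : (k%:Z == 0) = false) //; case: (k) k0.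
- by rewrite (E k).1 /shift_poly big_seq1 rmorph1 fpe_act1 mul1r.
- by rewrite (E k).2 /shift_poly big_seq1 /= star1 rmorph1 fpe_act1 mul1r.
Qed.

Lemma fp_incl_gen (a : A) :
  (gen_subalg (range (emb fp_ncps) `|` [set (fp_incl a : fp_ncps); star (fp_incl a : fp_ncps)])
     `<=` range (fp_incl : A -> fp_ncps))%classic.
Proof.
apply: gen_subalg_ind => [|z [[b _ <-]|[->|->]]].
- apply: subalg_closedP; first by exists 1 => //; rewrite rmorph1.
    by move=> c _ _ [x _ <-] [y _ <-]; exists (c *: x + y) => //; rewrite linearP.
  by move=> _ _ [x _ <-] [y _ <-]; exists (x * y) => //; rewrite rmorphM.
- by exists (emb A b).
- by exists a.
- by exists (star a) => //; rewrite fp_incl_star.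
Qed.

(** Both operator components of an alternating product vanish; the second one
    is a product in the reverse order, which alternates as well. *)
Lemma fp_free (a : A) : free_B [set fp_haar; star fp_haar]%classic
  [set (fp_incl a : fp_ncps); star (fp_incl a : fp_ncps)]%classic.
Proof.
move=> n i y n0 gy Ey alt.
have facts k : (k < n)%N -> free_factor (i k, (y k : fpstar).1.2) /\
    free_factor (i k, ((y k : fpstar).2 : P)).
  move=> kn; have := gy k kn; have := Ey k kn; rewrite /free_factor /=.
  case: (i k) => Ek.
    move/fp_incl_gen => [x _ yE]; rewrite -yE /=.
    have x0 : cexp A x = 0 by rewrite -fps_exp_incl -[LHS]/(cexp fp_ncps (fp_incl x)) yE.
    by split; [exists x|exists (star x); rewrite // cexp_star x0 star0].
  move/haar_poly_gen => [L [yp yq]].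
  have L0 : const_term L = 0 by rewrite -(fps_exp_haar_poly yp yq).
  by split; [exists L|exists (conj_poly L); rewrite // const_term_conj L0 star0].
rewrite -[LHS]/(fps_exp _) /fps_exp.
have -> : ((\prod_(0 <= k < n) y k : fp_ncps) : fpstar).1.2 =
    \prod_(x <- mkseq (fun k => (i k, (y k : fpstar).1.2)) n) x.2.
  rewrite /mkseq big_map -{2}[n]subn0 -/(index_iota 0 n).
  by apply: (big_morph (fun z : fpstar => z.1.2)).
have -> : (((\prod_(0 <= k < n) y k : fp_ncps) : fpstar).2 : P) =
    \prod_(x <- rev (mkseq (fun k => (i k, ((y k : fpstar).2 : P))) n)) x.2.
  rewrite -map_rev big_map -[in RHS](subn0 n) -/(index_iota 0 n) -rev_prodr.
  by apply: (big_morph (fun z : fpstar => z.2)).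
rewrite !free_product_vanish ?star0 ?addr0 ?scaler0 //.
- by move=> x; rewrite mem_rev => /mapP[k]; rewrite mem_iota => /andP[_ kn] ->;
  apply: (facts k kn).2.
- by rewrite /unzip1 map_rev rev_sorted; under eq_sorted do rewrite eq_sym;
    apply: alternating_mkseq.
- by rewrite size_rev size_mkseq.
- by move=> x /mapP[k]; rewrite mem_iota => /andP[_ kn] ->; apply: (facts k kn).1.
- exact: alternating_mkseq.
- by rewrite size_mkseq.
Qed.

End HaarEnlargement.

Lemma rotation_invariant_haar (C : numClosedFieldType) (B : starAlgType C) (A : ncps B) (a : A) :
  rotation_invariant a -> haar_rotation a.
Proof.
move=> He; exists (fp_ncps A), (fp_enl A), (fp_haar A).
split; first exact: fp_haar_unitary.
split; [exact: fp_haar_commute|exact: fp_free|exact: fp_haar_moments|].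
by apply: He; [exact: fp_haar_unitary|exact: fp_haar_commute|exact: fp_free].
Qed.

(** * Freeness of two by two matrices *)

Section AdditiveSpan.
Variable V : zmodType.

(** Sums of elements of a set, as an inductive predicate: additive maps are then
    controlled on the generators by [aspan_map]. *)
Inductive aspan (S : V -> Prop) : V -> Prop :=
| aspan0 : aspan S 0
| aspanD x y : S x -> aspan S y -> aspan S (x + y).

Lemma aspan_incl (S : V -> Prop) x : S x -> aspan S x.
Proof. by move=> Sx; rewrite -[x]addr0; apply: aspanD => //; apply: aspan0. Qed.

Lemma aspan_add (S : V -> Prop) x y : aspan S x -> aspan S y -> aspan S (x + y).
Proof.
by elim=> [|u v Su _ IH] Sy; rewrite ?add0r // -addrA; apply: aspanD => //; apply: IH.
Qed.

End AdditiveSpan.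

Lemma aspan_map (V W : zmodType) (S : V -> Prop) (T : W -> Prop) (f : V -> W) x :
    aspan S x -> f 0 = 0 -> {morph f : x y / x + y} ->
    (forall x, S x -> aspan T (f x)) ->
  aspan T (f x).
Proof.
move=> Sx f0 fD ST; elim: Sx => [|u v Su _ IH]; first by rewrite f0; apply: aspan0.
by rewrite fD; apply: aspan_add; [apply: ST|].
Qed.

Lemma aspan_mul (R : nzRingType) (S T U : R -> Prop) x y :
    (forall x y, S x -> T y -> aspan U (x * y)) ->
  aspan S x -> aspan T y -> aspan U (x * y).
Proof.
move=> STU Sx Ty.
apply: (aspan_map (f := fun t => t * y) Sx) => [|u v|u Su]; rewrite ?mul0r ?mulrDl //.
by apply: (aspan_map Ty) => [|v w|v Tv]; rewrite ?mulr0 ?mulrDr //; apply: STU.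
Qed.

Section TwoByTwo.
Variables (C : numClosedFieldType) (B : starAlgType C) (A : ncps B) (a : A).
Local Notation emb := (emb A).
Local Notation cexp := (cexp A).
Implicit Types (e f c : bool) (w : seq (bool * B)) (ws : seq (seq (bool * B))).

Definition ent (x : mx2 A) (e c : bool) : A :=
  (x : 'M[A]_2) (if e then 1 else 0) (if c then 1 else 0).

Lemma ent_inj (x y : mx2 A) : (forall e c, ent x e c = ent y e c) -> x = y.
Proof.
move=> E; apply/matrixP => i j.
have ix (k : 'I_2) : k = if (k == 1) then 1 else 0.
  by case: k => -[|[|k]] // kP; apply/val_inj.
by have := E (i == 1) (j == 1); rewrite /ent -!ix.
Qed.

Lemma entM x y e c :
  ent (x * y) e c = ent x e false * ent y false c + ent x e true * ent y true c.
Proof.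
rewrite /ent mxE big_ord_recl big_ord1.
by have -> : lift ord0 ord0 = 1 :> 'I_2 by apply/val_inj.
Qed.

Lemma entD x y e c : ent (x + y) e c = ent x e c + ent y e c.
Proof. by rewrite /ent mxE. Qed.

Lemma entZ (k : C) (x : mx2 A) e c : ent (k *: x) e c = k *: ent x e c.
Proof. by rewrite /ent mxE. Qed.

Lemma ent0 e c : ent 0 e c = 0.
Proof. by rewrite /ent mxE. Qed.

Lemma ent1 e c : ent 1 e c = if e == c then 1 else 0.
Proof. by rewrite /ent mxE; case: e; case: c. Qed.

Lemma ent_mk x11 x12 x21 x22 e c : ent (mk_mx2 x11 x12 x21 x22) e c =
  if e then (if c then x22 else x21) else (if c then x12 else x11).
Proof. by rewrite /ent mxE; case: e; case: c. Qed.

Lemma ent_cexp2 x e c : ent (cexp2 A x) e c = if e == c then emb (cexp (ent x e e)) else 0.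
Proof. by rewrite /cexp2 ent_mk; case: e; case: c. Qed.

Lemma cexp2_eq0 x : cexp2 A x = 0 <-> forall e, cexp (ent x e e) = 0.
Proof.
split=> [E e|E].
  have := congr1 (fun y => ent y e e) E; rewrite ent_cexp2 eqxx ent0.
  by move=> H; apply: (@emb_inj _ _ A); rewrite H raddf0.
by apply: ent_inj => e c; rewrite ent_cexp2 ent0; case: eqP => // _; rewrite E raddf0.
Qed.

(** The row index gives the first letter of the words, and the two indices give
    the parity of their lengths. *)
Definition alt_span (e c : bool) : A -> Prop := aspan (fun x =>
  exists2 s : state B bool, alternates e s.2 /\ odd (size s.2) = (e != c) & x = sval a s).

(** The parities make the last letter of a word in the entry (e, c) differ from
    the first letter of a word in the entry (c, d). *)
Lemma alt_spanM e c d x y : alt_span e c x -> alt_span c d y -> alt_span e d (x * y).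
Proof.
apply: aspan_mul => _ _ [[b w] [/= aw ow] ->] [[b' w'] [/= aw' ow'] ->].
apply: aspan_incl; exists ((rmul (b, w) b').1, (rmul (b, w) b').2 ++ w') => /=.
  rewrite alternates_cat alternates_rmul aw size_cat size_rmul /= oddD ow ow'.
  by case: (e) (c) (d) aw' => -[] [].
rewrite {2}/sval /= mulrA -sval_rmul.
by rewrite /sval /= wval_cat mulrA.
Qed.

Let z := mk_mx2 0 a (star a) 0.

Lemma gen_z_span y : gen_subalg (B2 A `|` [set z])%classic y ->
  forall e c, alt_span e c (ent y e c).
Proof.
have bs b e : alt_span e e (emb b).
  apply: aspan_incl; exists (b, [::]); rewrite /= ?eqxx //.
  by rewrite /sval /= wval_nil mulr1.
have as0 e c : alt_span e c 0 by apply: aspan0.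
move: y; apply: gen_subalg_ind => [|y [[b1 [b2 ->]]|->] e c].
- apply: subalg_closedP.
  + move=> e c; rewrite ent1; case: eqP => [->|_] //.
    by rewrite -(rmorph1 emb); apply: bs.
  + move=> k x y Hx Hy e c; rewrite entD entZ; apply: aspan_add; last exact: Hy.
    apply: (aspan_map (f := fun t : A => k *: t) (Hx e c)) => [|u v|_ [[b w] /= P ->]];
      rewrite ?scaler0 ?scalerDr //.
    apply: aspan_incl; exists (k *: b, w) => //.
    by rewrite /sval /= linearZ /= scalerAl.
  + move=> x y Hx Hy e c; rewrite entM.
    by apply: aspan_add; apply: (alt_spanM (Hx _ _) (Hy _ _)).
- by rewrite ent_mk; case: e; case: c.
have asz f : alt_span f (~~ f) (spow a f).
  apply: aspan_incl; exists (1, [:: (f, 1)]); rewrite /= ?eqxx; first by case: f.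
  by rewrite /sval /= wval_cons wval_nil /= rmorph1 !mulr1 mul1r.
rewrite ent_mk; case: e; case: c; do ?exact: as0.
  exact: (asz true).
exact: (asz false).
Qed.

Definition cent_span (e c : bool) : A -> Prop := aspan (fun x =>
  exists2 s : state B bool, [/\ alternates e s.2, (0 < size s.2)%N &
    odd (size s.2) = (e != c)] & x = emb s.1 * centered (wval a s.2)).

Lemma gen_z_centered y : Rdiag_moments (wmoment a) ->
    gen_subalg (B2 A `|` [set z])%classic y -> cexp2 A y = 0 ->
  forall e c, cent_span e c (ent y e c).
Proof.
move=> /Rdiag_momentsE[oM _] gy /cexp2_eq0 Ey e c.
have : cent_span e c (centered (ent y e c)).
  apply: (aspan_map (f := fun t => centered t) (gen_z_span gy e c)) =>
    [|u v|_ [[b w] /= [aw ow] ->]].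
  - by rewrite /centered !raddf0 addr0.
  - exact: centeredD.
  case: w aw ow => [|x w] aw ow.
    by rewrite /sval wval_nil mulr1 /centered cexp_emb subrr; apply: aspan0.
  by apply: aspan_incl; exists (b, x :: w) => //; rewrite /sval centeredMl.
rewrite centered_id //; have [<-//|ec] := eqVneq e c.
have : alt_span e c (ent y e c) by apply: gen_z_span.
elim=> [|_ v [[b w] /= [aw ow] ->] _ IH]; first by rewrite raddf0.
by rewrite linearD /= IH addr0 /sval cexpMl /= (oM e) ?mulr0 // ow.
Qed.

Lemma gen_M2B (y : mx2 A) : gen_subalg (B2 A `|` M2B A)%classic y -> M2B A y.
Proof.
have mkE (x : mx2 A) : (forall e c, exists b, ent x e c = emb b) -> M2B A x.
  move=> H; have [b1 E1] := H false false; have [b2 E2] := H false true.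
  have [b3 E3] := H true false; have [b4 E4] := H true true.
  exists b1, b2, b3, b4; apply: ent_inj => e c; rewrite ent_mk.
  by case: e; case: c.
have entB (x : mx2 A) : M2B A x -> forall e c, exists b, ent x e c = emb b.
  move=> [b1 [b2 [b3 [b4 ->]]]] e c; rewrite ent_mk.
  by case: e; case: c; [exists b4|exists b3|exists b2|exists b1].
move: y; apply: gen_subalg_ind => [|y [[b1 [b2 ->]]|//]].
  apply: subalg_closedP.
  - apply: mkE => e c; rewrite ent1; case: eqP => _; first by exists 1; rewrite rmorph1.
    by exists 0; rewrite raddf0.
  - move=> k x y /entB Hx /entB Hy; apply: mkE => e c.
    have [b1 E1] := Hx e c; have [b2 E2] := Hy e c.
    by exists (k *: b1 + b2); rewrite entD entZ E1 E2 linearP.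
  move=> x y /entB Hx /entB Hy; apply: mkE => e c; rewrite entM.
  have [b1 ->] := Hx e false; have [b2 ->] := Hx e true.
  have [b3 ->] := Hy false c; have [b4 ->] := Hy true c.
  by exists (b1 * b3 + b2 * b4); rewrite rmorphD !rmorphM.
by exists b1, 0, 0, b2; rewrite raddf0.
Qed.

(** The two diagonal entries are equal to their expectations. *)
Lemma gen_M2B_centered (y : mx2 A) : gen_subalg (B2 A `|` M2B A)%classic y ->
    cexp2 A y = 0 ->
  exists2 o : bool -> B, forall e, ent y e e = 0 & forall e, ent y e (~~ e) = emb (o e).
Proof.
move=> /gen_M2B[b1 [b2 [b3 [b4 ->]]]] /cexp2_eq0 E.
exists (fun e => if e then b3 else b2) => e; last by rewrite ent_mk; case: e.
by have := E e; rewrite ent_mk; case: e; rewrite cexp_emb => ->; rewrite raddf0.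
Qed.

Lemma chain_rcons e ws w : chain e (rcons ws w) =
  [&& chain e ws, (0 < size w)%N & alternates (last_letter e ws) w].
Proof.
elim: ws e => [|w' ws IH] e /=; first by rewrite andbT.
by rewrite IH -!andbA.
Qed.

Lemma last_letter_rcons e ws w :
  last_letter e (rcons ws w) = last_letter e ws (+) ~~ odd (size w).
Proof. by rewrite /last_letter -cats1 foldl_cat. Qed.

(** The index [f] is the letter with which the next word of the chain starts. *)
Definition chain_span (f : bool) : A -> Prop := aspan (fun x =>
  exists e (b : B) ws, [/\ chain e ws, (0 < size ws)%N, last_letter e ws = f &
    x = emb b * \prod_(w <- ws) centered (wval a w)]).

Lemma chain_span_step f x b s : chain_span f x -> alternates f s.2 -> (0 < size s.2)%N ->
  chain_span (f (+) ~~ odd (size s.2)) (x * (emb b * (emb s.1 * centered (wval a s.2)))).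
Proof.
move=> Hx as0 s0; set y := emb b * (_ * _).
apply: (aspan_map (f := fun t => t * y) Hx) => [|u v|_ [e [b0 [ws [cws ws0 lws ->]]]]];
  [exact: mul0r|exact: mulrDl|].
apply: aspan_incl; case/lastP: ws cws ws0 lws => // ws w.
rewrite chain_rcons last_letter_rcons => /and3P[cws w0 aw] _ lws.
pose w' := (rmul (1, w) (b * s.1)).2.
exists e, b0, (rcons (rcons ws w') s.2).
rewrite !chain_rcons !last_letter_rcons size_rmul alternates_rmul cws w0 aw s0 /= lws.
split=> //; first by rewrite size_rcons.
rewrite -!cats1 !big_cat /= !big_cons !big_nil !mulr1 -centered_rmul // /y.
by rewrite [emb (b * _)]rmorphM !mulrA.
Qed.

Lemma chain_span_start e c x b : cent_span e c x -> chain_span (~~ c) (emb b * x).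
Proof.
move=> Hx; apply: (aspan_map (f := fun t => emb b * t) Hx) => [|u v|_ [s [aw w0 ow] ->]];
  [by rewrite !mulr0|by rewrite !mulrDr|].
apply: aspan_incl; exists e, (b * s.1), [:: s.2]; rewrite /= w0 aw ow.
split=> //; first by case: (e) (c) => -[].
by rewrite big_cons big_nil mulr1 rmorphM mulrA.
Qed.

Lemma chain_span_mul c d x b y : chain_span c x -> cent_span c d y ->
  chain_span (~~ d) (x * (emb b * y)).
Proof.
move=> Hx Hy; apply: (aspan_map (f := fun t => x * (emb b * t)) Hy) =>
  [|u v|_ [s [aw w0 ow] ->]];
  [by rewrite !mulr0|by rewrite !mulrDr|].
have := chain_span_step b Hx aw w0; rewrite ow.
by case: (c) (d) => -[].
Qed.

Lemma chain_span_mulr f x b : chain_span f x -> chain_span f (x * emb b).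
Proof.
move=> Hx; apply: (aspan_map (f := fun t => t * emb b) Hx) =>
  [|u v|_ [e [b0 [ws [cws ws0 lws ->]]]]];
  [exact: mul0r|exact: mulrDl|].
apply: aspan_incl; case/lastP: ws cws ws0 lws => // ws w.
rewrite chain_rcons last_letter_rcons => /and3P[cws w0 aw] _ lws.
exists e, b0, (rcons ws (rmul (1, w) b).2).
rewrite !chain_rcons !last_letter_rcons size_rmul alternates_rmul cws w0 aw /= lws.
split=> //; first by rewrite size_rcons.
rewrite -!cats1 !big_cat /= !big_cons !big_nil !mulr1 -centered_rmul //.
by rewrite !mulrA.
Qed.

Lemma chain_span_cexp f x : Rdiag_moments (wmoment a) -> chain_span f x -> cexp x = 0.
Proof.
move=> /Rdiag_momentsE[_ cM]; elim=> [|_ v [e [b [ws [cws ws0 _ ->]]]] _ IH].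
  by rewrite raddf0.
by rewrite linearD /= IH addr0 cexpMl (cM e) // mulr0.
Qed.

Definition mx2_free := free_over (B2 A) (cexp2 A) [set z]%classic (M2B A).

(** After a factor from the algebra of [z], an entry in the column [c] awaits a
    word that starts with [~~ c]; an antidiagonal factor then exchanges the
    columns, and the awaited letter is the row index of the next factor. *)
Definition mx_state (t : bool) (X : mx2 A) : Prop :=
  forall e c, chain_span (if t then c else ~~ c) (ent X e c).

Lemma mx_state_run (xs : seq (bool * mx2 A)) t X : Rdiag_moments (wmoment a) ->
    free_factors (B2 A) (cexp2 A) [set z]%classic (M2B A) xs ->
    path (fun i j => i != j) t (unzip1 xs) -> mx_state t X ->
  exists t', mx_state t' (X * \prod_(x <- xs) x.2).
Proof.
move=> Ra; elim: xs t X => [|[t' y] xs IH] t X fx /= px HX.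
  by exists t; rewrite big_nil mulr1.
case/andP: px => tt' px; rewrite big_cons mulrA; apply: IH px _ => [x xxs|].
  by apply: fx; rewrite inE xxs orbT.
have /= [gy Ey] := fx (t', y) (mem_head _ _).
case: t' tt' gy {fx} => /=; case: t HX => //= HX _ gy e c.
  have [o o0 oE] := gen_M2B_centered gy Ey.
  have -> : ent (X * y) e c = ent X e (~~ c) * emb (o (~~ c)).
    rewrite -oE entM negbK; case: (c); rewrite o0 ?mulr0 ?addr0 ?add0r //.
  by apply: chain_span_mulr; have := HX e (~~ c); rewrite negbK.
have Hy := gen_z_centered Ra gy Ey.
have M d : chain_span (~~ c) (ent X e d * ent y d c).
  rewrite -[ent y d c]mul1r -(rmorph1 emb).
  exact: (chain_span_mul 1 (HX e d) (Hy d c)).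
by rewrite entM; apply: aspan_add; apply: M.
Qed.

Lemma Rdiag_mx2_free : Rdiag_moments (wmoment a) -> mx2_free.
Proof.
move=> Ra n i y n0 gy Ey alt.
pose xs := mkseq (fun k => (i k, y k)) n.
have -> : \prod_(0 <= k < n) y k = \prod_(x <- xs) x.2.
  by rewrite /xs /mkseq big_map /index_iota subn0.
have fx : free_factors (B2 A) (cexp2 A) [set z]%classic (M2B A) xs.
  move=> x /mapP[k]; rewrite mem_iota => /andP[_ kn] ->.
  by split; [apply: gy|apply: Ey].
have sx : sorted (fun i j => i != j) (unzip1 xs).
  exact: alternating_mkseq.
have : (0 < size xs)%N by rewrite size_mkseq.
have fin xs' t X : free_factors (B2 A) (cexp2 A) [set z]%classic (M2B A) xs' ->
    path (fun i j => i != j) t (unzip1 xs') -> mx_state t X ->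
    cexp2 A (X * \prod_(x <- xs') x.2) = 0.
  move=> fx' px HX; have [t' H] := mx_state_run Ra fx' px HX.
  by apply/cexp2_eq0 => e; apply: (chain_span_cexp Ra (H e e)).
have tl x l : free_factors (B2 A) (cexp2 A) [set z]%classic (M2B A) (x :: l) ->
    free_factors (B2 A) (cexp2 A) [set z]%classic (M2B A) l.
  by move=> fl u ul; apply: fl; rewrite inE ul orbT.
case: (xs) fx sx => [//|[t y1] xs1] fx sx _; rewrite big_cons.
have /= [gy1 Ey1] := fx _ (mem_head _ _).
case: t fx sx gy1 => fx sx gy1; last first.
  apply: fin sx _; first exact: tl fx.
  move=> e c; rewrite -[ent _ _ _]mul1r -(rmorph1 emb).
  exact: chain_span_start (gen_z_centered Ra gy1 Ey1 e c).
(* an antidiagonal factor in front exchanges the rows of the next factor *)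
case: xs1 fx sx => [|[t y2] xs1] fx sx; first by rewrite big_nil mulr1.
case: t fx sx => fx //= sx.
have /= [gy2 Ey2] := tl _ _ fx _ (mem_head _ _).
rewrite big_cons mulrA; apply: fin sx _; first exact: tl (tl _ _ fx).
move=> e c; have [o o0 oE] := gen_M2B_centered gy1 Ey1.
have -> : ent (y1 * y2) e c = emb (o e) * ent y2 (~~ e) c.
  rewrite -oE entM; case: (e); rewrite o0 mul0r ?addr0 ?add0r //.
exact: chain_span_start (gen_z_centered Ra gy2 Ey2 (~~ e) c).
Qed.

Definition elm (e c : bool) (x : A) : mx2 A :=
  mk_mx2 (if ~~ e && ~~ c then x else 0) (if ~~ e && c then x else 0)
         (if e && ~~ c then x else 0) (if e && c then x else 0).

Lemma ent_elm e c x e' c' : ent (elm e c x) e' c' = if (e == e') && (c == c') then x else 0.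
Proof. by rewrite ent_mk; case: e; case: c; case: e'; case: c'. Qed.

Lemma elmM e c d x y : elm e c x * elm c d y = elm e d (x * y).
Proof.
apply: ent_inj => e' d'; rewrite entM !ent_elm.
by case: (e) (c) (d) e' d' => -[] [] [] [];
   rewrite /= ?(mul0r, mulr0, addr0, add0r).
Qed.

Definition flip : mx2 A := mk_mx2 0 1 1 0.

Lemma elm_flip e c x : elm e c x * flip = elm e (~~ c) x.
Proof.
apply: ent_inj => e' d'; rewrite entM !ent_elm !ent_mk.
by case: (e) (c) e' d' => -[] [] []; rewrite /= ?(mulr1, mul0r, mulr0, addr0, add0r).
Qed.

Let Gz := gen_subalg (B2 A `|` [set z])%classic.

Lemma elm_emb_gen e b : Gz (elm e e (emb b)).
Proof.
apply: gen_subalg_incl; left; exists (if e then 0 else b), (if e then b else 0).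
by apply: ent_inj => e' c'; rewrite ent_elm ent_mk; case: e; case: e'; case: c' => //=;
  rewrite raddf0.
Qed.

Lemma elm_wval_gen e w : alternates e w -> Gz (elm e (e (+) odd (size w)) (wval a w)).
Proof.
elim: w e => [|x w IH] e /=.
  by rewrite addbF wval_nil -(rmorph1 emb) => _; apply: elm_emb_gen.
case/andP=> /eqP xe /IH; rewrite wval_cons xe addbN -addNb => gw.
rewrite -(elmM _ (~~ e)); apply: gen_subalgM => //.
rewrite -(elmM _ (~~ e)); apply: gen_subalgM; last exact: elm_emb_gen.
rewrite (_ : elm _ _ _ = elm e e 1 * z).
  apply: gen_subalgM; last by apply: gen_subalg_incl; right.
  by rewrite -(rmorph1 emb); apply: elm_emb_gen.
apply: ent_inj => e' c'; rewrite entM !ent_elm !ent_mk.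
by case: (e) e' c' => -[] []; rewrite /= ?(mul1r, mul0r, mulr0, addr0, add0r).
Qed.

Lemma cexp2_elm e c x : e != c -> cexp2 A (elm e c x) = 0.
Proof.
move=> ec; apply/cexp2_eq0 => f; rewrite ent_elm; case: andP => [[/eqP ef /eqP cf]|].
  by rewrite ef cf eqxx in ec.
by rewrite raddf0.
Qed.

Lemma flip_gen : gen_subalg (B2 A `|` M2B A)%classic flip.
Proof.
apply: gen_subalg_incl; right; exists 0, 1, 1, 0.
by rewrite raddf0 rmorph1.
Qed.

Lemma cexp2_flip : cexp2 A flip = 0.
Proof. by apply/cexp2_eq0 => e; rewrite ent_mk; case: e; rewrite raddf0. Qed.

Fixpoint mx_factors (e : bool) ws : seq (bool * mx2 A) :=
  if ws is w :: ws' then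
    [:: (false, elm e (e (+) odd (size w)) (centered (wval a w))), (true, flip) &
      mx_factors (e (+) ~~ odd (size w)) ws']
  else [::].

Lemma prod_mx_factors e c ws x : chain e ws ->
  elm c e x * \prod_(y <- mx_factors e ws) y.2 =
  elm c (last_letter e ws) (x * \prod_(w <- ws) centered (wval a w)).
Proof.
elim: ws e x => [|w ws IH] e x /=; first by rewrite !big_nil !mulr1.
case/and3P=> w0 aw cws; rewrite !big_cons /= mulrA elmM mulrA elm_flip -addbN IH //.
by rewrite mulrA.
Qed.

(** A centered word sits at one entry of a matrix from the algebra of [z];
    multiplying such matrices with flips in between multiplies the words of a
    chain. *)
Lemma mx2_free_Rdiag : mx2_free -> Rdiag_moments (wmoment a).
Proof.
move=> Hf; apply/Rdiag_momentsE.
have oM e w : alternates e w -> odd (size w) -> cexp (wval a w) = 0.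
  move=> aw ow; pose y := elm e (~~ e) (wval a w).
  have gy : Gz y by have := elm_wval_gen aw; rewrite ow addbT.
  have Ey : cexp2 A y = 0 by apply: cexp2_elm; case: (e).
  have fx : free_factors (B2 A) (cexp2 A) [set z]%classic (M2B A)
      [:: (false, y); (true, flip)].
    move=> x; rewrite !inE => /orP[]/eqP-> //.
    by split; [apply: flip_gen|apply: cexp2_flip].
  have := free_over_seq (s := [:: (false, y); (true, flip)]) Hf isT fx isT.
  rewrite !big_cons big_nil mulr1 /= elm_flip negbK => /cexp2_eq0/(_ e).
  by rewrite ent_elm eqxx.
split=> // e ws ws0 cws.
have fcent f w : alternates f w ->
    let y := elm f (f (+) odd (size w)) (centered (wval a w)) in
    Gz y /\ cexp2 A y = 0.
  move=> aw; split.
    case ow : (odd (size w)).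
      by rewrite centered_id ?(oM f) //; have := elm_wval_gen aw; rewrite ow.
    have := gen_subalgB (elm_wval_gen aw) (elm_emb_gen f (cexp (wval a w))).
    rewrite ow addbF; congr (gen_subalg _ _); apply: ent_inj => e' c'.
    rewrite entD -scaleN1r entZ scaleN1r !ent_elm; case: ifP => // _.
    by rewrite subr0.
  apply/cexp2_eq0 => f'; rewrite ent_elm; case: ifP => _; last by rewrite raddf0.
  exact: cexp_centered.
have fok f us : chain f us ->
    free_factors (B2 A) (cexp2 A) [set z]%classic (M2B A) (mx_factors f us) /\
    path (fun i j => i != j) true (unzip1 (mx_factors f us)).
  elim: us f => [|w us IH] f //= /and3P[w0 aw /IH[fus pus]]; split=> //.
  move=> x; rewrite !inE => /or3P[/eqP->|/eqP->|/fus //]; first exact: fcent.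
  by split; [apply: flip_gen|apply: cexp2_flip].
case/lastP: ws ws0 cws => // ws w _ cww.
have := cww; rewrite chain_rcons => /and3P[cws w0 aw].
set l := last_letter e ws; set n := size w.
have [fws pws] := fok _ _ cws.
pose y := elm l (l (+) odd n) (centered (wval a w)).
pose xs := rcons (mx_factors e ws) (false, y).
have [gy Ey] := fcent _ _ aw.
have fx : free_factors (B2 A) (cexp2 A) [set z]%classic (M2B A) xs.
  by move=> x; rewrite mem_rcons inE => /predU1P[->|/fws].
have last_true us f : last true (unzip1 (mx_factors f us)) = true.
  by elim: us f => //= w' us IH f; apply: IH.
have px : path (fun i j => i != j) true (unzip1 xs).
  by rewrite /xs /unzip1 map_rcons rcons_path pws /= -/(unzip1 _) last_true.
have prodE : elm e e 1 * \prod_(x <- xs) x.2 =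
    elm e (l (+) odd n) (\prod_(w <- rcons ws w) centered (wval a w)).
  rewrite /xs -!cats1 !big_cat /= !big_cons !big_nil !mulr1 mulrA.
  by rewrite prod_mx_factors // mul1r elmM.
set X := \prod_(w <- rcons ws w) _ in prodE *.
(* only the diagonal entries are seen by the expectation: if the product is
   off diagonal, one more flip moves it there *)
have [ell|ell] := eqVneq (l (+) odd n) e.
  have := free_over_seq Hf _ fx (path_sorted px).
  rewrite size_rcons => /(_ isT)/cexp2_eq0/(_ e).
  have -> : ent (\prod_(x <- xs) x.2) e e = ent (elm e e 1 * \prod_(x <- xs) x.2) e e.
    by rewrite entM !ent_elm; case: (e); rewrite /= mul1r mul0r ?addr0 ?add0r.
  by rewrite prodE ell ent_elm eqxx.
have fx2 : free_factors (B2 A) (cexp2 A) [set z]%classic (M2B A) (rcons xs (true, flip)).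
  move=> x; rewrite mem_rcons inE => /predU1P[->|/fx //].
  by split; [apply: flip_gen|apply: cexp2_flip].
have px2 : path (fun i j => i != j) true (unzip1 (rcons xs (true, flip))).
  rewrite /unzip1 map_rcons rcons_path px.
  by rewrite /xs map_rcons last_rcons.
have := free_over_seq Hf _ fx2 (path_sorted px2).
rewrite size_rcons => /(_ isT)/cexp2_eq0/(_ e).
rewrite -cats1 big_cat /= big_cons big_nil mulr1.
set Y := \prod_(x <- xs) x.2 in prodE *.
have -> : ent (Y * flip) e e = ent (elm e e 1 * Y * flip) e e.
  by rewrite -mulrA [RHS]entM !ent_elm; case: (e); rewrite /= mul1r mul0r ?addr0 ?add0r.
rewrite prodE elm_flip (_ : ~~ _ = e) ?ent_elm ?eqxx //.
by case: (e) (_ (+) _) ell => -[].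
Qed.

End TwoByTwo.

(** * Moments produced by a family of cumulants *)

Section FockProcess.
Variables (C : numClosedFieldType) (B : starAlgType C) (I : Type).
Variable beta : seq (I * B) -> B.
Local Notation state := (state B I).
Implicit Types (s : state) (l w : seq (I * B)) (f g : state -> B).

(** One step of the process: the letter [x] is put on the stack, and either
    stays there or completes the block formed by the letters above height [p],
    whose value [beta] multiplies the coefficient below.  This is the action of
    an element on the full Fock space, written for functions of the stack. *)
Definition push (x : I * B) f s : B :=
  f (s.1, rcons s.2 x) +
  \sum_(p < (size s.2).+1) f (rmul (s.1, take p s.2) (beta (drop p (rcons s.2 x)))).

Fixpoint fock w f : state -> B := if w is x :: w' then push x (fock w' f) else f.

Definition vacuum s : B := if s.2 is [::] then s.1 else 0.

Definition fock_moment w : B := fock w vacuum (1, [::]).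

Lemma fock_cat w1 w2 f : fock (w1 ++ w2) f = fock w1 (fock w2 f).
Proof. by elim: w1 => //= x w1 ->. Qed.

Lemma fock_rcons w x f : fock (rcons w x) f = fock w (push x f).
Proof. by rewrite -cats1 fock_cat. Qed.

Lemma eq_fock w f g : f =1 g -> fock w f =1 fock w g.
Proof.
elim: w => //= x w IH fg s; rewrite /push IH //; congr (_ + _).
by apply: eq_bigr => p _; rewrite IH.
Qed.

Lemma fockD w f g s : fock w (fun t => f t + g t) s = fock w f s + fock w g s.
Proof.
elim: w s => //= x w IH s; rewrite /push IH (eq_bigr _ (fun p _ => IH _)).
by rewrite big_split /= addrACA.
Qed.

Lemma fock_morph w (h : B -> B) f s : h 0 = 0 -> {morph h : x y / x + y} ->
  fock w (fun t => h (f t)) s = h (fock w f s).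
Proof.
move=> h0 hD; elim: w s => //= x w IH s; rewrite /push IH (eq_bigr _ (fun p _ => IH _)).
by rewrite hD (big_morph h hD h0).
Qed.

Definition left_linear f := forall b b0 l, f (b * b0, l) = b * f (b0, l).

Lemma rmul_left b b0 l v :
  rmul (b * b0, l) v = (b * (rmul (b0, l) v).1, (rmul (b0, l) v).2).
Proof.
by elim/last_ind: l => [|l x _]; rewrite ?rmul_nil ?rmul_rcons //= mulrA.
Qed.

Lemma left_linear_fock w f : left_linear f -> left_linear (fock w f).
Proof.
move=> fl; elim: w => //= x w IH b b0 l; rewrite /push /= IH mulrDr; congr (_ + _).
rewrite big_distrr /=; apply: eq_bigr => p _.
by rewrite rmul_left IH; case: rmul.
Qed.

Lemma left_linear_vacuum : left_linear vacuum.
Proof. by move=> b b0 [|x l]; rewrite /vacuum /= ?mulr0. Qed.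

Definition slot_additive (g : seq (I * B) -> B) := forall l1 e b b' l2,
  g (l1 ++ (e, b + b') :: l2) = g (l1 ++ (e, b) :: l2) + g (l1 ++ (e, b') :: l2).

Record multi_additive f : Prop := MultiAdditive {
  multi_base : forall b b' l, f (b + b', l) = f (b, l) + f (b', l);
  multi_slot : forall b, slot_additive (fun l => f (b, l)) }.

Lemma multi_rmulD f s v v' : multi_additive f ->
  f (rmul s (v + v')) = f (rmul s v) + f (rmul s v').
Proof.
case=> fb fs; case: s => b; elim/last_ind => [|l x _]; rewrite ?rmul_nil ?rmul_rcons.
  by rewrite mulrDr fb.
by rewrite mulrDr -!cats1 fs.
Qed.

Lemma multi_rmul0 f s : multi_additive f -> f (rmul s 0) = 0.
Proof.
by move=> fm; apply: (addrI (f (rmul s 0))); rewrite -multi_rmulD // !addr0.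
Qed.

Lemma rmul_cat_cons b l1 x l2 v : rmul (b, l1 ++ x :: l2) v =
  (b, l1 ++ (if l2 is [::] then (x.1, x.2 * v) else x) :: (rmul (b, l2) v).2).
Proof.
case/lastP: l2 => [|l2 y]; first by rewrite cats1 rmul_rcons cats1.
rewrite -rcons_cons -rcons_cat !rmul_rcons /= rcons_cat /=.
by case: l2.
Qed.

Lemma multi_rmul f v : multi_additive f -> multi_additive (fun s => f (rmul s v)).
Proof.
move=> [fb fs]; split=> [b b' l|b l1 e c c' l2].
  by elim/last_ind: l => [|l x _]; rewrite ?rmul_nil ?rmul_rcons -?fb ?mulrDl.
by rewrite !rmul_cat_cons; case: l2 => [|y l2] /=; rewrite ?mulrDl fs.
Qed.

Lemma multi_vacuum : multi_additive vacuum.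
Proof.
split=> [b b' [|x l]|b [|x l1] e c c' l2]; rewrite /vacuum /= ?addr0 //.
Qed.

Hypothesis beta_add : slot_additive beta.

Lemma multi_push x f : multi_additive f -> multi_additive (push x f).
Proof.
move=> fm; have [fb fs] := fm; split=> [b b' l|b l1 e c c' l2]; rewrite /push /=.
  rewrite fb addrACA -big_split /=; congr (_ + _); apply: eq_bigr => p _.
  by have [+ _] := multi_rmul (beta (drop p (rcons l x))) fm; apply.
rewrite !rcons_cat /= fs addrACA; congr (_ + _).
rewrite !size_cat /= -big_split /=; apply: eq_bigr => -[p /= _] _.
rewrite !take_cat !drop_cat; case: ltnP => pl1.
  by rewrite beta_add multi_rmulD.
case: (p - size l1)%N => [|q] /=.
  rewrite !cats0.
  have := beta_add [::] e c c' (rcons l2 x) => /= ->.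
  by rewrite multi_rmulD.
have [_ +] := multi_rmul (beta (drop q (rcons l2 x))) fm.
by move=> /(_ b l1 e c c' (take q l2)).
Qed.

Lemma multi_fock w f : multi_additive f -> multi_additive (fock w f).
Proof. by move=> fm; elim: w => //= x w IH; apply: multi_push. Qed.

Lemma slot_additive_fock f s : multi_additive f -> slot_additive (fun w => fock w f s).
Proof.
move=> fm l1 e b b' l2; rewrite !fock_cat /= -fockD; apply: eq_fock => t.
have gm := multi_fock l2 fm; set g := fock l2 f in gm *.
have [_ gs] := gm; rewrite /push addrACA -big_split /=; congr (_ + _).
  by rewrite -!cats1 gs.
apply: eq_bigr => -[p /= pt] _; rewrite -multi_rmulD //.
rewrite -!cats1 !drop_cat; case: ltnP => pl; first by rewrite beta_add.
have -> : (p - size t.2 = 0)%N by lia.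
by have := beta_add [::] e b b' [::] => /= ->.
Qed.

Hypothesis beta_right : forall u e b v,
  beta (rcons u (e, b * v)) = beta (rcons u (e, b)) * v.

(** A coefficient multiplied after the last letter acts on the stack at the
    moment when this letter has been processed. *)
Lemma fock_rmul b l v f :
  fock (rmul (b, l) v).2 f ((rmul (b, l) v).1, [::]) =
  fock l (fun s => f (rmul s v)) (b, [::]).
Proof.
elim/last_ind: l => [|l [e c] _]; first by rewrite rmul_nil.
rewrite rmul_rcons /= !fock_rcons; apply: eq_fock => t.
rewrite /push rmul_rcons; congr (_ + _); apply: eq_bigr => -[p /= pt] _.
rewrite rmulM -!cats1 !drop_cat; case: ltnP => pl.
  by rewrite cats1 beta_right -cats1.
have -> : (p - size t.2 = 0)%N by lia.
by have := beta_right [::] e c v => /= ->.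
Qed.

End FockProcess.

Section AlternatingFock.
Variables (C : numClosedFieldType) (B : starAlgType C).
Variable beta : seq (bool * B) -> B.
Hypothesis beta_add : slot_additive beta.
Hypothesis beta_right : forall u e b v,
  beta (rcons u (e, b * v)) = beta (rcons u (e, b)) * v.
Hypothesis beta_alt : forall u,
  ~~ ((alternates true u || alternates false u) && ~~ odd (size u)) -> beta u = 0.
Local Notation state := (state B bool).
Local Notation fock := (fock beta).
Local Notation fock_moment := (fock_moment beta).
Implicit Types (s t : state) (w : seq (bool * B)) (f g : state -> B).

Lemma beta_odd u : odd (size u) -> beta u = 0.
Proof. by move=> ou; rewrite beta_alt // ou andbF. Qed.

Fixpoint fock_centered (ws : seq (seq (bool * B))) : state -> B :=
  if ws is w :: ws' then
    fun s => fock w (fock_centered ws') s - fock_centered ws' (rmul s (fock_moment w))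
  else @vacuum C B bool.

Lemma centered_moment_fock ws s :
  centered_moment fock_moment s ws = fock s.2 (fock_centered ws) (s.1, [::]).
Proof.
elim: ws s => [|w ws IH] [b l] /=.
  have := left_linear_fock beta l (@left_linear_vacuum C B bool) b 1 [::].
  by rewrite mulr1 => ->.
rewrite !IH /= fock_cat fock_rmul //.
rewrite (fockD _ l (fock w (fock_centered ws))).
by rewrite (@fock_morph _ _ _ beta l -%R) ?oppr0 //; apply: opprD.
Qed.

Lemma multi_opp f : multi_additive f -> multi_additive (fun s => - f s).
Proof.
case=> fb fs; split=> [b b' l|b l1 e c c' l2]; first by rewrite fb opprD.
by have := fs b l1 e c c' l2 => /= ->; rewrite opprD.
Qed.

Lemma multi_addf f g : multi_additive f -> multi_additive g ->
  multi_additive (fun s => f s + g s).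
Proof.
move=> [fb fs] [gb gs]; split=> [b b' l|b l1 e c c' l2].
  by rewrite fb gb addrACA.
have := fs b l1 e c c' l2 => /= ->.
by have := gs b l1 e c c' l2 => /= ->; rewrite addrACA.
Qed.

Lemma multi_centered ws : multi_additive (fock_centered ws).
Proof.
elim: ws => [|w ws IH] /=; first exact: multi_vacuum.
apply: multi_addf; first exact: multi_fock.
by apply: multi_opp; apply: multi_rmul.
Qed.

(** Started from an alternating stack, an alternating word only meets
    alternating stacks: only blocks of even size have a nonzero value, and their
    removal leaves the parity unchanged. *)
Lemma eq_fock_run e w t f g : multi_additive f -> multi_additive g ->
    alternates e t.2 -> alternates (e (+) odd (size t.2)) w ->
    (forall b l, alternates e l -> odd (size l) = odd (size t.2 + size w) ->
       f (b, l) = g (b, l)) ->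
  fock w f t = fock w g t.
Proof.
move=> fm gm; elim: w t => [|x w IH] [b l] /= al aw fg.
  by apply: fg; rewrite ?addn0.
have {aw}/andP[/eqP xe aw] := aw.
have {}fg b' l' : alternates e l' -> odd (size l') = ~~ odd (size l + size w) ->
    f (b', l') = g (b', l').
  by move=> al' ol'; apply: fg => //; rewrite ol' addnS.
rewrite /push /=; congr (_ + _).
  apply: IH => [||b' l' al' ol'] /=.
  - by rewrite alternates_rcons al xe eqxx.
  - by rewrite size_rcons /= addbN -addNb addNb -addbN; move: aw; rewrite addbN.
  - by apply: fg => //; rewrite ol' size_rcons addSn.
apply: eq_bigr => -[p /= pl] _; set u := drop p _.
have su : size u = ((size l).+1 - p)%N by rewrite size_drop size_rcons.
case ou : (odd (size u)).
  rewrite beta_odd // !multi_rmul0 //; exact: multi_fock.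
have pE : odd p = ~~ odd (size l).
  by move: ou; rewrite su oddB ?(ltnW pl) //=; case: odd; case: odd.
have sp : size (take p l) = p by rewrite size_takel.
have atp : alternates e (take p l).
  by move: al; rewrite -{1}(cat_take_drop p l) alternates_cat => /andP[].
apply: IH => [||b' l' al' ol'].
- by rewrite alternates_rmul.
- by rewrite size_rmul /= sp pE; move: aw; rewrite addbN.
- by apply: fg => //; rewrite ol' size_rmul /= sp oddD pE addNb oddD.
Qed.

Definition above s t : state := ((rmul s t.1).1, (rmul s t.1).2 ++ t.2).

Lemma above_rmul s t v : rmul (above s t) v = above s (rmul t v).
Proof.
case: t => c l; rewrite /above; elim/last_ind: l => [|l x _].
  by rewrite rmul_nil /= -rmulM !cats0; case: (rmul s c) => b l; case: rmul.
by rewrite rmul_rcons /= -!rcons_cat rmul_rcons.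
Qed.

Lemma multi_above s f : multi_additive f -> multi_additive (fun t => f (above s t)).
Proof.
move=> fm; split=> [b b' l|b l1 e c c' l2]; last first.
  by rewrite /above /= !catA; case: fm => _; apply.
rewrite /above /=; case: s => b0; elim/last_ind => [|l0 [e c] _].
  by rewrite !rmul_nil /= mulrDr; case: fm.
by rewrite !rmul_rcons /= mulrDr !cat_rcons; case: fm => _; apply.
Qed.

Definition top_letter e s :=
  s.2 = [::] \/ exists l b, s.2 = rcons l (e, b).

(** If the letters at the junction of [s] and [t] are equal, then a block that
    reaches below the junction is not alternating and has value 0: the process
    does not see [s]. *)
Lemma fock_above e s t w f : multi_additive f -> top_letter e s ->
    alternates e t.2 -> alternates (e (+) odd (size t.2)) w ->
  fock w f (above s t) = fock w (fun t => f (above s t)) t.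
Proof.
move=> fm ts; elim: w t => [//|x w IH] [c lt] /= alt' /andP[/eqP xe aw].
set s' := rmul s c.
have sE : above s (c, lt) = (s'.1, s'.2 ++ lt) by [].
have axr : alternates e (rcons lt x) by rewrite alternates_rcons alt' xe eqxx.
rewrite /push sE /=; congr (_ + _).
  have := IH (c, rcons lt x); rewrite /above /= -/s' rcons_cat => -> //.
  by rewrite size_rcons /=; move: aw; rewrite addbN.
rewrite size_cat -addnS -(big_mkord xpredT (fun p => fock w f
  (rmul (s'.1, take p (s'.2 ++ lt)) (beta (drop p (rcons (s'.2 ++ lt) x)))))).
rewrite (big_cat_nat (n := size s'.2)) ?leq_addr //=.
rewrite big_nat_cond big1 ?add0r; last first.
  move=> p /andP[/andP[_ ps] _].
  have -> : beta (drop p (rcons (s'.2 ++ lt) x)) = 0; last first.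
    by rewrite multi_rmul0 //; apply: multi_fock.
  apply: beta_alt; rewrite negb_and; apply/orP; left.
  rewrite rcons_cat drop_cat ps.
  have hd : exists b l, rcons lt x = (e, b) :: l.
    case: (rcons lt x) axr (size_rcons lt x) => [|[e' b] l] //= /andP[/eqP-> _] _.
    by exists b, l.
  have [b [l ->]] := hd.
  have dp0 : (0 < size (drop p s'.2))%N by rewrite size_drop subn_gt0.
  have lastE : (last (true, 0) (drop p s'.2)).1 = e.
    have : (0 < size s.2)%N by rewrite -(size_rmul s c) -/s'; lia.
    case: ts => [-> //|[l' [b' sE']] _].
    have s'E : s'.2 = rcons l' (e, b' * c).
      by rewrite /s'; case: (s) sE' => b0 l0 /= ->; rewrite rmul_rcons.
    have := congr1 (last (true, 0)) (cat_take_drop p s'.2).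
    rewrite last_cat [in RHS]s'E last_rcons.
    by case: (drop p s'.2) dp0 => // y d _ /= ->.
  have no e' : ~~ alternates e' (drop p s'.2 ++ (e, b) :: l).
    apply/negP; rewrite alternates_cat => /andP[a1 /= /andP[/eqP a2 _]].
    have := alternates_last (true, 0) a1 dp0; rewrite lastE {1}a2 addbN.
    by case: (_ (+) _).
  by rewrite negb_or !no.
rewrite -{1}[size s'.2]add0n big_addn addKn big_mkord; apply: eq_bigr => -[p /= plt] _.
rewrite take_cat ltnNge leq_addl /= addnK.
rewrite rcons_cat drop_cat ltnNge leq_addl /= addnK.
set v := beta _.
have -> : (s'.1, s'.2 ++ take p lt) = above s (c, take p lt) by [].
rewrite above_rmul.
case ou : (odd (size (drop p (rcons lt x)))).
  rewrite /v beta_odd //; rewrite -above_rmul !multi_rmul0 //; apply: multi_fock => //.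
  exact: multi_above.
apply: IH.
  rewrite alternates_rmul; move: alt'; rewrite -{1}(cat_take_drop p lt) alternates_cat.
  by case/andP.
rewrite size_rmul /= size_takel //.
have -> : odd p = ~~ odd (size lt).
  by move: ou; rewrite size_drop size_rcons oddB ?(ltnW plt) //=; case: odd; case: odd.
by rewrite addbN.
Qed.

(** The word [w] either leaves letters above [s], where [F] vanishes, or is
    entirely consumed; in the second case the coefficients produced add up to
    the moment of [w]. *)
Lemma fock_run_top e w F s : multi_additive F -> alternates e w -> top_letter e s ->
    (forall t, t.2 <> [::] -> top_letter (e (+) ~~ odd (size w)) t -> F t = 0) ->
  fock w F s = F (rmul s (fock_moment w)).
Proof.
move=> Fm aw ts HF.
have sE : above s (1, [::]) = s by rewrite /above /= rmul1 cats0; case: (s).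
rewrite -{1}sE (fock_above (e := e)) ?addbF //.
rewrite -(@fock_morph _ _ _ beta w (fun c => F (rmul s c))); last 2 first.
- exact: multi_rmul0.
- by move=> x y; apply: multi_rmulD.
apply: (eq_fock_run (e := e)) => //=; rewrite ?addbF //.
- exact: multi_above.
- have [vb vs] := multi_vacuum B bool; split=> [b b' l|b l1 c x x' l2].
    by rewrite vb multi_rmulD.
  by have := vs b l1 c x x' l2 => /= ->; rewrite multi_rmulD.
move=> b l; case/lastP: l => [|l x] al ol.
  by rewrite /above /vacuum /= cats0; case: rmul.
rewrite /vacuum /=; have -> : (if rcons l x is [::] then b else 0) = 0 by case: (l).
rewrite multi_rmul0 //; apply: HF; rewrite /above /=.
  by case: (_.2) => //; case: (l).
right; exists ((rmul s b).2 ++ l), x.2; rewrite -rcons_cat; congr rcons.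
move: al; rewrite alternates_rcons => /andP[_ /eqP xe].
rewrite -ol size_rcons /= negbK -xe; exact: surjective_pairing.
Qed.

Lemma fock_centered_top e w ws s : chain e (w :: ws) -> top_letter e s ->
  fock_centered (w :: ws) s = 0.
Proof.
elim: ws e w s => [|w' ws IH] e w s /= /and3P[w0 aw cws] ts;
  apply/eqP; rewrite subr_eq0; apply/eqP.
  rewrite (fock_run_top (e := e)) //; first exact: multi_vacuum.
  by move=> [b [|x l]].
apply: (fock_run_top (e := e)) => //; first exact: (multi_centered (w' :: ws)).
by move=> t _ tt; apply: IH tt.
Qed.

Lemma fock_Rdiag : Rdiag_moments fock_moment.
Proof.
split=> [e w aw ow|e [//|w ws] _ cws].
  have zm : multi_additive (fun _ : state => 0 : B) 
    by split=> [b b' l|b l1 c x x' l2] /=; rewrite addr0.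
  rewrite /fock_moment (@eq_fock_run e w _ _ _ (multi_vacuum B bool) zm) //= ?addbF //.
    by rewrite (@fock_morph _ _ _ beta w (fun=> 0) (fun=> 0)) // => x y /=; rewrite addr0.
  by move=> b [|x l] // _; rewrite ow.
rewrite centered_moment_fock; apply: fock_centered_top cws _.
by left.
Qed.

End AlternatingFock.

(** * Removal of interval blocks *)

Section BlockRemoval.
Variables (C : numClosedFieldType) (B : starAlgType C) (I : Type).
Variable alpha : seq I -> seq B -> B.

(** Attaching to a block the coefficient that follows it makes the blocks at
    the two ends of a word behave as the others. *)
Definition block_value (u : seq (I * B)) : B :=
  alpha (unzip1 u) (take (size u).-1 (unzip2 u)) * last 0 (unzip2 u).

Lemma block_value_rcons u x :
  block_value (rcons u x) = alpha (unzip1 (rcons u x)) (unzip2 u) * x.2.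
Proof.
rewrite /block_value size_rcons /= /unzip2 map_rcons last_rcons.
by rewrite -[rcons (map _ _) _]cats1 take_size_cat // size_map.
Qed.

Definition hat_value (T : eqType) (m : nat) (s : state B I) (c : seq T) : B :=
  if s.2 is [::] then s.1
  else s.1 * hat_rec alpha m (unzip1 s.2) c (take (size s.2).-1 (unzip2 s.2)) *
       last 0 (unzip2 s.2).

Lemma hat_value_rcons (T : eqType) m b0 w x (c : seq T) :
  hat_value m (b0, rcons w x) c =
  b0 * hat_rec alpha m (unzip1 (rcons w x)) c (unzip2 w) * x.2.
Proof.
rewrite /hat_value /=; case E : (rcons w x) => [|y w']; first by case: (w) E.
rewrite -E size_rcons /= /unzip2 map_rcons last_rcons.
by rewrite -[rcons (map _ _) _]cats1 take_size_cat // size_map.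
Qed.

Definition insert_block (T : Type) (p q : nat) (t : T) (c : seq T) : seq T :=
  take p c ++ nseq q t ++ drop p c.

Section Insertion.
Variables (T : eqType) (p q : nat) (t : T) (c : seq T).
Hypotheses (tc : t \notin c) (q0 : (0 < q)%N) (pc : (p <= size c)%N).
Hypothesis open_labels : forall x, x \in take p c -> x \in drop p c.
Let c' := insert_block p q t c.

Lemma size_insert_block : size c' = (size c + q)%N.
Proof.
by rewrite /c' /insert_block !size_cat size_nseq size_drop size_takel // addnCA subnKC // addnC.
Qed.

Let drop_insert : drop p c' = nseq q t ++ drop p c.
Proof. by rewrite /c' /insert_block drop_size_cat // size_takel. Qed.

Let count_t : count_mem t c' = q.
Proof.
have [t1 t2] : t \notin take p c /\ t \notin drop p c.
  by apply/andP; rewrite -negb_or -mem_cat cat_take_drop.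
rewrite /c' /insert_block !count_cat count_nseq /= eqxx mul1n.
by rewrite (count_memPn t1) (count_memPn t2) addn0.
Qed.

Lemma insert_block_size : block_size c' p = q.
Proof.
rewrite /block_size drop_insert; by case: (q) q0 count_t.
Qed.

Lemma insert_block_starts : starts_block c' p.
Proof.
rewrite /starts_block insert_block_size drop_insert; case: (q) q0 => // n _ /=.
by rewrite take_size_cat ?size_nseq // eqxx.
Qed.

(** The labels before the inserted block occur again after it, and so none of
    them can form an interval block. *)
Lemma insert_block_first : first_block c' = p.
Proof.
have ps : (p < size c')%N by rewrite size_insert_block; lia.
have before p0 : (p0 < p)%N -> ~~ starts_block c' p0.
  move=> p0p; apply/negP; rewrite /starts_block /block_size.
  have dE : drop p0 c' = drop p0 (take p c) ++ nseq q t ++ drop p c.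
    by rewrite /c' /insert_block drop_cat size_takel // p0p.
  rewrite dE; case uE : (drop p0 (take p c)) => [|t0 u] /=.
    by move: (congr1 size uE); rewrite size_drop size_takel //=; lia.
  set d := t0 :: _; set n := count_mem t0 c' => /eqP run.
  have t0p : t0 \in take p c by apply: (@mem_drop p0); rewrite uE mem_head.
  have t0t : t0 != t.
    by apply: contraNneq tc => <-; rewrite -(cat_take_drop p c) mem_cat t0p.
  have dc : d = drop p0 c' by rewrite dE uE.
  have nu : (n <= (size u).+1)%N.
    rewrite leqNgt; apply/negP => un; case/eqP: t0t.
    have := congr1 (fun s => nth t0 s (size u).+1) run.
    rewrite nth_nseq un nth_take // /d /= nth_cat ltnn subnn.
    by case: (q) q0 => //= ? _ ->.
  have t0d : t0 \in drop n d.
    rewrite /d -cat_cons drop_cat /=; case: ltnP => [_|n1].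
      by rewrite !mem_cat (open_labels t0p) !orbT.
    have -> : n = (size u).+1 by lia.
    by rewrite subnn drop0 mem_cat (open_labels t0p) orbT.
  have : (count_mem t0 d <= n)%N.
    rewrite dc /n -{2}(cat_take_drop p0 c') count_cat; lia.
  rewrite -{1}(cat_take_drop n d) count_cat run count_nseq /= eqxx mul1n.
  by move: t0d; rewrite -has_pred1 has_count; lia.
rewrite /first_block; have fp : has (starts_block c') (iota 0 (size c')).
  by apply/hasP; exists p; [rewrite mem_iota|apply: insert_block_starts].
have := nth_find 0%N fp; have := fp; rewrite has_find size_iota.
set f := find _ _ => fs; rewrite nth_iota // add0n => stf.
apply/eqP; rewrite eqn_leq; apply/andP; split; rewrite leqNgt; apply/negP => H.
  by have := before_find 0%N H; rewrite nth_iota ?add0n ?insert_block_starts //; lia.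
by have := before _ H; rewrite stf.
Qed.

Lemma insert_block_cut : cut p q c' = c.
Proof.
rewrite /cut /c' /insert_block take_size_cat ?size_takel // catA.
by rewrite drop_size_cat ?cat_take_drop // size_cat size_nseq size_takel.
Qed.

Lemma insert_block_constant : (0 < size c)%N -> ~~ constant c'.
Proof.
move=> c0; apply/negP => /(constantP t)[x E].
have mem y : y \in c' -> y = x by rewrite E mem_nseq => /andP[_ /eqP].
have tx : t = x.
  by apply: mem; rewrite !mem_cat mem_nseq q0 eqxx orbT.
have yc := mem_nth t c0; move: (nth t c 0) yc => y yc.
have yc' : y \in c'.
  move: yc; rewrite /c' /insert_block -{1}(cat_take_drop p c) !mem_cat.
  by case/orP=> ->; rewrite ?orbT.
by move: tc; rewrite tx -(mem y yc') yc.
Qed.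

(** Writing the coefficient after the last letter, the three cases of the
    recursion become one: the value of the block multiplies the coefficient on
    its left. *)
Lemma hat_value_insert m b0 w1 u w2 : size w1 = p -> size u = q ->
    size (w1 ++ w2) = size c ->
  hat_value m.+1 (b0, w1 ++ u ++ w2) c' =
  let s := rmul (b0, w1) (block_value u) in hat_value m (s.1, s.2 ++ w2) c.
Proof.
move=> sw1 su sw12.
have sc' := size_insert_block.
have unz (a1 a2 : seq (I * B)) : (unzip1 (a1 ++ a2) = unzip1 a1 ++ unzip1 a2) *
  (unzip2 (a1 ++ a2) = unzip2 a1 ++ unzip2 a2) by rewrite /unzip1 /unzip2 !map_cat.
case/lastP: u su => [|u y]; first by move=> q00; move: q0; rewrite -q00.
move=> su; rewrite /= block_value_rcons; set v := alpha _ _.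
have [c0|c0] := posnP (size c).
  have [-> ->] : w1 = [::] /\ w2 = [::].
    by move: sw12; rewrite c0 size_cat; case: (w1) => //; case: (w2).
  rewrite cats0 hat_value_rcons rmul_nil /= /hat_value /= mulrA.
  have -> // : constant c' = true.
  rewrite /c' (size0nil c0) /insert_block take_oversize // drop_oversize // cats0.
  by apply/(constantP t); exists t; rewrite size_nseq.
have cst := insert_block_constant c0.
have dropu (S : Type) (s1 su' s2 : seq S) : size s1 = p -> size su' = q ->
    cut p q (s1 ++ su' ++ s2) = s1 ++ s2 /\
    take q (drop p (s1 ++ su' ++ s2)) = su'.
  move=> s1p suq; rewrite (drop_size_cat _ s1p) (take_size_cat _ suq); split=> //.
  rewrite /cut (take_size_cat _ s1p) catA drop_size_cat // size_cat s1p suq //.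
have [cutj takej] := dropu I (unzip1 w1) (unzip1 (rcons u y)) (unzip1 w2)
  (etrans (size_map _ _) sw1) (etrans (size_map _ _) su).
have su' : size u = q.-1 by rewrite -su size_rcons.
have H b : hat_rec alpha m.+1 (unzip1 (w1 ++ rcons u y ++ w2)) c' b =
  let vv := alpha (unzip1 (rcons u y)) (take q.-1 (drop p b)) in
  if p == 0%N then vv * b`_q.-1 * hat_rec alpha m (unzip1 (w1 ++ w2)) c (drop q b)
  else if (p + q)%N == size (w1 ++ rcons u y ++ w2) then
    hat_rec alpha m (unzip1 (w1 ++ w2)) c (take p.-1 b) * b`_p.-1 * vv
  else
    hat_rec alpha m (unzip1 (w1 ++ w2)) c
      (take p.-1 b ++ (b`_p.-1 * vv * b`_(p + q).-1) :: drop (p + q) b).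
  rewrite [LHS]/= (negbTE cst) insert_block_first insert_block_size insert_block_cut.
  by rewrite !unz cutj takej -!unz size_map.
case/lastP: w1 sw1 sw12 {cutj takej} H => [|w1 x] sw1 sw12 H.
  case/lastP: w2 sw12 H => [|w2 z] sw12 H; first by rewrite -sw12 in c0.
  have p00 : p = 0%N by rewrite -sw1.
  rewrite rmul_nil /= -rcons_cat !hat_value_rcons [rcons (_ ++ _) z]rcons_cat.
  have := H (unzip2 (rcons u y ++ w2)); rewrite /= => ->; rewrite p00 /= drop0.
  rewrite !unz /unzip2 map_rcons cat_rcons take_size_cat ?size_map //.
  rewrite nth_cat size_map su' ltnn subnn /=.
  have -> : drop q ([seq i.2 | i <- u] ++ y.2 :: [seq i.2 | i <- w2]) = [seq i.2 | i <- w2].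
    by rewrite -cat_rcons drop_size_cat // size_rcons size_map su'; lia.
  by rewrite -/v !mulrA.
have sw1' : size w1 = p.-1 by rewrite -sw1 size_rcons.
have p0 : (p == 0%N) = false by rewrite -sw1 size_rcons.
rewrite rmul_rcons /=.
case/lastP: w2 sw12 H => [|w2 z] sw12 H.
  rewrite !cats0 in H *; rewrite -rcons_cat !hat_value_rcons rcons_cat H p0.
  have -> : (p + q)%N == size (rcons w1 x ++ rcons u y) by rewrite size_cat sw1 su.
  have takeE : take p.-1 (unzip2 (rcons w1 x ++ u)) = unzip2 w1.
    by rewrite /unzip2 map_cat map_rcons cat_rcons take_size_cat // size_map.
  have nthE : (unzip2 (rcons w1 x ++ u))`_p.-1 = x.2.
    by rewrite /unzip2 map_cat map_rcons cat_rcons nth_cat size_map sw1' ltnn subnn.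
  have dropE : take q.-1 (drop p (unzip2 (rcons w1 x ++ u))) = unzip2 u.
    rewrite /unzip2 map_cat drop_size_cat ?size_map // take_oversize // size_map; lia.
  rewrite takeE nthE dropE -/v !mulrA.
  by rewrite /unzip1 !map_rcons.
have neq : ((p + q)%N == size (rcons w1 x ++ rcons u y ++ rcons w2 z)) = false.
  by apply/eqP; rewrite !size_cat sw1 su size_rcons; lia.
rewrite -!rcons_cat !hat_value_rcons !rcons_cat H p0 neq.
set bs := unzip2 (rcons w1 x ++ rcons u y ++ w2).
have bsE : bs = unzip2 w1 ++ x.2 :: unzip2 u ++ y.2 :: unzip2 w2.
  by rewrite /bs /unzip2 !map_cat !map_rcons !cat_rcons.
have takeE : take p.-1 bs = unzip2 w1 by rewrite bsE take_size_cat // size_map.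
have nthE : bs`_p.-1 = x.2 by rewrite bsE nth_cat size_map sw1' ltnn subnn.
have dropp : drop p bs = unzip2 u ++ y.2 :: unzip2 w2.
  rewrite bsE -cat_rcons drop_size_cat // size_rcons size_map sw1'.
  by move: p0; case: (p).
have dropE : take q.-1 (drop p bs) = unzip2 u.
  by rewrite dropp take_size_cat // size_map.
have nthE2 : bs`_(p + q).-1 = y.2.
  have -> : (p + q).-1 = (p + q.-1)%N by lia.
  by rewrite -nth_drop dropp nth_cat size_map su' ltnn subnn.
have dropE2 : drop (p + q) bs = unzip2 w2.
  rewrite addnC -drop_drop dropp -cat_rcons drop_size_cat // size_rcons size_map su'; lia.
rewrite takeE nthE dropE nthE2 dropE2 -/v.
rewrite /unzip1 /unzip2 !map_cat !map_rcons /= !cat_rcons.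
by rewrite !mulrA.
Qed.

End Insertion.

(** The words of size [h + r] that code noncrossing partitions of which no block
    lies within the first [h] positions.  Either the block of the position [h]
    continues to its right, or it ends there; in the second case it is an
    interval, since a block nested in it would lie within the first [h]
    positions.  Its label is the number of letters to the right of it. *)
Fixpoint nc_words (h r : nat) : seq (seq nat) :=
  if r is r'.+1 then
    nc_words h.+1 r' ++
    flatten [seq [seq insert_block p (h.+1 - p) r' c | c <- nc_words p r'] |
              p <- iota 0 h.+1]
  else if h is 0%N then [:: [::]] else [::].

Lemma nc_wordsS h r : nc_words h r.+1 = nc_words h.+1 r ++
  flatten [seq [seq insert_block p (h.+1 - p) r c | c <- nc_words p r] |
            p <- iota 0 h.+1].
Proof. by []. Qed.

Lemma nc_wordsP h r c : c \in nc_words h r ->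
  [/\ size c = (h + r)%N, forall x, x \in c -> (x < r)%N &
   forall x, x \in take h c -> x \in drop h c].
Proof.
elim: r h c => [|r IH] h c.
  by case: h => //; rewrite inE => /eqP->.
rewrite nc_wordsS mem_cat => /orP[/IH[sc lc oc]|cI].
  split; first by rewrite sc; lia.
    by move=> x /lc; lia.
  move=> x xh; have : x \in take h.+1 c.
    by rewrite -(cat_take_drop h (take h.+1 c)) mem_cat take_takel // xh.
  by move/oc; rewrite -add1n -drop_drop; apply: mem_drop.
have [p + /mapP[c' /IH[sc lc oc] ->]] := flatten_mapP cI.
rewrite mem_iota add0n => /andP[_ ph].
have pc : (p <= size c')%N by rewrite sc leq_addr.
split.
- by rewrite size_insert_block // sc; lia.
- move=> x; rewrite !mem_cat mem_nseq => /or3P[xt|/andP[_ /eqP->] //|xd].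
    by apply/ltnW/lc/(mem_take xt).
  by apply/ltnW/lc/(mem_drop xd).
have sh : (h = p + (h - p))%N by lia.
have qE : (h.+1 - p = (h - p).+1)%N by lia.
rewrite /insert_block qE catA.
have -> : take p c' ++ nseq (h - p).+1 r = (take p c' ++ nseq (h - p) r) ++ [:: r].
  by rewrite -catA; congr (_ ++ _); rewrite -[(h - p).+1]addn1 nseqD.
have sz : size (take p c' ++ nseq (h - p) r) = h.
  by rewrite size_cat size_nseq size_takel //; lia.
rewrite -[((_ ++ _) ++ [:: r]) ++ _]catA (take_size_cat _ sz) (drop_size_cat _ sz) => x /=.
rewrite mem_cat mem_nseq inE => /orP[/oc ->|/andP[_ ->] //].
by rewrite orbT.
Qed.

(** The first [h] positions are the stack, and the first block that the process
    completes is the leftmost interval block of the partition. *)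
Lemma fock_nc_words w b0 l m : (size w <= m)%N ->
  fock block_value w (@vacuum C B I) (b0, l) =
  \sum_(c <- nc_words (size l) (size w)) hat_value m (b0, l ++ w) c.
Proof.
elim: w b0 l m => [|x w IH] b0 l m.
  by case: l => [|y l] _; rewrite /= ?big_seq1 ?big_nil.
case: m => // m wm; rewrite [size (x :: w)]/= nc_wordsS big_cat [LHS]/= /push.
congr (_ + _).
  by rewrite (IH _ _ m.+1) ?size_rcons ?cat_rcons //; apply: leqW.
rewrite big_flatten big_map -[in RHS](subn0 (size l).+1) -/(index_iota 0 _) big_mkord.
apply: eq_bigr => -[p /= pl] _; rewrite big_map.
have := IH (rmul (b0, take p l) (block_value (drop p (rcons l x)))).1
  (rmul (b0, take p l) (block_value (drop p (rcons l x)))).2 m wm.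
rewrite -surjective_pairing => ->; rewrite size_rmul /= size_takel //.
rewrite big_seq [RHS]big_seq; apply: eq_bigr => c cw.
have [sc lc oc] := nc_wordsP cw.
have -> : l ++ x :: w = take p l ++ drop p (rcons l x) ++ w.
  rewrite catA -cat_rcons; congr (_ ++ w).
  by rewrite -{1}(cat_take_drop p (rcons l x)) -cats1 takel_cat.
rewrite hat_value_insert //.
- by apply/negP => /lc; rewrite ltnn.
- lia.
- by rewrite sc leq_addr.
- by rewrite size_takel.
- by rewrite size_drop size_rcons.
- by rewrite size_cat size_takel // sc.
Qed.

End BlockRemoval.

(** * Words coding noncrossing partitions *)

Section CanonicalWords.

(** The label of a block counts the letters to the right of its last element:
    labels stay the same when letters are removed or inserted further to the
    left. *)
Record canonical (h r : nat) (c : seq nat) : Prop := Canonical {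
  can_size : size c = (h + r)%N;
  can_lt : forall i, (i < h + r)%N -> (nth 0%N c i < r)%N;
  can_last : forall i, (i < h + r)%N -> (i + nth 0%N c i < h + r)%N;
  can_mark : forall i, (i < h + r)%N ->
    nth 0%N c (h + r - (nth 0%N c i).+1) = nth 0%N c i;
  can_nc : forall i j k l, (i < j < k)%N -> (k < l < h + r)%N ->
    nth 0%N c i = nth 0%N c k -> nth 0%N c j = nth 0%N c l ->
    nth 0%N c i = nth 0%N c j }.

Lemma nth_insert_block p q (t : nat) (c : seq nat) i : (p <= size c)%N ->
  nth 0%N (insert_block p q t c) i =
  if (i < p)%N then nth 0%N c i else
  if (i < p + q)%N then t else nth 0%N c (i - q).
Proof.
move=> pc; rewrite /insert_block nth_cat size_takel //; case: ltnP => ip.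
  by rewrite nth_take.
rewrite nth_cat size_nseq nth_nseq ltn_subLR // nth_drop; case: ltnP => // iq.
by congr nth; lia.
Qed.

Lemma canonical_insert p r h c : canonical p r c -> (p <= h)%N ->
  canonical h r.+1 (insert_block p (h.+1 - p) r c).
Proof.
move=> [sc lt la mk nc] ph; have pc : (p <= size c)%N by rewrite sc leq_addr.
set q := (h.+1 - p)%N; have N i := nth_insert_block q r i pc.
have hq : (h + r.+1 = p + r + q)%N by rewrite /q; lia.
split.
- by rewrite size_insert_block // sc; lia.
- move=> i ih; rewrite N; case: (ltnP i p) => ip /=; first by have := lt i ltac:(lia); lia.
  case: (ltnP i (p + q)) => iq /=; first by lia.
  by have := lt (i - q)%N ltac:(lia); lia.
- move=> i ih; rewrite N; case: (ltnP i p) => ip.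
    by have := la i ltac:(lia); have := lt i ltac:(lia); lia.
  case: (ltnP i (p + q)) => iq /=; first by lia.
  by have := la (i - q)%N ltac:(lia); have := lt (i - q)%N ltac:(lia); lia.
- move=> i ih; rewrite [in X in nth _ _ X]N [RHS]N.
  have key i' : (i' < p + r)%N ->
      nth 0%N (insert_block p q r c) (h + r.+1 - (nth 0%N c i').+1) = nth 0%N c i'.
    move=> i'p; have l1 := lt i' i'p; have l2 := la i' i'p; rewrite N.
    case: ltnP => H1 /=; first by lia.
    case: ltnP => H2 /=; first by lia.
    by rewrite -[RHS](mk _ i'p); congr nth; lia.
  case: (ltnP i p) => ip /=; first by apply: key; lia.
  case: (ltnP i (p + q)) => iq /=; last by apply: key; lia.
  rewrite N; case: ltnP => H1 /=; first by lia.
  by case: ltnP => // H2; lia.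
move=> i j k l ijk kl; rewrite !N.
have L x : (x < p + r)%N -> nth 0%N c x = r -> False by move=> /lt + E; rewrite E ltnn.
case: (ltnP i p) => ip; case: (ltnP j p) => jp; case: (ltnP k p) => kp;
  case: (ltnP l p) => lp; try (exfalso; lia);
  case: (ltnP i (p + q)) => iq; case: (ltnP j (p + q)) => jq;
  case: (ltnP k (p + q)) => kq; case: (ltnP l (p + q)) => lq;
  try (exfalso; lia); rewrite /= => E1 E2 //;
  first [ by exfalso; apply: (L _ _ E1); lia | by exfalso; apply: (L _ _ E2); lia
        | by exfalso; apply: (L _ _ (esym E1)); lia
        | by exfalso; apply: (L _ _ (esym E2)); lia
        | by apply: (nc _ _ _ _ _ _ E1 E2); lia ].
Qed.

Lemma nc_words_canonical h r c : c \in nc_words h r -> canonical h r c.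
Proof.
elim: r h c => [|r IH] h c.
  by case: h => //; rewrite inE => /eqP->; split=> // i j k l _ /andP[].
rewrite nc_wordsS mem_cat => /orP[/IH[sc lt la mk nc]|cI].
  have hE : (h + r.+1 = h.+1 + r)%N by lia.
  by split; rewrite hE // => i /lt; apply: ltnW.
have [p + /mapP[c' /IH cc ->]] := flatten_mapP cI.
by rewrite mem_iota add0n => /andP[_ ph]; apply: canonical_insert.
Qed.

(** If the label [r] occurs, its last occurrence is at the position [h]; a
    different label between two of its occurrences would be completed to the
    right of [h], and the two blocks would cross. *)
Lemma canonical_nc_words h r c : canonical h r c -> c \in nc_words h r.
Proof.
elim: r h c => [|r IH] h c cc; have [sc lt la mk nc] := cc.
  case: h sc lt {cc la mk nc} => [|h] sc lt; first by rewrite (size0nil sc).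
  by have := lt 0%N isT.
have hE : (h + r.+1 = h.+1 + r)%N by lia.
rewrite nc_wordsS mem_cat; apply/orP; have [rc|rc] := boolP (r \in c); last first.
  left; apply: IH; rewrite hE in sc lt la mk nc; split=> // i ih.
  have := lt i ih; rewrite ltnS leq_eqVlt => /predU1P[E|//].
  by case/negP: rc; rewrite -E mem_nth // sc.
right; pose p := index r c; pose q := (h.+1 - p)%N; pose c' := cut p q c.
have pn : (p < h + r.+1)%N by rewrite -sc index_mem.
have cp : nth 0%N c p = r by apply: nth_index.
have ph : (p <= h)%N by have := la p pn; rewrite cp; lia.
have ch : nth 0%N c h = r by rewrite -[RHS]cp -(mk p pn) cp; congr nth; lia.
have before i : (i < p)%N -> nth 0%N c i <> r.
  by move=> ip E; have := before_find 0%N ip; rewrite /= E eqxx.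
have after i : (h < i < h + r.+1)%N -> nth 0%N c i <> r.
  by move=> ih E; have := la i ltac:(lia); rewrite E; lia.
have mid i : (p <= i <= h)%N -> nth 0%N c i = r.
  move=> pih; have [//|ir] := eqVneq (nth 0%N c i) r.
  have il := lt i ltac:(lia).
  have ip : i <> p by move=> E; rewrite E cp eqxx in ir.
  have ih : i <> h by move=> E; rewrite E ch eqxx in ir.
  have := nc p i h (h + r.+1 - (nth 0%N c i).+1)%N ltac:(lia) ltac:(lia).
  by rewrite mk ?cp ?ch; [move=> <-|lia].
have sc' : size c' = (p + r)%N.
  by rewrite /c' /cut size_cat size_takel ?size_drop sc /q; lia.
have N i : nth 0%N c' i = if (i < p)%N then nth 0%N c i else nth 0%N c (i + q).
  rewrite /c' /cut nth_cat size_takel ?sc; last by lia.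
  by case: ltnP => ip /=; [rewrite nth_take|rewrite nth_drop; congr nth; lia].
have cE : c = insert_block p q r c'.
  apply: (@eq_from_nth _ 0%N) => [|i].
    by rewrite size_insert_block ?sc' ?leq_addr // sc /q; lia.
  rewrite sc => ih; rewrite nth_insert_block ?sc' ?leq_addr // !N.
  case: ltnP => // pi; case: ltnP => iq /=; first by apply: mid; rewrite /q in iq; lia.
  by case: ltnP => H /=; [lia|congr nth; lia].
apply/flatten_mapP; exists p; first by rewrite mem_iota; lia.
apply/mapP; exists c' => //; apply: IH.
(* the place in [c] of the position [i] of [c'] *)
pose up i := if (i < p)%N then i else (i + q)%N.
have N' i : nth 0%N c' i = nth 0%N c (up i) by rewrite N /up; case: ifP.
have upn i : (i < p + r)%N -> (up i < h + r.+1)%N.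
  by rewrite /up /q; case: (ltnP i p) => ? /=; lia.
have upr i : (i < p + r)%N -> nth 0%N c (up i) <> r.
  move=> ip; rewrite /up; case: ltnP => H /=; first exact: before.
  by apply: after; rewrite /q; lia.
have upl i : (i < p + r)%N -> (nth 0%N c (up i) < r)%N.
  by move=> ip; have := lt _ (upn i ip); have := upr i ip; lia.
split=> // [i ip|i ip|i ip|i j k l ijk kl].
- by rewrite N'; apply: upl.
- rewrite N'; have := la _ (upn i ip); have := upl i ip.
  by set x := nth _ _ _; rewrite /up /q; case: (ltnP i p) => ? /=; lia.
- rewrite !N' -[RHS](mk _ (upn i ip)); congr nth.
  have := upl i ip; set x := nth _ _ _ => xr.
  by rewrite /up /q; case: ltnP => ? /=; lia.
rewrite !N'; apply: nc; first by rewrite /up;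
    case: (ltnP i p) => ? /=; case: (ltnP j p) => ? /=; case: (ltnP k p) => ? /=; lia.
by have := upn l ltac:(lia); rewrite /up;
  case: (ltnP k p) => ? /=; case: (ltnP l p) => ? /=; lia.
Qed.

(** The number of letters [r] tells which block was inserted. *)
Lemma nc_words_uniq h r : uniq (nc_words h r).
Proof.
elim: r h => [|r IH] h; first by case: h.
have cnt h' c : c \in nc_words h' r -> count_mem r c = 0%N.
  move=> /nc_wordsP[_ lc _]; apply/count_memPn/negP => /lc; by rewrite ltnn.
have cntI p c : c \in nc_words p r ->
    count_mem r (insert_block p (h.+1 - p) r c) = (h.+1 - p)%N.
  move=> /cnt; rewrite -{1}(cat_take_drop p c) /insert_block !count_cat count_nseq /=.
  by rewrite eqxx; lia.
rewrite nc_wordsS cat_uniq IH; apply/and3P; split=> //.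
  apply/hasPn => c cI; apply/negP => /cnt.
  have [p + /mapP[c' /cntI + cE]] := flatten_mapP cI.
  by rewrite mem_iota cE => pI ->; lia.
apply: allpairs_uniq_dep => [|p _|[p1 c1] [p2 c2]]; first exact: iota_uniq.
  exact: IH.
move=> /allpairsPdep[p1' [c1' [p1I c1I [-> ->]]]]
  /allpairsPdep[p2' [c2' [p2I c2I [-> ->]]]] /= E.
have := congr1 (count_mem r) E; rewrite !cntI // => pp.
have pE : p1' = p2' by move: p1I p2I; rewrite !mem_iota; lia.
subst p2'; congr (Tagged _ _).
have [s1 _ _] := nc_wordsP c1I; have [s2 _ _] := nc_wordsP c2I.
rewrite -(@insert_block_cut _ p1' (h.+1 - p1') r c1') ?s1 ?leq_addr // E.
by rewrite insert_block_cut // s2 leq_addr.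
Qed.

End CanonicalWords.

(** * Moments and cumulants of an element *)

Section NoncrossingWords.
Variable n : nat.
Implicit Types (P : {set {set 'I_n}}) (V : {set 'I_n}).

Definition block_label V : nat := (n.-1 - \max_(i in V) i)%N.

Definition partition_word P : seq nat := map block_label (labels P).

Lemma block_labelP V i : i \in V -> exists2 m : 'I_n, m \in V &
  block_label V = (n.-1 - m)%N /\ forall j, j \in V -> (j <= m)%N.
Proof.
move=> iV; have V0 : (0 < #|V|)%N by apply/card_gt0P; exists i.
have [m mV mE] := eq_bigmax_cond (@nat_of_ord n) V0.
exists m => //; rewrite /block_label mE; split=> // j jV.
by rewrite -mE; apply: leq_bigmax_cond.
Qed.

Lemma size_partition_word P : size (partition_word P) = n.
Proof. by rewrite /partition_word /labels 2!size_map size_enum_ord. Qed.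

Lemma nth_partition_word P (i : 'I_n) :
  nth 0%N (partition_word P) i = block_label (finset.pblock P i).
Proof.
rewrite /partition_word /labels -map_comp (nth_map i) ?size_enum_ord //=.
by rewrite nth_ord_enum.
Qed.

Section Partition.
Variable P : {set {set 'I_n}}.
Hypothesis partP : finset.partition P [set: 'I_n]%SET.

Let trivP : finset.trivIset P. Proof. by case/and3P: partP. Qed.
Let inblock i : i \in finset.pblock P i.
Proof. by rewrite mem_pblock (cover_partition partP) inE. Qed.
Let pblockP i : finset.pblock P i \in P.
Proof. by rewrite pblock_mem // (cover_partition partP) inE. Qed.

Lemma block_label_inj i j :
  block_label (finset.pblock P i) = block_label (finset.pblock P j) ->
  finset.pblock P i = finset.pblock P j.
Proof.
have [m mi [-> _]] := block_labelP (inblock i).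
have [m' mj [-> _]] := block_labelP (inblock j) => E.
have mm' : m = m' by apply/val_inj => /=; have := ltn_ord m; have := ltn_ord m'; lia.
by rewrite -(same_pblock trivP mi) mm' (same_pblock trivP mj).
Qed.

Lemma canonical_partition_word : P \in NC n -> canonical 0 n (partition_word P).
Proof.
rewrite inE => /andP[_ /forall_inP ncP].
have N i (ilt : (i < n)%N) : nth 0%N (partition_word P) i =
    block_label (finset.pblock P (Ordinal ilt)).
  by rewrite -(nth_partition_word P (Ordinal ilt)).
split; rewrite ?add0n ?size_partition_word //.
- move=> i ilt; rewrite (N i ilt) /block_label; have := ltn_ord (Ordinal ilt); lia.
- move=> i ilt; rewrite (N i ilt).
  have [m _ [-> /(_ _ (inblock _))/=]] := block_labelP (inblock (Ordinal ilt)).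
  by have := ltn_ord m; lia.
- move=> i ilt; rewrite (N i ilt).
  have [m mi [E _]] := block_labelP (inblock (Ordinal ilt)); rewrite E.
  have -> : (n - (n.-1 - m).+1 = m)%N by have := ltn_ord m; lia.
  by rewrite nth_partition_word (same_pblock trivP mi).
move=> i j k l ijk kl.
have il : (i < n)%N by lia. have jl : (j < n)%N by lia.
have kl' : (k < n)%N by lia. have ll : (l < n)%N by lia.
rewrite (N i il) (N j jl) (N k kl') (N l ll).
move=> /block_label_inj E1 /block_label_inj E2.
have [->//|neq] := eqVneq (finset.pblock P (Ordinal il)) (finset.pblock P (Ordinal jl)).
have /forall_inP/(_ _ (pblockP (Ordinal jl)))/implyP/(_ neq) := ncP _ (pblockP (Ordinal il)).
case/negP; apply/exists_inP; exists (Ordinal il) => //.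
apply/exists_inP; exists (Ordinal jl) => //.
apply/exists_inP; exists (Ordinal kl'); first by rewrite E1.
apply/exists_inP; exists (Ordinal ll); first by rewrite E2.
by rewrite /=; lia.
Qed.

Lemma partition_from_pblock : P =
  equivalence_partition (fun i j => j \in finset.pblock P i) [set: 'I_n]%SET.
Proof. by rewrite equivalence_partition_pblock. Qed.

Lemma mem_pblock_word i j : (j \in finset.pblock P i) =
  (nth 0%N (partition_word P) i == nth 0%N (partition_word P) j).
Proof.
rewrite !nth_partition_word; apply/idP/eqP => [/(same_pblock trivP)->//|E].
by rewrite (block_label_inj E).
Qed.

End Partition.

Lemma NC_partition P : P \in NC n -> finset.partition P [set: 'I_n]%SET.
Proof. by rewrite inE => /andP[]. Qed.

Lemma partition_word_inj : {in NC n &, injective partition_word}.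
Proof.
move=> P Q PN QN E.
rewrite (partition_from_pblock (NC_partition PN)) (partition_from_pblock (NC_partition QN)).
rewrite /equivalence_partition; apply: eq_imset => i /=.
apply/setP => j; rewrite !inE /=.
by rewrite (mem_pblock_word (NC_partition PN)) (mem_pblock_word (NC_partition QN)) E.
Qed.

(** The blocks are the sets of positions with equal letters. *)
Lemma canonical_partition c : canonical 0 n c ->
  exists2 P, P \in NC n & partition_word P = c.
Proof.
move=> [sc lt la mk nc]; rewrite !add0n in sc lt la mk nc.
pose f (i : 'I_n) := nth 0%N c i; pose P := preim_partition f [set: 'I_n]%SET.
have partP : finset.partition P [set: 'I_n]%SET by apply: preim_partitionP.
have pb i : finset.pblock P i = [set j : 'I_n | f i == f j]%SET.
  apply/setP => j; rewrite /P pblock_equivalence_partition ?inE //.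
  by move=> x y z _ _ _ /=; split=> // /eqP ->.
have f_lab i : block_label (finset.pblock P i) = f i.
  have ii : i \in finset.pblock P i by rewrite pb inE.
  have [m + [-> mmax]] := block_labelP ii; rewrite pb inE => /eqP fim.
  have ln : (n - (f i).+1 < n)%N by have := ltn_ord i; lia.
  have := mmax (Ordinal ln); rewrite pb inE /f /= mk ?ltn_ord // eqxx => /(_ isT).
  have := la m (ltn_ord m); rewrite -/(f m) -fim.
  by have := ltn_ord m; have := lt i (ltn_ord i); rewrite -/(f i); lia.
have wE : partition_word P = c.
  apply: (@eq_from_nth _ 0%N); rewrite size_partition_word ?sc // => i ilt.
  by rewrite (nth_partition_word _ (Ordinal ilt)) f_lab.
exists P => //; rewrite inE partP /=.
apply/forall_inP => V VP; apply/forall_inP => W WP; apply/implyP => VW.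
apply/negP => /exists_inP[i iV /exists_inP[k kW /exists_inP[j jV /exists_inP[l lW]]]].
case/andP=> ikj jl.
have trivP : finset.trivIset P by case/and3P: partP.
have Vi := def_pblock trivP VP iV; have Wk := def_pblock trivP WP kW.
have fij : f i = f j by apply/eqP; move: jV; rewrite -Vi pb inE.
have fkl : f k = f l by apply/eqP; move: lW; rewrite -Wk pb inE.
have fik : f i = f k by apply: (nc i k j l) => //; rewrite jl ltn_ord.
case/eqP: VW; rewrite -Vi -Wk; apply: (same_pblock trivP).
by rewrite pb inE -fik.
Qed.

Lemma sum_NC (V : nmodType) (F : seq nat -> V) :
  \sum_(P in NC n) F (partition_word P) = \sum_(c <- nc_words 0 n) F c.
Proof.
rewrite -big_enum -(big_map partition_word xpredT F); apply: perm_big.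
apply: uniq_perm; last 1 first.
- move=> c; apply/mapP/idP => [[P]|/nc_words_canonical/canonical_partition[P PN <-]].
    rewrite mem_enum => PN ->; apply: canonical_nc_words.
    exact: canonical_partition_word (NC_partition PN) PN.
  by exists P; rewrite ?mem_enum.
- rewrite map_inj_in_uniq ?enum_uniq // => P Q; rewrite !mem_enum.
  exact: partition_word_inj.
exact: nc_words_uniq.
Qed.

End NoncrossingWords.

Section Relabelling.
Variables (C : numClosedFieldType) (B : starAlgType C) (I : Type).
Variable alpha : seq I -> seq B -> B.
Variables (S T : eqType) (f : S -> T).

Lemma eq_map_in (c s1 s2 : seq S) : {in c &, injective f} ->
  {subset s1 <= c} -> {subset s2 <= c} -> (map f s1 == map f s2) = (s1 == s2).
Proof.
move=> inj s1c s2c; apply/eqP/eqP => [|-> //].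
elim: s1 s2 s1c s2c => [|x s1 IH] [|y s2] //= s1c s2c [xy E]; congr (_ :: _).
  by apply: inj xy; [apply: s1c|apply: s2c]; apply: mem_head.
by apply: IH => // z zs; [apply: s1c|apply: s2c]; rewrite inE zs orbT.
Qed.

(** The recursion only compares labels for equality. *)
Lemma hat_rec_map m j (c : seq S) b : {in c &, injective f} ->
  hat_rec alpha m j (map f c) b = hat_rec alpha m j c b.
Proof.
elim: m j c b => [|m IH] j c b inj.
  rewrite /=; congr (if _ then _ else _).
  case: c inj => //= x s inj; rewrite all_map; apply: eq_in_all => y ys /=.
  by apply: (inj_in_eq inj); rewrite inE ?ys ?eqxx ?orbT.
have cst : constant (map f c) = constant c.
  case: (c) inj => //= x s inj'; rewrite all_map; apply: eq_in_all => y ys /=.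
  by apply: (inj_in_eq inj'); rewrite inE ?ys ?eqxx ?orbT.
have bs p : block_size (map f c) p = block_size c p.
  rewrite /block_size -map_drop; case dE : (drop p c) => [//|t d] /=.
  rewrite count_map; apply: eq_in_count => y yc /=; apply: (inj_in_eq inj) => //.
  by apply: (@mem_drop p); rewrite dE mem_head.
have sb p : starts_block (map f c) p = starts_block c p.
  rewrite /starts_block -map_drop bs; case dE : (drop p c) => [//|t d].
  set k := block_size c p; rewrite /= -(map_nseq _ f t) -[f t :: map f d]/(map f (t :: d)).
  rewrite -map_take.
  apply: (eq_map_in inj) => y.
    by move=> /mem_take yd; apply: (@mem_drop p); rewrite dE.
  rewrite mem_nseq => /andP[_ /eqP->].
  by apply: (@mem_drop p); rewrite dE mem_head.
have fb : first_block (map f c) = first_block c.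
  by rewrite /first_block size_map; apply: eq_find.
have cutE p q : cut p q (map f c) = map f (cut p q c).
  by rewrite /cut map_cat map_take map_drop.
rewrite [LHS]/= [RHS]/= cst fb bs cutE.
have inj' : {in cut (first_block c) (block_size c (first_block c)) c &, injective f}.
  move=> x y; rewrite /cut !mem_cat => /orP[/mem_take xc|/mem_drop xc]
    /orP[/mem_take yc|/mem_drop yc];
  exact: inj.
by rewrite !IH.
Qed.

End Relabelling.

Section MomentCumulant.
Variables (C : numClosedFieldType) (B : starAlgType C) (I : Type).
Implicit Types (alpha : seq I -> seq B -> B) (j : seq I) (b : seq B).

Lemma hat_partition_word alpha n j (P : {set {set 'I_n}}) b : P \in NC n ->
  hat alpha j P b = hat_rec alpha n j (partition_word P) b.
Proof.
move=> PN; rewrite /hat /partition_word; apply/esym/hat_rec_map => V W.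
move=> /mapP[i _ ->] /mapP[k _ ->]; apply: block_label_inj.
exact: NC_partition.
Qed.

Lemma fock_moment_hat alpha j b (b0 : B) : size j = (size b).+1 ->
  fock_moment (block_value alpha) (zip j (rcons b b0)) =
  (\sum_(P in NC (size j)) hat alpha j P b) * b0.
Proof.
move=> s; set w := zip _ _; have sw : size w = size j.
  by rewrite /w size_zip size_rcons s minnn.
rewrite /fock_moment (fock_nc_words _ _ _ (leqnn _)) /= sw.
rewrite (eq_bigr (fun P => hat_rec alpha (size j) j (partition_word P) b)); last first.
  by move=> P; apply: hat_partition_word.
rewrite (sum_NC _ (fun c => hat_rec alpha (size j) j c b)) mulr_suml.
apply: eq_bigr => c _; case/lastP: j s @w sw => [//|j x] s w sw.
have {w sw} -> : w = rcons (zip j b) (x, b0).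
  by rewrite /w zip_rcons //; move: s; rewrite size_rcons; case.
have sjb : size j = size b by move: s; rewrite size_rcons; case.
rewrite hat_value_rcons mul1r /unzip1 map_rcons -/(unzip1 _) unzip1_zip ?sjb //.
by rewrite unzip2_zip // sjb.
Qed.

Lemma word_zip (w : seq (I * B)) : (0 < size w)%N -> exists j b (b0 : B),
  size j = (size b).+1 /\ w = zip j (rcons b b0).
Proof.
case/lastP: w => // w [e b0] _; exists (rcons (unzip1 w) e), (unzip2 w), b0.
by rewrite zip_rcons ?zip_unzip !size_map ?size_rcons ?size_map.
Qed.

Lemma block_value_zip alpha j b (b0 : B) : size j = (size b).+1 ->
  block_value alpha (zip j (rcons b b0)) = alpha j b * b0.
Proof.
case/lastP: j => [//|j x]; rewrite size_rcons => -[s].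
rewrite zip_rcons // block_value_rcons /unzip1 map_rcons -/(unzip1 _).
by rewrite unzip1_zip ?unzip2_zip ?s.
Qed.

(** The only term that involves the values on words of full length is that of
    the one-block partition. *)
Lemma eq_fock_moment_top (al1 al2 : seq I -> seq B -> B) w : (0 < size w)%N ->
    (forall j b, (size j < size w)%N -> al1 j b = al2 j b) ->
  fock_moment (block_value al1) w - block_value al1 w =
  fock_moment (block_value al2) w - block_value al2 w.
Proof.
move=> w0 eal; have [j [b [b0 [s wE]]]] := word_zip w0.
have sw : size w = size j by rewrite wE size_zip size_rcons s minnn.
rewrite wE !fock_moment_hat // !block_value_zip // -!mulrBl; congr (_ * _).
have j0 : (0 < size j)%N by rewrite s.
have top al : \sum_(P in NC (size j)) hat al j P b - al j b =
    \sum_(P in NC (size j) | P != one_block (size j)) hat al j P b.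
  by rewrite (bigD1 (one_block (size j))) ?one_block_NC //= hat_one_block
    addrAC subrr add0r.
rewrite !top; apply: eq_bigr => P /andP[PN P1].
by apply: (@eq_hat _ _ _ _ _ j) => // j' b' j'j; apply: eal; rewrite sw.
Qed.

Lemma eq_fock_beta (be1 be2 : seq (I * B) -> B) w f :
    (forall u, (0 < size u)%N -> be1 u = be2 u) ->
  fock be1 w f =1 fock be2 w f.
Proof.
move=> E; elim: w => //= x w IH s; rewrite /push IH; congr (_ + _).
by apply: eq_bigr => p _; rewrite IH E // size_drop size_rcons subn_gt0.
Qed.

Lemma block_value_right alpha u e (b v : B) : block_value alpha (rcons u (e, b * v)) =
  block_value alpha (rcons u (e, b)) * v.
Proof. by rewrite !block_value_rcons /unzip1 !map_rcons /= mulrA. Qed.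

End MomentCumulant.

Section CumulantsOfElement.
Variables (C : numClosedFieldType) (B : starAlgType C) (A : ncps B) (a : A).
Local Notation kappa := (cumulant (spow a)).
Local Notation beta := (block_value kappa).

(** This is the moment-cumulant formula, the sum over noncrossing partitions
    being computed by the process. *)
Lemma wmoment_fock : fock_moment beta =1 wmoment a.
Proof.
move=> w; have [w0|w0] := posnP (size w).
  by rewrite (size0nil w0) /wmoment wval_nil cexp1.
have [j [b [b0 [s ->]]]] := word_zip w0.
by rewrite fock_moment_hat // wmoment_split // moment_cumulant // s.
Qed.

Lemma wmoment_slot : slot_additive (wmoment a).
Proof.
move=> l1 e b b' l2; rewrite /wmoment !wval_cat !wval_cons /= rmorphD.
by rewrite !(mulrDr, mulrDl) raddfD.
Qed.

(** Moments are additive in each coefficient.  A cumulant is the difference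
    between a moment and a value of the process that involves shorter cumulants
    only, to which the induction applies. *)
Lemma cumulant_slot : slot_additive beta.
Proof.
pose al n j b := if (size j < n)%N then kappa j b else 0.
have alE n u : block_value (al n) u = if (size u < n)%N then beta u else 0.
  by rewrite /block_value /al size_map; case: ifP => // _; rewrite mul0r.
have ala n : slot_additive (block_value (al n)).
  elim: n => [|n IH] l1 e b b' l2; rewrite !alE !size_cat /=.
    by rewrite addr0.
  have betaE u : size u = n -> (0 < size u)%N ->
      beta u = wmoment a u - fock_moment (block_value (al n)) u.
    move=> un u0; have := @eq_fock_moment_top _ _ _ kappa (al n) u u0.
    rewrite un wmoment_fock alE un ltnn subr0 => <-; first by rewrite subKr.
    by move=> j b1 jn; rewrite /al jn.
  case: ltnP => [|_]; last by rewrite addr0.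
  rewrite ltnS leq_eqVlt => /predU1P[sn|sn].
    rewrite !betaE ?size_cat //=; try lia.
    have fs := slot_additive_fock IH (1, [::]) (multi_vacuum B bool) l1 e b b' l2.
    by rewrite wmoment_slot /fock_moment fs opprD addrACA.
  by have := IH l1 e b b' l2; rewrite !alE !size_cat /= sn.
move=> l1 e b b' l2; have := ala (size l1 + (size l2).+1).+1 l1 e b b' l2.
by rewrite !alE !size_cat /= ltnSn.
Qed.

Lemma sorted_alternates (u : seq (bool * B)) :
  sorted (fun k l => k != l) (unzip1 u) = alternates true u || alternates false u.
Proof.
case: u => //= -[e b] u.
have pathE e' v : path (fun k l : bool => k != l) e' (unzip1 v) = alternates (~~ e') v :> bool.
  elim: v e' => //= -[f c] v IH e'; rewrite IH.
  by case: e' f => -[].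
by rewrite pathE; case: e; rewrite /= ?orbF.
Qed.

(** The cumulants that would be left if [a] were R-diagonal. *)
Definition kappa_alt j b : B :=
  if sorted (fun k l => k != l) j && ~~ odd (size j) then kappa j b else 0.

Local Notation beta' := (block_value kappa_alt).

Lemma kappa_altE u : beta' u =
  if (alternates true u || alternates false u) && ~~ odd (size u) then beta u else 0.
Proof.
rewrite /block_value /kappa_alt sorted_alternates size_map.
by case: ifP => // _; rewrite mul0r.
Qed.

Lemma kappa_alt_Rdiag : Rdiag_moments (fock_moment beta').
Proof.
apply: fock_Rdiag => [l1 e b b' l2||u bad].
- rewrite !kappa_altE !size_cat /= -!sorted_alternates /unzip1 !map_cat /=.
  by case: ifP => _; rewrite ?cumulant_slot ?addr0.
- exact: block_value_right.
by rewrite kappa_altE (negbTE bad).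
Qed.

Definition only_alternating_cumulants := forall (j : seq bool) (b : seq B), size j = (size b).+1 ->
  ~~ (sorted (fun k l => k != l) j && ~~ odd (size j)) -> kappa j b = 0.

Lemma only_alternating_Rdiag : only_alternating_cumulants -> Rdiag_moments (wmoment a).
Proof.
move=> Hg; apply: Rdiag_moments_ext kappa_alt_Rdiag => w.
rewrite -wmoment_fock; apply: eq_fock_beta => u u0.
have [j [b [b0 [s ->]]]] := word_zip u0; rewrite !block_value_zip //.
rewrite /kappa_alt; case: ifP => // /negbT bad.
by rewrite Hg.
Qed.

(** By induction on the length.  When the shorter cumulants agree with their
    truncations, a moment and its counterpart differ as the two cumulants of the
    same length do.  For a word that is not even alternating the two moments
    agree by [Rdiag_moments_step], hence so do the cumulants. *)
Lemma Rdiag_only_alternating : Rdiag_moments (wmoment a) -> only_alternating_cumulants.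
Proof.
move=> Ra.
have key n u : size u = n -> wmoment a u = fock_moment beta' u /\
    ((0 < n)%N -> beta u = beta' u).
  elim/ltn_ind: n u => n IH u un; have [n0|n0] := posnP n.
    by rewrite n0 in un *; rewrite (size0nil un) /wmoment wval_nil cexp1.
  (* equal to [kappa] below the length [n], whatever the number of coefficients;
     equal to [kappa_alt] on all words, by induction *)
  pose al j b := if (size j < n)%N then kappa j b else kappa_alt j b.
  have alE v : (0 < size v)%N -> block_value al v = beta' v.
    move=> v0; rewrite /block_value /al size_map; case: ifP => // vn.
    by have [_ H] := IH _ vn v erefl; move: (H v0).
  have top : wmoment a u - beta u = fock_moment beta' u - beta' u.
    rewrite -wmoment_fock (@eq_fock_moment_top _ _ _ kappa al u) ?un //.
      by rewrite alE ?un // /fock_moment (eq_fock_beta _ _ alE).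
    by move=> j b jn; rewrite /al jn.
  have [bad|good] := boolP (~~ (alternates true u || alternates false u) || odd n).
    have E : wmoment a u = fock_moment beta' u.
      apply: (Rdiag_moments_step (n := n)) => // [v vn|]; last exact: kappa_alt_Rdiag.
      by have [] := IH _ vn v erefl.
    by split=> // _; move: top; rewrite E => /addrI/oppr_inj.
  have E : beta u = beta' u.
    by rewrite kappa_altE un; move: good; rewrite negb_or negbK => ->.
  by split=> //; move: top; rewrite E => /addIr.
move=> j b s bad.
have [_ H] := key (size j) (zip j (rcons b 1))
  ltac:(by rewrite size_zip size_rcons s minnn).
have := H ltac:(by rewrite s); rewrite !block_value_zip // !mulr1 => ->.
by rewrite /kappa_alt (negbTE bad).
Qed.

End CumulantsOfElement.

Unset Implicit Arguments.
Set Strict Implicit.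
Set Printing Implicit Defensive.

Theorem theorem3p1 (R : realType) (B : starAlgType R[i]) (A : ncps B) (a : A) :
  [<->
    (* (a) *)
    Rdiagonal a;
    (* (b) *)
    forall (n : nat) (i : nat -> bool) (x : nat -> A), (0 < n)%N ->
      (forall k, (1 <= k <= n)%N -> Pset a (i k.-1) (i k) (x k)) ->
      cexp A (\prod_(1 <= k < n.+1) x k) = 0;
    (* (c) *)
    exists (A' : ncps B) (p u : A'), unitary u /\
      [/\ normalizes u,
          cexp A' p = 0 /\
            (forall (k : nat) (b : nat -> B), (0 < k)%N ->
               cexp A' (alt_word p (star p) b k * p) = 0),
          free_B [set u; star u]%classic [set p; star p]%classic,
          cexp A' u = 0 &
          same_star_dist a (u * p)];
    (* (d) *)
    exists (A' : ncps B) (f : enlargement A A') (u : A'), unitary u /\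
      [/\ forall b : B, u * emb A' b = emb A' b * u,
          free_B [set u; star u]%classic [set f a; star (f a)]%classic,
          forall k : nat, (0 < k)%N -> cexp A' (u ^+ k) = 0 &
          same_star_dist a (u * f a)];
    (* (e) *)
    forall (A' : ncps B) (f : enlargement A A') (u : A'), unitary u ->
      (forall b : B, u * emb A' b = emb A' b * u) ->
      free_B [set u; star u]%classic [set f a; star (f a)]%classic ->
      same_star_dist a (u * f a);
    (* (f) *)
    free_over (B2 A) (cexp2 A)
      [set mk_mx2 0 a (star a) 0]%classic (M2B A);
    (* (g) *)
    forall (j : seq bool) (b : seq B), size j = (size b).+1 ->
      ~~ (sorted (fun k l => k != l) j && ~~ odd (size j)) ->
      cumulant (spow a) j b = 0].
Proof.
have aR := RdiagonalP a.
have bR : Pset_products_vanish a <-> _ := Pset_productsP a.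
have Re := @Rdiag_rotation_invariant _ _ A a.
have ed := @rotation_invariant_haar _ _ A a.
have dc := @haar_rotation_free_polar _ _ A a.
have cR := @free_polar_Rdiag _ _ A a.
have Rf := @Rdiag_mx2_free _ _ A a.
have fR := @mx2_free_Rdiag _ _ A a.
have Rg := @Rdiag_only_alternating _ _ A a.
have gR := @only_alternating_Rdiag _ _ A a.
tfae.
- by move/aR/bR.
- by move/bR/Re/ed/dc.
- by move/cR/Re/ed.
- by move/dc/cR/Re.
- by move/ed/dc/cR/Rf.
- by move/fR/Rg.
- by move/gR/aR.
Qed.
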